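(* Let $\xi$ be an $\mathcal F_1$-measurable random variable and suppose there exists an $\mathbb F$-adapted continuous process $\psi=\{\psi_t,t\in[0,1]\}$ such that for some $\alpha>1-H$ one has $\|\psi\|_{\alpha,1}<\infty$ almost surely, and $\int_0^1\psi_s\,dB^H_s=\xi$ almost surely. Then there exist a number $a>0$ and an $\mathbb F$-adapted process $\{z_t,t\in[0,1]\}$, whose paths are almost surely $a$-H\''older continuous on $[0,1]$, such that $z_1=\xi$.
   Context: Let $(\Omega,\mathcal F,\mathsf P)$ be a complete probability space with a $\mathsf P$-complete left-continuous filtration $\mathbb F=\{\mathcal F_t,t\in[0,1]\}$. Let $B^H=\{B^H_t,t\in[0,1]\}$ be a fractional Brownian motion with Hurst parameter $H\in(1/2,1)$, i.e. an $\mathbb F$-adapted centered Gaussian process with $\mathsf E[B^H_tB^H_s]=\frac12(s^{2H}+t^{2H}-|s-t|^{2H})$, with continuous paths. The H\''older constant of $z$ may be random. For $\alpha>0$ and $t\in(0,1]$ define $$\|f\|_{\alpha,t}=\int_0^t\left(\frac{|f(s)|}{s^\alpha}+\int_0^s\frac{|f(s)-f(z)|}{(s-z)^{1+\alpha}}\,dz\right)ds.$$ (On $[0,1]$, finiteness for some $\alpha$ implies finiteness for every smaller $\alpha$.) Integrals with respect to $B^H$ are pathwise generalized Lebesgue--Stieltjes integrals: if $\|f\|_{\alpha,t}<\infty$ for some $\alpha\in(1-H,1)$, then $$\int_0^t f_s\,dB^H_s=\frac{1}{\Gamma(1-\alpha)\Gamma(\alpha)}\int_0^t\left(\frac{f(x)}{x^\alpha}+\alpha\int_0^x\frac{f(x)-f(u)}{(x-u)^{1+\alpha}}du\right)\left(\frac{B^H_t-B^H_x}{(t-x)^{1-\alpha}}+(1-\alpha)\int_x^t\frac{B^H_u-B^H_x}{(u-x)^{2-\alpha}}du\right)dx.$$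 Almost surely, the second factor is bounded in $x$, and the value does not depend on the choice of such $\alpha$. *)

(* Defs.v *)
From HB Require Import structures.
From mathcomp Require Import all_boot all_order all_algebra.
From mathcomp Require Import all_classical all_reals all_analysis.

Set Implicit Arguments.
Unset Strict Implicit.
Unset Printing Implicit Defensive.

Import Order.TTheory GRing.Theory Num.Theory.
Import numFieldNormedType.Exports.

Local Open Scope classical_set_scope.
Local Open Scope ring_scope.

(* Processes and filtrations indexed by the time interval [0, 1] are functions
   on all of [R]; their values outside [0, 1] are never used. *)

Section filtrations.
Context {d : measure_display} {T : measurableType d} {R : realType}.
Implicit Types (G : set (set T)) (F : R -> set (set T)) (X : R -> T -> R).

Definition is_filtration F :=
  [/\ forall t : R, 0 <= t <= 1 -> sigma_algebra [set: T] (F t),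
      forall t : R, 0 <= t <= 1 -> F t `<=` measurable &
      forall s t : R, 0 <= s -> s <= t -> t <= 1 -> F s `<=` F t].

Definition filtration_complete (P : probability T R) F :=
  forall t : R, 0 <= t <= 1 -> forall N, P.-negligible N -> F t N.

Definition filtration_left_continuous F :=
  forall t : R, 0 < t <= 1 -> F t = <<s \bigcup_(s in `[0, t[) F s >>.

Definition measurable_wrt G (Y : T -> R) :=
  forall A : set R, measurable A -> G (Y @^-1` A).

Definition adapted F X :=
  forall t : R, 0 <= t <= 1 -> measurable_wrt (F t) (X t).

Definition continuous_paths X :=
  forall w, {within `[0, 1], continuous (X ^~ w)}.

End filtrations.

Section fractional_brownian_motion.
Context {d : measure_display} {T : measurableType d} {R : realType}.
Variable P : probability T R.

(* Gaussian law with mean [m] and standard deviation [s]. The library's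
   [normal_prob m 0] is the uniform law on [0, 1], hence the case split. *)
Definition gaussian_prob (m s : R) : set R -> \bar R :=
  if s == 0 then \d_m else normal_prob m s.

Definition gaussian_rv (Y : T -> R) :=
  exists m s : R, 0 <= s /\
    forall A, measurable A -> P (Y @^-1` A) = gaussian_prob m s A.

(* All finite linear combinations of values are (possibly degenerate)
   Gaussian, i.e. all finite-dimensional distributions are Gaussian. *)
Definition gaussian_process (X : R -> T -> R) :=
  forall (n : nat) (t c : 'I_n -> R), (forall i, 0 <= t i <= 1) ->
    gaussian_rv (fun w => \sum_(i < n) c i * X (t i) w).

Definition fBm (H : R) (F : R -> set (set T)) (B : R -> T -> R) :=
  [/\ adapted F B,
      gaussian_process B,
      forall t : R, 0 <= t <= 1 -> ('E_P[B t])%E = 0%:E,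
      forall s t : R, 0 <= s <= 1 -> 0 <= t <= 1 ->
        ('E_P[fun w => (B t w * B s w)%R])%E =
        (2^-1 * (s `^ (2 * H) + t `^ (2 * H) - `|s - t| `^ (2 * H)))%:E &
      continuous_paths B].

End fractional_brownian_motion.

Section generalized_lebesgue_stieltjes.
Context {R : realType}.
Local Notation mu := (@lebesgue_measure R).
Implicit Types (f g : R -> R) (a t x : R).

Definition norm_alpha a t f : \bar R :=
  (\int[mu]_(s in `[0%R, t])
     ((`|f s| / s `^ a)%:E +
      \int[mu]_(z in `[0%R, s]) (`|f s - f z| / (s - z) `^ (1 + a))%:E))%E.

Definition Gamma a : R :=
  \int[mu]_(x in `]0, +oo[) (x `^ (a - 1) * expR (- x)).

(* The two factors of the integrand, without their Gamma normalizations; they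
   are the fractional derivatives of [f] (left-sided, of order [a]) and of
   [g - g t] (right-sided, of order [1 - a]). *)
Definition frac_left a f x : R :=
  f x / x `^ a +
  a * \int[mu]_(u in `[0, x]) ((f x - f u) / (x - u) `^ (1 + a)).

Definition frac_right a t g x : R :=
  (g t - g x) / (t - x) `^ (1 - a) +
  (1 - a) * \int[mu]_(u in `[x, t]) ((g u - g x) / (u - x) `^ (2 - a)).

Definition gLS a t f g : R :=
  (Gamma (1 - a) * Gamma a)^-1 *
  \int[mu]_(x in `[0, t]) (frac_left a f x * frac_right a t g x).

(* [v] is the integral of [f] against [g] over [0, t]. For almost every path
   [g] of a fractional Brownian motion of Hurst parameter [H], the value [v]
   does not depend on the admissible order [a]. *)
Definition is_gLS_integral (H : R) t f g (v : R) :=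
  exists a, [/\ 1 - H < a < 1, (norm_alpha a t f < +oo)%E & v = gLS a t f g].

Definition hoelder01 a f :=
  exists C : R, forall s t : R, 0 <= s <= 1 -> 0 <= t <= 1 ->
    `|f t - f s| <= C * `|t - s| `^ a.

End generalized_lebesgue_stieltjes.

(* Main.v *)
Require Import Defs.
From HB Require Import structures.
From mathcomp Require Import all_boot all_order all_algebra.
From mathcomp Require Import all_classical all_reals all_analysis.
From mathcomp Require Import measurable_realfun.
From mathcomp Require Import ring lra.

Set Implicit Arguments.
Unset Strict Implicit.
Unset Printing Implicit Defensive.

Import Order.TTheory GRing.Theory Num.Theory.
Import numFieldNormedType.Exports.

Local Open Scope classical_set_scope.
Local Open Scope ring_scope.

(* Idea. For [t < 1] put [z_t = \int_0^1 psi(x) b_t(x) dx], where [b_t(x)] is the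
   difference quotient of step [1 - t] at [x] of the path of [B] stopped at [t];
   it only involves times up to [t], so [z_t] is [F_t]-measurable. The product of
   the two fractional derivatives in [gLS] integrates by parts: when the
   integrator has derivative [h], the value of [gLS] is [\int psi h], whatever the
   order. Hence [z_t] is the integral of [psi] against a smoothing of [B] at scale
   [1 - t], and if [B] is q-Hoelder, [norm_alpha] of order [a] is finite and
   [1 - a < p < q], then [|z_t - gLS a 1 psi B| <= C (1 - t) ^ (q - p)]. As [z_t]
   does not depend on [a], neither does its limit [gLS a 1 psi B], so the random
   order of the hypothesis may be replaced by a deterministic one; this gives
   [|z_t - xi| <= C (1 - t) ^ eta] with [eta] deterministic. As [(1 - t) z_t] is
   itself Hoelder in [t], interpolating between the two bounds makes [z], closed
   by [z_1 = xi], Hoelder on [0, 1]. That almost every path of [B] is q-Hoelder for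
   all [q < H] is Kolmogorov's dyadic argument with Gaussian tails. *)

(** * Calculus tools *)

Section improper_FTC.
Context {R : realType}.
Local Notation mu := (@lebesgue_measure R).
Implicit Types (f F : R -> R) (a b la lb : R).

Let eps a b n : R := (b - a) / 3%:R * harmonic n.

Let eps_gt0 a b n : a < b -> 0 < eps a b n.
Proof. by move=> ab; rewrite mulr_gt0 ?divr_gt0 ?subr_gt0//= invr_gt0. Qed.

Let eps_le a b m n : a < b -> (m <= n)%N -> eps a b n <= eps a b m.
Proof.
move=> ab mn; rewrite ler_pM2l ?divr_gt0 ?subr_gt0//.
by rewrite lef_pV2 ?posrE// ler_nat.
Qed.

Let eps_le3 a b n : a < b -> a + eps a b n < b - eps a b n.
Proof.
move=> ab; have := @eps_le a b 0%N n ab isT; rewrite {2}/eps/= invr1 mulr1.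
by move: (eps a b n) => e; lra.
Qed.

Let cvg_eps a b : eps a b n @[n --> \oo] --> 0.
Proof.
rewrite -[X in _ --> X](mulr0 ((b - a) / 3%:R)); apply: cvgMl_tmp.
exact: cvg_harmonic.
Qed.

Let cvg_epsl a b : a < b -> a + eps a b n @[n --> \oo] --> a^'+.
Proof.
move=> ab A [e /= e0 eA].
have /cvgrPdist_lt/(_ e e0)[N _ hN] := @cvg_eps a b.
exists N => // n /hN; rewrite sub0r normrN => ne; apply: eA => /=.
  by rewrite opprD addNKr normrN.
by rewrite ltrDl eps_gt0.
Qed.

Let cvg_epsr a b : a < b -> b - eps a b n @[n --> \oo] --> b^'-.
Proof.
move=> ab A [e /= e0 eA].
have /cvgrPdist_lt/(_ e e0)[N _ hN] := @cvg_eps a b.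
exists N => // n /hN; rewrite sub0r normrN => ne; apply: eA => /=.
  by rewrite opprB addrC subrK.
by rewrite ltrBlDr ltrDl eps_gt0.
Qed.

Let D a b n : set R := `[a + eps a b n, b - eps a b n].

Let bigcup_D a b : a < b -> \bigcup_n D a b n = `]a, b[%classic.
Proof.
move=> ab; apply/seteqP; split=> [x [n _]|x]; rewrite /D/= !in_itv/=.
  move=> /andP[ax xb]; have := eps_gt0 n ab => e0.
  by apply/andP; split; lra.
move=> /andP[ax xb].
have e0 : 0 < Num.min (x - a) (b - x) by rewrite lt_min !subr_gt0 ax xb.
have /cvgrPdist_lt/(_ _ e0)[N _ /(_ N (leqnn _))] := @cvg_eps a b.
rewrite sub0r normrN gtr0_norm ?eps_gt0// lt_min => /andP[e1 e2].
by exists N => //; rewrite /D/= in_itv/=; apply/andP; split; lra.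
Qed.

Let nd_D a b : a < b -> nondecreasing_seq (D a b).
Proof.
move=> ab m n mn; apply/subsetPset => x; rewrite /D/= !in_itv/=.
by have := eps_le ab mn => ? /andP[? ?]; apply/andP; split; lra.
Qed.

Let FTC_D f F a b n : a < b -> {in `]a, b[, continuous f} ->
  (forall x, a < x < b -> is_derive x 1 F (f x)) ->
  (\int[mu]_(x in D a b n) (f x)%:E =
     (F (b - eps a b n) - F (a + eps a b n))%:E)%E.
Proof.
move=> ab cf dF; have e0 := eps_gt0 n ab.
have sub x : a + eps a b n <= x <= b - eps a b n -> a < x < b.
  by move=> /andP[? ?]; apply/andP; split; lra.
have dF' x : a + eps a b n <= x <= b - eps a b n -> derivable F x 1.
  by move=> /sub /dF ?; exact: ex_derive.
have cF x : a + eps a b n <= x <= b - eps a b n -> {for x, continuous F}.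
  by move=> /dF' /derivable1_diffP /differentiable_continuous.
have e1 := eps_le3 n ab.
rewrite /D (@continuous_FTC2 _ f F)//.
- apply: continuous_in_subspaceT => x; rewrite inE/= in_itv/= => /sub xab.
  by apply: cf; rewrite in_itv.
- split.
  + move=> x; rewrite in_itv/= => /andP[? ?]; apply: dF'.
    by apply/andP; split; lra.
  + by apply: cvg_at_right_filter; apply: cF; apply/andP; split; lra.
  + by apply: cvg_at_left_filter; apply: cF; apply/andP; split; lra.
- move=> x; rewrite in_itv/= => /andP[? ?].
  have xab : a < x < b by apply: sub; apply/andP; split; lra.
  by have ? := dF _ xab; rewrite derive1E derive_val.
Qed.

Let cvg_FTC_D f F a b la lb : a < b -> {in `]a, b[, continuous f} ->
  (forall x, a < x < b -> is_derive x 1 F (f x)) ->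
  F x @[x --> a^'+] --> la -> F x @[x --> b^'-] --> lb ->
  (\int[mu]_(x in D a b n) (f x)%:E @[n --> \oo] --> (lb - la)%:E)%E.
Proof.
move=> ab cf dF Fa Fb; under eq_fun do rewrite (FTC_D _ ab cf dF).
apply: cvg_EFin; first by near=> n.
apply: cvgB.
  by apply: (@cvg_comp _ _ _ (fun n => b - eps a b n) F) Fb; exact: cvg_epsr.
by apply: (@cvg_comp _ _ _ (fun n => a + eps a b n) F) Fa; exact: cvg_epsl.
Unshelve. all: by end_near. Qed.

Lemma measurable_continuous_oo f a b :
  {in `]a, b[, continuous f} -> measurable_fun `]a, b[ f.
Proof.
move=> cf; apply: subspace_continuous_measurable_fun => //.
by apply: continuous_in_subspaceT => x; rewrite inE; exact: cf.
Qed.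

Lemma is_derive_derivable F (x d : R) :
  is_derive x 1 F d -> derivable F x 1 /\ 'D_1 F x = d.
Proof. by move=> ?; split; [exact: ex_derive|rewrite derive_val]. Qed.

Let to_is_derive f F a b :
  (forall x, a < x < b -> derivable F x 1 /\ 'D_1 F x = f x) ->
  (forall x, a < x < b -> is_derive x 1 F (f x)).
Proof. by move=> h x /h[dF <-]; exact: derivableP. Qed.

Lemma ge0_improper_FTC f F a b la lb : a < b -> {in `]a, b[, continuous f} ->
  (forall x, a < x < b -> derivable F x 1 /\ 'D_1 F x = f x) ->
  F x @[x --> a^'+] --> la -> F x @[x --> b^'-] --> lb ->
  (forall x, a < x < b -> 0 <= f x) ->
  (\int[mu]_(x in `]a, b[) (f x)%:E = (lb - la)%:E)%E.
Proof.
move=> ab cf /to_is_derive dF Fa Fb f0.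
have mf : measurable_fun `]a, b[ (EFin \o f).
  by apply/measurable_EFinP; exact: measurable_continuous_oo.
have := cvg_FTC_D ab cf dF Fa Fb; rewrite -bigcup_D//; apply: cvg_unique => //.
apply: ge0_nondecreasing_set_cvg_integral.
- exact: nd_D.
- by move=> n; exact: measurable_itv.
- by move=> n; apply: measurable_funS mf => //; rewrite -bigcup_D//; exact: bigcup_sup.
- move=> n x Dx; rewrite lee_fin; apply: f0.
  suff : `]a, b[%classic x by rewrite /= in_itv.
  by rewrite -bigcup_D//; exists n.
Qed.

Lemma improper_FTC f F a b la lb : a < b -> {in `]a, b[, continuous f} ->
  (forall x, a < x < b -> derivable F x 1 /\ 'D_1 F x = f x) ->
  F x @[x --> a^'+] --> la -> F x @[x --> b^'-] --> lb ->
  mu.-integrable `]a, b[ (EFin \o f) ->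
  \int[mu]_(x in `]a, b[) f x = lb - la.
Proof.
move=> ab cf /to_is_derive dF Fa Fb fi.
have mf : measurable_fun `]a, b[ (EFin \o f) by exact: measurable_int fi.
suff: (\int[mu]_(x in `]a, b[) (f x)%:E = (lb - la)%:E)%E.
  by move=> h; rewrite /Rintegral h.
apply: cvg_unique (cvg_FTC_D ab cf dF Fa Fb) => //.
have mD n : measurable (D a b n) by exact: measurable_itv.
have subD n : D a b n `<=` `]a, b[ by rewrite -bigcup_D//; exact: bigcup_sup.
rewrite integralE.
rewrite [X in X @ _](_ : _ = (fun n => \int[mu]_(x in D a b n) (EFin \o f)^\+ x) \-
  (fun n => \int[mu]_(x in D a b n) (EFin \o f)^\- x))%E; last first.
  by apply/funext => n; rewrite integralE.
rewrite -bigcup_D//; apply: cvgeB.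
- rewrite bigcup_D//; apply: fin_num_adde_defr.
  by apply: integrable_pos_fin_num fi; exact: measurable_itv.
- apply: ge0_nondecreasing_set_cvg_integral => //; first exact: nd_D.
  by move=> n; apply: measurable_funepos; apply: measurable_funS mf.
- apply: ge0_nondecreasing_set_cvg_integral => //; first exact: nd_D.
  by move=> n; apply: measurable_funeneg; apply: measurable_funS mf.
Qed.

End improper_FTC.

Section power_integrals.
Context {R : realType}.
Local Notation mu := (@lebesgue_measure R).
Implicit Types (p a b c e u v x : R).

Lemma cvg_powR0 (T : Type) (F : set_system T) (FF : Filter F) (w : T -> R) p :
  0 < p -> w x @[x --> F] --> 0 -> (\forall x \near F, 0 < w x) ->
  w x `^ p @[x --> F] --> 0.
Proof.
move=> p0 w0 wpos; apply: (@cvg_comp _ _ _ w (@powR R ^~ p)) (powR_cvg0 p0).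
move=> A [e /= e0 eA]; near=> x; apply: eA => /=; last by near: x.
by near: x; move/cvgrPdist_lt : w0; exact.
Unshelve. all: by end_near. Qed.

Lemma continuous_powR_comp (w : R -> R) p x :
  {for x, continuous w} -> 0 < w x -> {for x, continuous (fun y => w y `^ p)}.
Proof.
move=> cw wx; apply: (@continuous_comp _ _ _ w (@powR R ^~ p)) => //.
by apply: differentiable_continuous; apply/derivable1_diffP; apply: derivable_powR;
  rewrite in_itv/= wx.
Qed.

Lemma is_derive_powR_comp (w : R -> R) dw p x :
  is_derive x 1 w dw -> 0 < w x ->
  is_derive x 1 (fun y => w y `^ p) (p * w x `^ (p - 1) * dw).
Proof.
move=> dwx wx.
have := @is_derive1_comp _ (@powR R ^~ p) w x _ _ (is_derive1_powR p wx) dwx.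
by rewrite mulrC.
Qed.

Lemma is_derive_subl v u : is_derive u 1 (fun u => v - u) (-1).
Proof. by have := is_deriveB (is_derive_cst v u 1) (is_derive_id u 1); rewrite sub0r. Qed.

Lemma integral_powR_right p x b : 0 < p -> x <= b ->
  (\int[mu]_(u in `[x, b]) ((u - x) `^ (p - 1))%:E = ((b - x) `^ p / p)%:E)%E.
Proof.
move=> p0; rewrite le_eqVlt => /predU1P[<-|xb].
  by rewrite set_itv1 integral_set1 subrr powR0 ?gt_eqF// mul0r.
have cu u : {for u, continuous (fun u => u - x)}.
  by apply: continuousB; [exact: cvg_id|exact: cvg_cst].
have cf : {in `]x, b[, continuous (fun u => (u - x) `^ (p - 1))}.
  move=> u; rewrite in_itv/= => /andP[xu _].
  apply: (@continuous_powR_comp (fun u => u - x)); first exact: cu.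
  by rewrite subr_gt0.
rewrite integral_itv_bndoo; last first.
  by apply/measurable_EFinP; exact: measurable_continuous_oo.
apply: etrans; [apply: (@ge0_improper_FTC _ _ (fun u => (u - x) `^ p / p) x b 0 ((b - x) `^ p / p)) => //|by rewrite ?subr0].
- move=> u /andP[xu ub].
  have du : is_derive u 1 (fun u => u - x) 1.
    by apply: is_derive_eq; rewrite subr0.
  have xu0 : 0 < u - x by rewrite subr_gt0.
  apply: is_derive_derivable; have := is_derive_powR_comp p du xu0 => dp.
  apply: is_derive_eq; rewrite mulr1 /GRing.scale/=; field.
  by rewrite gt_eqF.
- rewrite -[X in _ --> X](mul0r p^-1); apply: cvgMr_tmp.
  apply: cvg_powR0 => //; last first.
    by near=> u; rewrite subr_gt0; near: u; exact: nbhs_right_gt.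
  by rewrite -(subrr x); apply: cvg_at_right_filter; exact: cu.
- apply: cvg_at_left_filter; apply: cvgMr_tmp.
  apply: (@continuous_powR_comp (fun u => u - x)); first exact: cu.
  by rewrite subr_gt0.
- by move=> *; rewrite powR_ge0.
Unshelve. all: by end_near. Qed.

Lemma integral_powR_left p c v : 0 < p -> c <= v ->
  (\int[mu]_(u in `[c, v]) ((v - u) `^ (p - 1))%:E = ((v - c) `^ p / p)%:E)%E.
Proof.
move=> p0; rewrite le_eqVlt => /predU1P[<-|cv].
  by rewrite set_itv1 integral_set1 subrr powR0 ?gt_eqF// mul0r.
have cu u : {for u, continuous (fun u => v - u)}.
  by apply: continuousB; [exact: cvg_cst|exact: cvg_id].
have cf : {in `]c, v[, continuous (fun u => (v - u) `^ (p - 1))}.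
  move=> u; rewrite in_itv/= => /andP[_ uv].
  apply: (@continuous_powR_comp (fun u => v - u)); first exact: cu.
  by rewrite subr_gt0.
rewrite integral_itv_bndoo; last first.
  by apply/measurable_EFinP; exact: measurable_continuous_oo.
apply: etrans; [apply: (@ge0_improper_FTC _ _ (fun u => - ((v - u) `^ p / p)) c v
  (- ((v - c) `^ p / p)) 0) => //|by rewrite ?sub0r ?opprK].
- move=> u /andP[cu' uv].
  have du := is_derive_subl v u.
  have uv0 : 0 < v - u by rewrite subr_gt0.
  apply: is_derive_derivable; have := is_derive_powR_comp p du uv0 => dp.
  apply: is_derive_eq; rewrite /GRing.scale/=; field.
  by rewrite gt_eqF.
- apply: cvg_at_right_filter; apply: cvgN; apply: cvgMr_tmp.
  apply: (@continuous_powR_comp (fun u => v - u)); first exact: cu.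
  by rewrite subr_gt0.
- rewrite -oppr0; apply: cvgN; rewrite -[X in _ --> X](mul0r p^-1); apply: cvgMr_tmp.
  apply: cvg_powR0 => //; last first.
    by near=> u; rewrite subr_gt0; near: u; exact: nbhs_left_lt.
  by rewrite -(subrr v); apply: cvg_at_left_filter; exact: cu.
- by move=> *; rewrite powR_ge0.
Unshelve. all: by end_near. Qed.

(* The substitution [w = (v - x) / (x - u + e)] makes the integrand exact. *)
Lemma integral_powR_convolution p e u v : 0 < p -> 0 < e -> u < v ->
  (\int[mu]_(x in `[u, v]) ((v - x) `^ (p - 1) * (x - u + e) `^ (- (1 + p)))%:E =
   ((v - u) `^ p / (p * e `^ p * (v - u + e)))%:E)%E.
Proof.
move=> p0 e0 uv.
have vue : 0 < v - u + e by rewrite addr_gt0// subr_gt0.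
have cl x : {for x, continuous (fun x => v - x)}.
  by apply: continuousB; [exact: cvg_cst|exact: cvg_id].
have cr x : {for x, continuous (fun x => x - u + e)}.
  by apply: continuousD; [apply: continuousB; [exact: cvg_id|exact: cvg_cst]|exact: cvg_cst].
have cf : {in `]u, v[, continuous
    (fun x => (v - x) `^ (p - 1) * (x - u + e) `^ (- (1 + p)))}.
  move=> x; rewrite in_itv/= => /andP[ux xv]; apply: cvgM.
    by apply: (@continuous_powR_comp (fun x => v - x)); [exact: cl|rewrite subr_gt0].
  apply: (@continuous_powR_comp (fun x => x - u + e)); first exact: cr.
  by rewrite addr_gt0// subr_gt0.
pose w x := (v - x) / (x - u + e).
have cw x : u <= x -> {for x, continuous w}.
  move=> ux; apply: cvgM; first exact: cl.
  by apply: cvgV; [rewrite gt_eqF// ltr_wpDl// subr_ge0|exact: cr].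
have w0 x : u <= x < v -> 0 < w x.
  by move=> /andP[ux xv]; rewrite divr_gt0 ?subr_gt0// ltr_wpDl// subr_ge0.
rewrite integral_itv_bndoo; last first.
  by apply/measurable_EFinP; exact: measurable_continuous_oo.
apply: etrans; [apply: (@ge0_improper_FTC _ _ (fun x => - (w x `^ p / (p * (v - u + e)))) u v
  (- (w u `^ p / (p * (v - u + e)))) 0) => //|].
- move=> x /andP[ux xv].
  have xue : 0 < x - u + e by rewrite addr_gt0// subr_gt0.
  have xue0 : x - u + e != 0 by rewrite gt_eqF.
  have dw : is_derive x 1 w (- ((v - u + e) / (x - u + e) ^+ 2)).
    have dr : is_derive x 1 (fun x => x - u + e) 1.
      by apply: is_derive_eq; rewrite subr0 addr0.
    have := is_deriveM (is_derive_subl v x) (@is_deriveV _ (fun x => x - u + e) x _ _ xue0 dr) => dw.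
    by apply: is_derive_eq; rewrite /GRing.scale/=; field.
  have wx : 0 < w x by apply: w0; rewrite xv ltW.
  apply: is_derive_derivable; have := is_derive_powR_comp p dw wx => dp.
  have wE : w x `^ (p - 1) = (v - x) `^ (p - 1) * (x - u + e) `^ (- (p - 1)).
    rewrite /w powRM ?invr_ge0 ?subr_ge0 ?ltW//.
    by rewrite -(powR_inv1 (ltW xue)) -powRrM mulN1r.
  apply: is_derive_eq; rewrite /GRing.scale/= wE mulr0 add0r.
  have -> : - (1 + p) = - (p - 1) + (- 2%:R) by ring.
  rewrite (@powRD _ (x - u + e)) ?xue0 ?implybT// (powR_invn _ (ltW xue)).
  by field; rewrite !gt_eqF.
- apply: cvg_at_right_filter; apply: cvgN; apply: cvgMr_tmp.
  apply: (@continuous_powR_comp w); first exact: cw.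
  by apply: w0; rewrite lexx.
- rewrite -oppr0; apply: cvgN; rewrite -[X in _ --> X](mul0r (p * (v - u + e))^-1).
  apply: cvgMr_tmp; apply: cvg_powR0 => //; last first.
    near=> x; apply: w0; apply/andP; split; near: x; last exact: nbhs_left_lt.
    exact: nbhs_left_ge.
  have -> : 0 = w v by rewrite /w subrr mul0r.
  by apply: cvg_at_left_filter; apply: cw; exact: ltW.
- by move=> *; rewrite mulr_ge0// powR_ge0.
- rewrite sub0r opprK; congr EFin; rewrite /w subrr add0r powRM ?invr_ge0 ?subr_ge0 ?ltW//.
  rewrite -powR_inv1 ?ltW// -powRrM mulN1r powRN.
  by field; rewrite !gt_eqF// powR_gt0.
Unshelve. all: by end_near. Qed.

Lemma integral_powR_shift p e x : 0 < p -> 0 < e -> 0 <= x ->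
  (\int[mu]_(u in `[0%R, x]) ((x - u + e) `^ (- (1 + p)))%:E =
   ((e `^ (- p) - (x + e) `^ (- p)) / p)%:E)%E.
Proof.
move=> p0 e0; rewrite le_eqVlt => /predU1P[<-|x0].
  by rewrite set_itv1 integral_set1 add0r subrr mul0r.
have cr u : {for u, continuous (fun u => x - u + e)}.
  by apply: continuousD; [apply: continuousB; [exact: cvg_cst|exact: cvg_id]|exact: cvg_cst].
have pos u : u <= x -> 0 < x - u + e by move=> ux; rewrite ltr_wpDl// subr_ge0.
have cpow u : u <= x -> (x - y + e) `^ (- p) / p @[y --> u] --> (x - u + e) `^ (- p) / p.
  move=> ux; apply: cvgMr_tmp; apply: (@continuous_powR_comp (fun u => x - u + e)).
    exact: cr.
  exact: pos.
have cf : {in `]0, x[, continuous (fun u => (x - u + e) `^ (- (1 + p)))}.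
  move=> u; rewrite in_itv/= => /andP[_ ux].
  by apply: (@continuous_powR_comp (fun u => x - u + e)); [exact: cr|apply: pos; exact: ltW].
rewrite integral_itv_bndoo; last first.
  by apply/measurable_EFinP; exact: measurable_continuous_oo.
apply: etrans; [apply: (@ge0_improper_FTC _ _ (fun u => (x - u + e) `^ (- p) / p) 0 x
  ((x + e) `^ (- p) / p) (e `^ (- p) / p)) => //|by rewrite ?mulrBl].
- move=> u /andP[u0 ux].
  have du : is_derive u 1 (fun u => x - u + e) (-1).
    by have := is_deriveD (is_derive_subl x u) (is_derive_cst e u 1); rewrite addr0.
  apply: is_derive_derivable; have := is_derive_powR_comp (- p) du (pos _ (ltW ux)) => dp.
  apply: is_derive_eq; rewrite /GRing.scale/= [- (1 + p)]opprD addrC.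
  by rewrite [- p - 1]addrC [- 1 - p]addrC; field; rewrite gt_eqF.
- by have /cvg_at_right_filter := cpow _ (ltW x0); rewrite subr0.
- by have /cvg_at_left_filter := cpow _ (lexx x); rewrite subrr add0r.
- by move=> *; rewrite powR_ge0.
Qed.

End power_integrals.

Section lebesgue_affine.
Context {R : realType}.
Local Notation mu := (@lebesgue_measure R).

Let affine (c d : R) : measurableTypeR R -> measurableTypeR R := fun x => c * x + d.

Let measurable_affine c d : measurable_fun setT (affine c d).
Proof.
apply: continuous_measurable_fun => x; apply: cvgD; last exact: cvg_cst.
by apply: cvgMl_tmp; exact: cvg_id.
Qed.

Let affine_measure (c d : R) : {measure set (measurableTypeR R) -> \bar R}.
Proof.
refine (mscale (`|c|)%:nng (pushforward mu (affine c d))).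
exact: measurable_affine.
Defined.

Let affine_measureE (c d : R) A : c != 0 -> measurable A -> mu A = affine_measure c d A.
Proof.
move=> c0; apply: lebesgue_measure_unique => _ [[a b] _ <-] /=.
rewrite /mscale/= /pushforward.
have [ab|ba] := ltP a b; last first.
  rewrite set_itv_ge ?bnd_simp -?leNgt// preimage_set0 !measure0.
  by rewrite mule0.
have [cpos|cneg] := ltP 0 c.
  rewrite (_ : _ @^-1` _ = `](a - d) / c, (b - d) / c]%classic); last first.
    apply/seteqP; split=> x /=; rewrite !in_itv/= /affine;
      by rewrite ltr_pdivrMr// ler_pdivlMr// ltrBlDr lerBrDr mulrC.
  rewrite !lebesgue_measure_itv/= !lte_fin ab ltr_pM2r ?invr_gt0// ltrD2r ab.
  rewrite -!EFinB -EFinM gtr0_norm//; congr EFin; field.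
  by rewrite gt_eqF.
have {}cneg : c < 0 by rewrite lt_neqAle c0.
rewrite (_ : _ @^-1` _ = `[(b - d) / c, (a - d) / c[%classic); last first.
  apply/seteqP; split=> x /=; rewrite !in_itv/= /affine;
    by rewrite ltr_ndivlMr// ler_ndivrMr// ltrBlDr lerBrDr andbC mulrC.
rewrite !lebesgue_measure_itv/= !lte_fin ab ltr_nM2r ?invr_lt0// ltrD2r ab.
by rewrite -!EFinB -EFinM ltr0_norm//; congr EFin; field.
Qed.

Lemma ge0_integral_affine (f : R -> \bar R) (c d : R) : c != 0 ->
  measurable_fun setT f -> (forall x, (0 <= f x)%E) ->
  (\int[mu]_x f (c * x + d)%R = (`|c|^-1)%:E * \int[mu]_x f x)%E.
Proof.
move=> c0 mf f0.
have -> : (\int[mu]_x f x = `|c|%:E * \int[mu]_x f (c * x + d)%R)%E.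
  rewrite (@eq_measure_integral _ _ _ _ (affine_measure c d)); last first.
    by move=> A mA _; exact: affine_measureE.
  rewrite ge0_integral_mscale//= ge0_integral_pushforward//.
by rewrite muleA -EFinM mulVf ?mul1e// normr_eq0.
Qed.

Lemma integrable_affine (f : R -> R) (c d : R) : c != 0 ->
  mu.-integrable setT (EFin \o f) ->
  mu.-integrable setT (EFin \o (fun x => f (c * x + d))).
Proof.
move=> c0 /integrableP[mf fi].
have maff : measurable_fun setT (fun x => f (c * x + d)).
  apply: (@measurableT_comp _ _ _ _ _ _ f); first exact/measurable_EFinP.
  exact: measurable_affine.
apply/integrableP; split; first exact/measurable_EFinP.
rewrite (@ge0_integral_affine (fun x => `|(f x)%:E|%E))//.
  by rewrite lte_mul_pinfty ?lee_fin ?invr_ge0.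
exact: measurableT_comp.
Qed.

Lemma Rintegral_affine (f : R -> R) (c d : R) : c != 0 ->
  mu.-integrable setT (EFin \o f) ->
  \int[mu]_x f (c * x + d)%R = `|c|^-1 * \int[mu]_x f x.
Proof.
move=> c0 fi; have mf : measurable_fun setT (EFin \o f) by exact: measurable_int fi.
rewrite /Rintegral [in LHS]integralE [in RHS]integralE.
have -> : (\int[mu]_x ((fun x => (f (c * x + d))%:E)^\+ x) =
    `|c|^-1%:E * \int[mu]_x (EFin \o f)^\+ x)%E.
  rewrite -(@ge0_integral_affine (EFin \o f)^\+%E c d)//.
    by apply: eq_integral => x _; rewrite !funeposE.
  exact: measurable_funepos.
have -> : (\int[mu]_x ((fun x => (f (c * x + d))%:E)^\- x) =
    `|c|^-1%:E * \int[mu]_x (EFin \o f)^\- x)%E.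
  rewrite -(@ge0_integral_affine (EFin \o f)^\-%E c d)//.
    by apply: eq_integral => x _; rewrite !funenegE.
  exact: measurable_funeneg.
have fp : (\int[mu]_x (EFin \o f)^\+ x)%E \is a fin_num.
  by apply: integrable_pos_fin_num fi.
have fn : (\int[mu]_x (EFin \o f)^\- x)%E \is a fin_num.
  by apply: integrable_neg_fin_num fi.
transitivity (`|c|^-1 * fine (\int[mu]_x (EFin \o f)^\+ x - \int[mu]_x (EFin \o f)^\- x)%E) => //.
by rewrite -(fineK fp) -(fineK fn) -!EFinM -!EFinB/= mulrBr.
Qed.

End lebesgue_affine.

Section parametric_integrals.
Context {R : realType}.
Local Notation mu := (@lebesgue_measure R).

Lemma measurable_fun_Rintegral d (T : measurableType d) (f : T * R -> R) :
  measurable_fun setT f -> measurable_fun setT (fun x => \int[mu]_y f (x, y)).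
Proof.
move=> mf; rewrite /Rintegral.
have mf' : measurable_fun setT (EFin \o f) by exact/measurable_EFinP.
apply: (@measurableT_comp _ _ _ _ _ _ fine) => //.
rewrite (_ : (fun x => _) = (fun x => \int[mu]_y (EFin \o f)^\+ (x, y)) \-
   (fun x => \int[mu]_y (EFin \o f)^\- (x, y)))%E; last first.
  apply/funext => x; rewrite integralE; congr (_ - _)%E;
    by apply: eq_integral => y _; rewrite ?funeposE ?funenegE.
apply: emeasurable_funB.
- apply: (measurable_fun_fubini_tonelli_F (m2 := mu) (EFin \o f)^\+%E) => //.
  exact: measurable_funepos.
- apply: (measurable_fun_fubini_tonelli_F (m2 := mu) (EFin \o f)^\-%E) => //.
  exact: measurable_funeneg.
Qed.

Lemma Rintegral_Fubini (f : R * R -> R) :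
  (mu \x mu)%E.-integrable setT (EFin \o f) ->
  \int[mu]_x \int[mu]_y f (x, y) = \int[mu]_y \int[mu]_x f (x, y).
Proof.
move=> fi; rewrite /Rintegral; congr fine.
have eF (g : R -> \bar R) : mu.-integrable setT g ->
    (\int[mu]_x (fine (g x))%:E = \int[mu]_x g x)%E.
  move=> gi; have mg := measurable_int _ gi; apply: ae_eq_integral => //.
    by apply/measurable_EFinP; exact: measurableT_comp.
  have := integrable_ae measurableT gi; apply: filterS => x /= h _.
  by rewrite fineK// h.
rewrite (eF (fun x => \int[mu]_y (f (x, y))%:E)%E); last exact: integrable_fubini_F fi.
rewrite (eF (fun y => \int[mu]_x (f (x, y))%:E)%E); last first.
  have fi' : (mu \x mu)%E.-integrable setT (EFin \o f \o (fun z => (z.2, z.1))).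
    have mf := measurable_int _ fi.
    have mf' : measurable_fun setT (EFin \o f \o (fun z => (z.2, z.1))).
      by apply: measurableT_comp => //; exact: measurable_swap.
    apply: (iffRL (@integrable12ltyP _ _ _ _ _ mu mu _ mf')).
    exact: (iffLR (@integrable21ltyP _ _ _ _ _ mu mu _ mf)).
  exact: integrable_fubini_F fi'.
exact: (Fubini fi).
Qed.

Let tri (b : R) : set (R * R) := [set z | (0 <= z.1) && (z.1 <= z.2) && (z.2 <= b)].

Let measurable_tri b : measurable (tri b).
Proof.
rewrite -[tri b]setTI.
have m : measurable_fun [set: R * R] (fun z => (0 <= z.1) && (z.1 <= z.2) && (z.2 <= b)).
  by apply: measurable_and; [apply: measurable_and|]; apply: measurable_fun_ler.
have := m measurableT [set true] I.
by congr measurable; apply/seteqP; split=> z [] //= _ ->.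
Qed.

Let patch_tri1 (f : R * R -> R) (b x y : R) : x \in `[0, b] ->
  (f \_ (tri b)) (x, y) = ((fun y => f (x, y)) \_ `[x, b]) y.
Proof.
rewrite in_itv/= => /andP[x0 xb]; rewrite !patchE.
rewrite (_ : ((x, y) \in tri b) = (y \in `[x, b]%classic))//.
by apply/idP/idP => /set_mem h; apply/mem_set; move: h; rewrite /tri/= in_itv/= x0.
Qed.

Let patch_tri1N (f : R * R -> R) (b x y : R) : x \notin `[0, b] ->
  (f \_ (tri b)) (x, y) = 0.
Proof.
move=> xb; rewrite patchE ifF//; apply/negbTE/negP.
rewrite inE/= => /andP[/andP[x0 xy] yb]; move/negP : xb; apply.
by rewrite in_itv/= x0 (le_trans xy).
Qed.

Let patch_tri2 (f : R * R -> R) (b x y : R) : y \in `[0, b] ->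
  (f \_ (tri b)) (x, y) = ((fun x => f (x, y)) \_ `[0, y]) x.
Proof.
rewrite in_itv/= => /andP[y0 yb]; rewrite !patchE.
rewrite (_ : ((x, y) \in tri b) = (x \in `[0, y]%classic))//.
by apply/idP/idP => /set_mem h; apply/mem_set; move: h; rewrite /tri/= in_itv/= yb andbT.
Qed.

Let patch_tri2N (f : R * R -> R) (b x y : R) : y \notin `[0, b] ->
  (f \_ (tri b)) (x, y) = 0.
Proof.
move=> yb; rewrite patchE ifF//; apply/negbTE/negP.
rewrite inE/= => /andP[/andP[x0 xy] y1]; move/negP : yb; apply.
by rewrite in_itv/= y1 (le_trans x0).
Qed.

Lemma Rintegral_triangle (f : R * R -> R) b : measurable_fun setT f ->
  (\int[mu]_(x in `[0%R, b]) \int[mu]_(y in `[x, b]) `|f (x, y)|%:E < +oo)%E ->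
  \int[mu]_(x in `[0, b]) \int[mu]_(y in `[x, b]) f (x, y) =
  \int[mu]_(y in `[0, b]) \int[mu]_(x in `[0, y]) f (x, y).
Proof.
move=> mf fi; pose g := f \_ (tri b).
have mg : measurable_fun setT (EFin \o g).
  by apply/measurable_EFinP/(measurable_restrictT f) => //; exact: measurable_funTS.
have gi : (mu \x mu)%E.-integrable setT (EFin \o g).
  apply: (iffRL (@integrable12ltyP _ _ _ _ _ mu mu _ mg)); apply: le_lt_trans fi.
  rewrite [leRHS]integral_mkcond; rewrite le_eqVlt; apply/orP; left; apply/eqP; apply: eq_integral => x _.
  rewrite patchE; case: ifPn => [|] xb.
    have {}xb : x \in `[0, b] by move: xb; rewrite inE.
    rewrite [RHS]integral_mkcond; apply: eq_integral => y _ /=.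
    rewrite /g patch_tri1//.
    by rewrite !patchE; case: ifPn => //; rewrite normr0.
  have {}xb : x \notin `[0, b] by apply: contra xb; rewrite inE.
  rewrite integral0_eq// => y _ /=.
  by rewrite /g patch_tri1N// normr0.
have := Rintegral_Fubini gi.
have -> : \int[mu]_x \int[mu]_y g (x, y) =
    \int[mu]_(x in `[0, b]) \int[mu]_(y in `[x, b]) f (x, y).
  rewrite [RHS]Rintegral_mkcond; apply: eq_Rintegral => x _.
  rewrite patchE; case: ifPn => xb.
    have {}xb : x \in `[0, b] by move: xb; rewrite inE.
    by rewrite [RHS]Rintegral_mkcond; apply: eq_Rintegral => y _; rewrite /g patch_tri1.
  have {}xb : x \notin `[0, b] by apply: contra xb; rewrite inE.
  rewrite (_ : (fun y => g (x, y)) = fun=> 0); last first.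
    by apply/funext => y; rewrite /g patch_tri1N.
  by rewrite /Rintegral integral0.
move=> ->; rewrite [RHS]Rintegral_mkcond; apply: eq_Rintegral => y _.
rewrite patchE; case: ifPn => yb.
  have {}yb : y \in `[0, b] by move: yb; rewrite inE.
  by rewrite [RHS]Rintegral_mkcond; apply: eq_Rintegral => x _; rewrite /g patch_tri2.
have {}yb : y \notin `[0, b] by apply: contra yb; rewrite inE.
rewrite (_ : (fun x => g (x, y)) = fun=> 0); last first.
  by apply/funext => x; rewrite /g patch_tri2N.
by rewrite /Rintegral integral0.
Qed.

End parametric_integrals.

Section gamma_reflection.
Context {R : realType}.
Local Notation mu := (@lebesgue_measure R).
Implicit Types (a p k s x y : R).

Lemma integral_indicM d (T : measurableType d) (m : {measure set T -> \bar R})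
    (D : set T) (f : T -> R) :
  (\int[m]_(x in D) (f x)%:E = \int[m]_x (\1_D x * f x)%:E)%E.
Proof.
rewrite integral_mkcond; apply: eq_integral => x _.
by rewrite patchE indicE; case: (x \in D); rewrite ?mul1r ?mul0r.
Qed.

Lemma measurable_invr : measurable_fun [set: R] (@GRing.inv R).
Proof.
have -> : (@GRing.inv R) = (fun x => x * (x * x) `^ (-1)).
  apply/funext => x; rewrite powR_inv1 -?expr2 ?sqr_ge0//.
  have [->|x0] := eqVneq x 0; first by rewrite invr0 mul0r.
  by field.
apply: measurable_funM => //; apply: (@measurableT_comp _ _ _ _ _ _ (fun y => y `^ (-1))).
  exact: measurable_powR.
exact: measurable_funM.
Qed.

Let pos : set R := `]0, +oo[.

Let measurable_pos : measurable pos. Proof. exact: measurable_itv. Qed.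

Lemma integral_expR_pos k : 0 < k ->
  (\int[mu]_(y in `]0%R, +oo[) (expR (- (k * y)))%:E = (k^-1)%:E)%E.
Proof.
move=> k0; have mf : measurable_fun setT (fun y => expR (- (k * y))).
  apply: (@measurableT_comp _ _ _ _ _ _ expR) => //.
  by apply: measurableT_comp => //; exact: measurable_funM.
rewrite integral_itv_obnd_cbnd; last by apply/measurable_EFinP; exact: measurable_funTS.
have dF y : is_derive y 1 (fun y => - (expR (- (k * y)) / k)) (expR (- (k * y))).
  by apply: is_derive_eq; rewrite /GRing.scale/=; field; rewrite gt_eqF.
rewrite (@ge0_continuous_FTC2y _ _ (fun y => - (expR (- (k * y)) / k)) 0 0).
- by rewrite mulr0 oppr0 expR0 -EFinB sub0r opprK mul1r.
- by move=> *; exact: expR_ge0.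
- apply: continuous_subspaceT => y; apply: continuous_comp; last exact: continuous_expR.
  by apply: cvgN; apply: cvgMl_tmp; exact: cvg_id.
- rewrite -oppr0; apply: cvgN; rewrite -[X in _ --> X](mul0r k^-1); apply: cvgMr_tmp.
  apply: (@cvg_comp _ _ _ (fun y => k * y) (fun y => expR (- y))); last exact: cvgr_expR.
  exact: gt0_cvgMry.
- by move=> y _; exact: ex_derive.
- have c0 : {for 0, continuous (fun y => - (expR (- (k * y)) / k))}.
    by apply: differentiable_continuous; apply/derivable1_diffP; exact: ex_derive.
  exact: (cvg_at_right_filter c0).
- by move=> y _; rewrite derive1E derive_val.
Qed.

Let G p : \bar R := (\int[mu]_(x in pos) (x `^ (p - 1) * expR (- x))%:E)%E.

Let measurable_gamma_fun p : measurable_fun setT (fun x => x `^ (p - 1) * expR (- x)).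
Proof.
apply: measurable_funM; first exact: measurable_powR.
by apply: (@measurableT_comp _ _ _ _ _ _ expR).
Qed.

Let integral_powR_01 p : 0 < p -> (\int[mu]_(x in `]0%R, 1%R]) (x `^ (p - 1))%:E = (p^-1)%:E)%E.
Proof.
move=> p0; rewrite integral_itv_obnd_cbnd.
  have := @integral_powR_right _ p 0 1 p0 ler01.
  under eq_integral do rewrite subr0.
  by rewrite subr0 powR1 div1r.
by apply/measurable_EFinP; apply: measurable_funTS; exact: measurable_powR.
Qed.

Let G_lty p : 0 < p -> p < 1 -> (G p < +oo)%E.
Proof.
move=> p0 p1.
pose f x := \1_(`]0, 1]) x * x `^ (p - 1) + \1_pos x * expR (- (1 * x)).
have mind (D : set R) : measurable D -> measurable_fun [set: R] (\1_D : R -> R).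
  by move=> mD; exact: measurable_indic.
have m1 : measurable_fun [set: R] (fun x => \1_(`]0%R, 1%R]) x * x `^ (p - 1)).
  by apply: measurable_funM; [exact: mind|exact: measurable_powR].
have m2 : measurable_fun [set: R] (fun x => \1_pos x * expR (- (1 * x))).
  apply: measurable_funM; first exact: mind.
  apply: (@measurableT_comp _ _ _ _ _ _ expR) => //.
  by apply: measurableT_comp => //; exact: measurable_funM.
rewrite /G integral_indicM; apply: (@le_lt_trans _ _ (\int[mu]_x (f x)%:E)%E).
  apply: ge0_le_integral => //.
  - by move=> x _; rewrite lee_fin !mulr_ge0// ?powR_ge0 ?expR_ge0.
  - by apply/measurable_EFinP; apply: measurable_funM; [exact: mind|exact: measurable_gamma_fun].
  - by apply/measurable_EFinP; exact: measurable_funD.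
  - move=> x _; rewrite lee_fin /f /pos !indicE.
    have [x0|x0] := ltP 0 x; last first.
      rewrite !memNset ?mul0r ?addr0//= in_itv/=; first by rewrite ltNge x0.
      by rewrite andbT ltNge x0.
    rewrite (mem_set (_ : `]0, +oo[%classic x)) ?mul1r; last by rewrite /= in_itv/= x0.
    have [x1|x1] := leP x 1.
      rewrite mem_set ?mul1r; last by rewrite /= in_itv/= x0 x1.
      rewrite -[leLHS]addr0 lerD ?expR_ge0//.
      by rewrite ler_piMr ?powR_ge0// expRN invf_le1 ?expR_gt0// -expR0 ler_expR ltW.
    rewrite memNset ?mul0r ?add0r; last by rewrite /= in_itv/= x0 leNgt x1.
    rewrite ler_piMl ?expR_ge0// -[leRHS](powRr0 x); apply: ler_powR.
      exact: ltW.
    by rewrite subr_le0 ltW.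
under eq_integral do rewrite EFinD.
rewrite ge0_integralD//.
- rewrite -!integral_indicM lte_add_pinfty//.
    by rewrite integral_powR_01// ltry.
  by rewrite integral_expR_pos// ltry.
- by move=> x _; rewrite lee_fin mulr_ge0// powR_ge0.
- exact/measurable_EFinP.
- exact/measurable_EFinP.
Qed.

Let G_ge0 p : (0 <= G p)%E.
Proof. by apply: integral_ge0 => x _; rewrite lee_fin mulr_ge0// ?powR_ge0 ?expR_ge0. Qed.

Let G_gt0 p : 0 < p -> (0 < G p)%E.
Proof.
move=> p0; apply: (@lt_le_trans _ _ ((expR (- 1))%:E * (p^-1)%:E)%E).
  by rewrite -EFinM lte_fin mulr_gt0 ?invr_gt0 ?expR_gt0.
rewrite -integral_powR_01// -ge0_integralZl//; last 2 first.
- by apply/measurable_EFinP; apply: measurable_funTS; exact: measurable_powR.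
- by move=> x _; rewrite lee_fin powR_ge0.
apply: (@le_trans _ _ (\int[mu]_(x in `]0%R, 1%R]) (x `^ (p - 1) * expR (- x))%:E)%E).
  apply: ge0_le_integral => //.
  - by move=> x _; rewrite -EFinM lee_fin mulr_ge0// ?powR_ge0 ?expR_ge0.
  - apply/measurable_EFinP; apply: measurable_funTS.
    by apply: measurable_funM => //; exact: measurable_powR.
  - by apply/measurable_EFinP; apply: measurable_funTS; exact: measurable_gamma_fun.
  - move=> x; rewrite /= in_itv/= => /andP[_ x1].
    by rewrite -EFinM lee_fin mulrC ler_wpM2l ?powR_ge0// ler_expR lerN2.
apply: ge0_subset_integral => //.
- by apply/measurable_EFinP; apply: measurable_funTS; exact: measurable_gamma_fun.
- by move=> x _; rewrite lee_fin mulr_ge0// ?powR_ge0 ?expR_ge0.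
- by move=> x; rewrite /pos/= !in_itv/= => /andP[->].
Qed.

Let G_scale p y : 0 < p -> 0 < y ->
  G p = (\int[mu]_(s in pos) (y `^ p * s `^ (p - 1) * expR (- (y * s)))%:E)%E.
Proof.
move=> p0 y0; rewrite [RHS]integral_indicM.
have := @ge0_integral_affine _ (fun x => (\1_pos x * (x `^ (p - 1) * expR (- x)))%:E) y 0.
rewrite gt_eqF// => /(_ isT).
rewrite gtr0_norm// => h.
have GE : G p = (\int[mu]_x (\1_pos x * (x `^ (p - 1) * expR (- x)))%:E)%E.
  by rewrite /G integral_indicM.
have {}h : (\int[mu]_x (\1_pos (y * x + 0)%R *
   ((y * x + 0) `^ (p - 1) * expR (- (y * x + 0))))%:E = (y^-1)%:E * G p)%E.
  rewrite GE; apply: h; last by move=> x; rewrite lee_fin !mulr_ge0// ?powR_ge0 ?expR_ge0.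
  apply/measurable_EFinP; apply: measurable_funM; first exact: measurable_indic.
  exact: measurable_gamma_fun.
have -> : G p = (y%:E * ((y^-1)%:E * G p))%E.
  by rewrite muleA -EFinM divff ?mul1e// gt_eqF.
rewrite -h.
rewrite -ge0_integralZl.
- apply: eq_integral => s _; rewrite -EFinM addr0; congr EFin.
  rewrite !indicE /pos; have [s0|s0] := ltP 0 s; last first.
    rewrite !memNset ?mul0r ?mulr0//= in_itv/= andbT; first by rewrite ltNge s0.
    by rewrite pmulr_rgt0// ltNge s0.
  rewrite !mem_set ?mul1r/= ?in_itv/= ?andbT ?pmulr_rgt0//.
  by rewrite powRM ?(ltW y0) ?(ltW s0)// !mulrA mulr_powRB1 ?(ltW y0).
- by [].
- apply/measurable_EFinP.
  apply: (@measurableT_comp _ _ _ _ _ _ (fun x => \1_pos x * (x `^ (p - 1) * expR (- x)))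
    _ (fun x => y * x + 0)).
    by apply: measurable_funM; [exact: measurable_indic|exact: measurable_gamma_fun].
  by apply: measurable_funD => //; exact: measurable_funM.
- by move=> x _; rewrite lee_fin !mulr_ge0// ?powR_ge0 ?expR_ge0.
- by rewrite lee_fin ltW.
Qed.

Lemma Gamma_reflection a : 0 < a < 1 ->
  [/\ 0 < Gamma a * Gamma (1 - a),
      mu.-integrable `]0, +oo[ (fun s => (s `^ (a - 1) / (1 + s))%:E) &
      \int[mu]_(s in `]0, +oo[) (s `^ (a - 1) / (1 + s)) = Gamma a * Gamma (1 - a)].
Proof.
move=> /andP[a0 a1].
have a1' : 0 < 1 - a by rewrite subr_gt0.
have a1'' : 1 - a < 1 by rewrite ltrBlDr ltrDl.
pose K := (\int[mu]_(s in pos) (s `^ (a - 1) / (1 + s))%:E)%E.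
have GK : (G a * G (1 - a) = K)%E.
  pose F (z : R * R) := (\1_pos z.1 * (\1_pos z.2 * (z.2 `^ (a - 1) * expR (- (z.1 * (1 + z.2))))))%:E.
  have mF : measurable_fun setT F.
    apply/measurable_EFinP; apply: measurable_funM.
      by apply: (@measurableT_comp _ _ _ _ _ _ (\1_pos : R -> R)) => //; exact: measurable_indic.
    apply: measurable_funM.
      by apply: (@measurableT_comp _ _ _ _ _ _ (\1_pos : R -> R)) => //; exact: measurable_indic.
    apply: measurable_funM.
      by apply: (@measurableT_comp _ _ _ _ _ _ (fun x => x `^ (a - 1))) => //; exact: measurable_powR.
    apply: (@measurableT_comp _ _ _ _ _ _ expR) => //; apply: measurableT_comp => //.
    by apply: measurable_funM => //; exact: measurable_funD.
  have F0 z : (0 <= F z)%E by rewrite lee_fin !mulr_ge0// ?powR_ge0 ?expR_ge0.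
  transitivity (\int[mu]_y \int[mu]_s F (y, s))%E.
    rewrite {2}/G integral_indicM muleC -ge0_integralZr//; last 2 first.
    - apply/measurable_EFinP; apply: measurable_funM; first exact: measurable_indic.
      exact: measurable_gamma_fun.
    - by move=> x _; rewrite lee_fin !mulr_ge0// ?powR_ge0 ?expR_ge0.
    apply: eq_integral => y _; have [y0|y0] := ltP 0 y; last first.
      rewrite !indicE /pos memNset ?mul0r ?mul0e; last by rewrite /pos/= in_itv/= ltNge y0.
      rewrite integral0_eq// => s _; rewrite /F/= indicE memNset ?mul0r//.
      by rewrite /pos/= in_itv/= ltNge y0.
    rewrite (G_scale a0 y0) integral_indicM.
    rewrite -ge0_integralZl.
    - apply: eq_integral => s _; rewrite -EFinM; congr EFin => /=.
      have -> : - (y * (1 + s)) = - y + - (y * s) by ring.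
      rewrite expRD; have -> : 1 - a - 1 = - a by ring.
      have -> : y `^ (- a) = (y `^ a)^-1 by rewrite powRN.
      by field; rewrite gt_eqF// powR_gt0.
    - by [].
    - apply/measurable_EFinP; apply: measurable_funM; first exact: measurable_indic.
      apply: measurable_funM; first by apply: measurable_funM => //; exact: measurable_powR.
      apply: (@measurableT_comp _ _ _ _ _ _ expR) => //; exact: measurableT_comp.
    - by move=> s _; rewrite lee_fin !mulr_ge0// ?powR_ge0 ?expR_ge0.
    - by rewrite lee_fin !mulr_ge0// ?powR_ge0 ?expR_ge0.
  rewrite (@fubini_tonelli _ _ _ _ _ mu mu F mF F0) /K integral_indicM.
  apply: eq_integral => s _; have [s0|s0] := ltP 0 s; last first.
    rewrite !indicE /pos memNset ?mul0r; last by rewrite /pos/= in_itv/= ltNge s0.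
    rewrite integral0_eq// => y _; rewrite /F/= [X in _ * (X * _)]indicE memNset ?mul0r ?mulr0//.
    by rewrite /pos/= in_itv/= ltNge s0.
  rewrite indicE mem_set ?mul1r; last by rewrite /pos/= in_itv/= s0.
  have s1 : 0 < 1 + s by rewrite addr_gt0.
  rewrite EFinM -(integral_expR_pos s1) [in RHS]integral_indicM -ge0_integralZl.
  - apply: eq_integral => y _; rewrite -EFinM /F/=; congr EFin.
    rewrite [X in _ * (X * _)]indicE mem_set ?mul1r; last by rewrite /pos/= in_itv/= s0.
    by rewrite mulrCA [y * _]mulrC.
  - by [].
  - apply/measurable_EFinP; apply: measurable_funM; first exact: measurable_indic.
    by apply: (@measurableT_comp _ _ _ _ _ _ expR) => //; apply: measurableT_comp.
  - by move=> y _; rewrite lee_fin mulr_ge0// expR_ge0.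
  - by rewrite lee_fin powR_ge0.
have Ga : (G a)%E \is a fin_num by rewrite ge0_fin_numE// G_lty.
have Gb : (G (1 - a))%E \is a fin_num by rewrite ge0_fin_numE// G_lty.
have Kfin : (G a * G (1 - a))%E \is a fin_num by exact: fin_numM.
split.
- by rewrite mulr_gt0// fine_gt0// G_lty// G_gt0.
- apply/integrableP; split.
    apply/measurable_EFinP; apply: measurable_funTS; apply: measurable_funM.
      exact: measurable_powR.
    by apply: (@measurableT_comp _ _ _ _ _ _ (@GRing.inv R)); [exact: measurable_invr|exact: measurable_funD].
  under eq_integral => s s0.
    rewrite gee0_abs; last first.
      rewrite lee_fin divr_ge0 ?powR_ge0// addr_ge0//.
      by move: s0; rewrite inE/= in_itv/= andbT => /ltW.
    over.
  by move: Kfin; rewrite GK fin_numElt => /andP[].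
- by rewrite /Rintegral -/pos -/K -GK fineM.
Qed.

End gamma_reflection.

Section measurability_tools.
Context {R : realType}.
Local Notation mu := (@lebesgue_measure R).

Lemma measurable_powR_comp d (T : measurableType d) (D : set T) (f : T -> R) p :
  measurable_fun D f -> measurable_fun D (fun x => f x `^ p).
Proof. by move=> mf; apply: (@measurableT_comp _ _ _ _ _ _ (@powR R ^~ p)) => //; exact: measurable_powR. Qed.

Lemma measurable_invr_comp d (T : measurableType d) (D : set T) (f : T -> R) :
  measurable_fun D f -> measurable_fun D (fun x => (f x)^-1).
Proof. by move=> mf; apply: (@measurableT_comp _ _ _ _ _ _ (@GRing.inv R)) => //; exact: measurable_invr. Qed.

Lemma measurable_normr_comp d (T : measurableType d) (D : set T) (f : T -> R) :
  measurable_fun D f -> measurable_fun D (fun x => `|f x|).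
Proof. by move=> mf; exact: measurableT_comp. Qed.

Let band d (T : measurableType d) (lo hi : T -> R) (f : T * R -> R) (z : T * R) : R :=
  if (lo z.1 <= z.2) && (z.2 <= hi z.1) then f z else 0.

Let measurable_band d (T : measurableType d) (lo hi : T -> R) (f : T * R -> R) :
  measurable_fun setT lo -> measurable_fun setT hi -> measurable_fun setT f ->
  measurable_fun setT (band lo hi f).
Proof.
move=> mlo mhi mf; apply: measurable_fun_ifT => //.
by apply: measurable_and; apply: measurable_fun_ler => //; exact: measurableT_comp.
Qed.

Let patch_band d (T : measurableType d) (lo hi : T -> R) (f : T * R -> R) x y :
  ((fun y => f (x, y)) \_ `[lo x, hi x]) y = band lo hi f (x, y).
Proof.
rewrite patchE /band/=; case: ifPn => [/set_mem|/negP h].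
  by rewrite /= in_itv/= => ->.
by rewrite ifF//; apply/negP => h'; apply: h; apply/mem_set; rewrite /= in_itv.
Qed.

Lemma measurable_Rintegral_itv d (T : measurableType d) (lo hi : T -> R) (f : T * R -> R) :
  measurable_fun setT lo -> measurable_fun setT hi -> measurable_fun setT f ->
  measurable_fun setT (fun x => \int[mu]_(y in `[lo x, hi x]) f (x, y)).
Proof.
move=> mlo mhi mf.
rewrite (_ : (fun x => _) = (fun x => \int[mu]_y band lo hi f (x, y))).
  by apply: measurable_fun_Rintegral; exact: measurable_band.
apply/funext => x; rewrite Rintegral_mkcond; apply: eq_Rintegral => y _.
exact: patch_band.
Qed.

Lemma measurable_integral_itv d (T : measurableType d) (lo hi : T -> R) (f : T * R -> R) :
  measurable_fun setT lo -> measurable_fun setT hi -> measurable_fun setT f ->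
  (forall z, 0 <= f z) ->
  measurable_fun setT (fun x => \int[mu]_(y in `[lo x, hi x]) (f (x, y))%:E)%E.
Proof.
move=> mlo mhi mf f0.
rewrite (_ : (fun x => _) = (fun x => \int[mu]_y (EFin \o band lo hi f) (x, y))%E).
  apply: (measurable_fun_fubini_tonelli_F (m2 := mu)).
    by apply/measurable_EFinP; exact: measurable_band.
  by move=> z; rewrite lee_fin /band; case: ifP.
apply/funext => x; rewrite integral_mkcond; apply: eq_integral => y _ /=.
by rewrite -patch_band !patchE; case: ifP.
Qed.

End measurability_tools.

Section integration_tools.
Context d (T : measurableType d) {R : realType} (m : {measure set T -> \bar R}).

Lemma dominated_cvg_Rintegral (D : set T) (f_ : nat -> T -> R) (f : T -> R)
    (g : T -> \bar R) : measurable D ->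
  (forall n, measurable_fun D (f_ n)) -> measurable_fun D f ->
  {ae m, forall x, D x -> f_ n x @[n --> \oo] --> f x} ->
  m.-integrable D g ->
  (forall n x, D x -> (`|f_ n x|%:E <= g x)%E) ->
  \int[m]_(x in D) f_ n x @[n --> \oo] --> \int[m]_(x in D) f x.
Proof.
move=> mD mf_ mf f_f ig f_g.
have [] := @dominated_convergence _ _ _ m D mD (fun n => EFin \o f_ n) (EFin \o f) g.
- by move=> n; exact/measurable_EFinP.
- exact/measurable_EFinP.
- by apply: filterS f_f => x h Dx; apply: cvg_EFin; [near=> n|exact: h].
- exact: ig.
- by apply: aeW => x n Dx; exact: f_g.
move=> fi _ h; apply: fine_cvg; move: h.
rewrite /Rintegral fineK; first exact.
exact: (integrable_fin_num mD fi).
Unshelve. all: by end_near. Qed.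

Lemma integrable_dominated (D : set T) (f g : T -> R) : measurable D ->
  measurable_fun D f -> m.-integrable D (EFin \o g) ->
  (forall x, D x -> `|f x| <= g x) -> m.-integrable D (EFin \o f).
Proof.
move=> mD mf gi fg; apply: le_integrable gi => //; first exact/measurable_EFinP.
move=> x Dx; rewrite /= lee_fin (le_trans (fg _ Dx))//; exact: ler_norm.
Qed.

Lemma ge0_Rintegral_fin (D : set T) (f : T -> R) :
  (forall x, D x -> 0 <= f x) -> measurable_fun D f -> measurable D ->
  (\int[m]_(x in D) (f x)%:E < +oo)%E -> m.-integrable D (EFin \o f).
Proof.
move=> f0 mf mD fi; apply/integrableP; split; first exact/measurable_EFinP.
rewrite (eq_integral (EFin \o f))// => x /set_mem Dx /=.
by rewrite ger0_norm// f0.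
Qed.

End integration_tools.

(** * Fractional derivatives *)

Section power_domination.
Context {R : realType}.
Local Notation mu := (@lebesgue_measure R).

Lemma integrable_powR_right (C p x b : R) : 0 < p -> x <= b ->
  mu.-integrable `[x, b] (EFin \o (fun u => C * (u - x) `^ (p - 1))).
Proof.
move=> p0 xb.
rewrite (_ : EFin \o _ = (fun u => C%:E * ((u - x) `^ (p - 1))%:E)%E); last first.
  by apply/funext => u.
apply: integrableZl => //; apply: ge0_Rintegral_fin => //.
- by move=> u _; rewrite powR_ge0.
- by apply: measurable_funTS; apply: measurable_powR_comp; exact: measurable_funB.
- by rewrite integral_powR_right// ltry.
Qed.

Lemma integrable_powR_left (C p c v : R) : 0 < p -> c <= v ->
  mu.-integrable `[c, v] (EFin \o (fun u => C * (v - u) `^ (p - 1))).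
Proof.
move=> p0 xb.
rewrite (_ : EFin \o _ = (fun u => C%:E * ((v - u) `^ (p - 1))%:E)%E); last first.
  by apply/funext => u.
apply: integrableZl => //; apply: ge0_Rintegral_fin => //.
- by move=> u _; rewrite powR_ge0.
- by apply: measurable_funTS; apply: measurable_powR_comp; exact: measurable_funB.
- by rewrite integral_powR_left// ltry.
Qed.

Lemma Rintegral_powR_right (p x b : R) : 0 < p -> x <= b ->
  \int[mu]_(u in `[x, b]) (u - x) `^ (p - 1) = (b - x) `^ p / p.
Proof. by move=> p0 xb; rewrite /Rintegral integral_powR_right. Qed.

Lemma Rintegral_itv_cc_oo (f : R -> R) x y : mu.-integrable `[x, y] (EFin \o f) ->
  \int[mu]_(u in `[x, y]) f u = \int[mu]_(u in `]x, y[) f u.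
Proof.
move=> fi; rewrite -Rintegral_itv_obnd_cbnd; last first.
  by apply: integrableS fi => //; exact: subset_itv_oc_cc.
rewrite Rintegral_itv_bndo_bndc//.
by apply: integrableS fi => //; exact: subset_itv_oo_cc.
Qed.

Lemma divr_powR_bound (N y p : R) : 0 <= y -> 0 <= N ->
  (N * y) / y `^ (1 + p) <= N * y `^ (- p).
Proof.
rewrite le_eqVlt => /predU1P[<-|y0] N0; first by rewrite mulr0 mul0r mulr_ge0 ?powR_ge0.
rewrite powRD ?(gt_eqF y0) ?implybT// powRr1 ?(ltW y0)// powRN.
by rewrite invfM -!mulrA (mulrA y) divff ?gt_eqF// mul1r.
Qed.

End power_domination.

Section fractional_primitive.
Context {R : realType}.
Local Notation mu := (@lebesgue_measure R).
Implicit Types (f g h : R -> R) (a x : R).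

Definition frac_int a h x : R := \int[mu]_(v in `[x, 1]) (h v * (v - x) `^ (a - 1)).

Lemma frac_right_primitive a h g (N : R) x : 0 < a < 1 -> 0 <= x <= 1 ->
  continuous h -> (forall u, `|h u| <= N) ->
  (forall u : R, 0 < u < 1 -> is_derive u 1 g (h u)) ->
  (forall u v, 0 <= u <= 1 -> 0 <= v <= 1 -> `|g u - g v| <= N * `|u - v|) ->
  measurable_fun setT g ->
  frac_right a 1 g x = frac_int a h x.
Proof.
move=> /andP[a0 a1] /andP[x0]; rewrite le_eqVlt => /predU1P[->|x1] ch hN dg lg mg.
  by rewrite /frac_right /frac_int set_itv1 !Rintegral_set1 !subrr mul0r mulr0 addr0.
have N0 : 0 <= N by exact: le_trans (hN 0).
have mh : measurable_fun setT h by exact: continuous_measurable_fun.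
pose p1 u := h u * (u - x) `^ (a - 1).
pose p2 u := (g u - g x) / (u - x) `^ (2 - a).
have mp1 : measurable_fun setT p1.
  by apply: measurable_funM => //; apply: measurable_powR_comp; exact: measurable_funB.
have mp2 : measurable_fun setT p2.
  apply: measurable_funM; first exact: measurable_funB.
  by apply/measurable_invr_comp/measurable_powR_comp; exact: measurable_funB.
have ip1 : mu.-integrable `[x, 1] (EFin \o p1).
  apply: integrable_dominated (integrable_powR_right N a0 (ltW x1)) _ => //.
    exact: measurable_funTS.
  by move=> u _; rewrite normrM (ger0_norm (powR_ge0 _ _)) ler_wpM2r ?powR_ge0.
have ip2 : mu.-integrable `[x, 1] (EFin \o p2).
  apply: integrable_dominated (integrable_powR_right N a0 (ltW x1)) _ => //.
    exact: measurable_funTS.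
  move=> u; rewrite /= in_itv/= => /andP[xu u1].
  rewrite /p2 normrM normfV (ger0_norm (powR_ge0 _ _)).
  apply: (@le_trans _ _ ((N * (u - x)) / (u - x) `^ (1 + (1 - a)))).
    rewrite addrA; apply: ler_wpM2r; first by rewrite invr_ge0 powR_ge0.
    apply: le_trans (lg _ _ _ _) _.
    + by rewrite u1 (le_trans x0 xu).
    + by rewrite x0 ltW.
    + by rewrite ger0_norm// subr_ge0.
  by apply: le_trans (divr_powR_bound _ _ _) _; rewrite ?subr_ge0// opprB.
have cux u : {for u, continuous (fun u => u - x)}.
  by apply: cvgB; [exact: cvg_id|exact: cvg_cst].
have cpow p u : x < u -> {for u, continuous (fun u => (u - x) `^ p)}.
  move=> xu; apply: (@continuous_powR_comp _ (fun u => u - x)); first exact: cux.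
  by rewrite subr_gt0.
have F := @improper_FTC _ (fun u => p1 u - (1 - a) * p2 u)
  (fun u => (g u - g x) * (u - x) `^ (a - 1)) x 1 0
  ((g 1 - g x) * (1 - x) `^ (a - 1)) x1.
have -> : frac_right a 1 g x = (g 1 - g x) * (1 - x) `^ (a - 1) +
    (1 - a) * \int[mu]_(u in `[x, 1]) p2 u.
  by rewrite /frac_right -powRN opprB.
have ip3 : mu.-integrable `[x, 1] (EFin \o (fun u => (1 - a) * p2 u)).
  rewrite (_ : EFin \o _ = (fun u => (1 - a)%:E * (p2 u)%:E)%E); last first.
    by apply/funext.
  exact: integrableZl.
have ip4 : mu.-integrable `[x, 1] (EFin \o (fun u => p1 u - (1 - a) * p2 u)).
  rewrite (_ : EFin \o _ = (EFin \o p1) \- (EFin \o (fun u => ((1 - a) * p2 u)%R)))%E.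
    exact: integrableB.
  by apply/funext => u /=; rewrite EFinB.
suff: \int[mu]_(u in `[x, 1]) (p1 u - (1 - a) * p2 u) =
    (g 1 - g x) * (1 - x) `^ (a - 1).
  by rewrite RintegralB// RintegralZl// /frac_int -/p1 => <-; rewrite subrK.
rewrite Rintegral_itv_cc_oo// F ?subr0//.
- move=> u; rewrite in_itv/= => /andP[xu u1].
  have cg : {for u, continuous g}.
    have u01 : 0 < u < 1 by rewrite u1 (le_lt_trans x0 xu).
    have dgu := dg _ u01; apply: differentiable_continuous.
    by apply/derivable1_diffP; exact: ex_derive.
  apply: cvgB; first by apply: cvgM; [exact: ch|exact: cpow].
  apply: cvgMl_tmp; apply: cvgM; first by apply: cvgB; [exact: cg|exact: cvg_cst].
  apply: cvgV; last exact: cpow.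
  by rewrite gt_eqF// powR_gt0// subr_gt0.
- move=> u /andP[xu u1]; apply: is_derive_derivable.
  have ux0 : 0 < u - x by rewrite subr_gt0.
  have d1 : is_derive u 1 (fun u => g u - g x) (h u).
    have := is_deriveB (dg u _) (is_derive_cst (g x) u 1); rewrite subr0; apply.
    by rewrite u1 (le_lt_trans x0 xu).
  have d2 : is_derive u 1 (fun u => u - x) 1 by apply: is_derive_eq; rewrite subr0.
  have d3 := is_deriveM d1 (is_derive_powR_comp (a - 1) d2 ux0).
  apply: is_derive_eq; rewrite /GRing.scale/= mulr1 /p1 /p2 -powRN opprB.
  by rewrite (_ : a - 1 - 1 = a - 2%:R); ring.
- apply/norm_cvg0P; apply: (@squeeze_cvgr _ _ _ _ (cst 0) (fun u => N * (u - x) `^ a)).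
  + near=> u; have xu : x < u by near: u; exact: nbhs_right_gt.
    have u1 : u <= 1 by near: u; exact: nbhs_right_le.
    rewrite normr_ge0/= normrM (ger0_norm (powR_ge0 _ _)).
    have xu0 : 0 <= u - x by rewrite subr_ge0 ltW.
    rewrite -(mulr_powRB1 xu0 a0) mulrA ler_wpM2r ?powR_ge0//.
    apply: le_trans (lg _ _ _ _) _.
    * by rewrite u1 (le_trans x0 (ltW xu)).
    * by rewrite x0 ltW.
    * by rewrite ger0_norm// subr_ge0 ltW.
  + exact: cvg_cst.
  + rewrite -[X in _ --> X](mulr0 N); apply: cvgMl_tmp; apply: cvg_powR0 => //.
      by rewrite -(subrr x); apply: cvg_at_right_filter; exact: cux.
    by near=> u; rewrite subr_gt0; near: u; exact: nbhs_right_gt.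
- apply: cvgM; last by apply: cvg_at_left_filter; exact: cpow.
  apply: cvgB; last exact: cvg_cst.
  apply/cvgrPdist_lt => e e0; near=> u.
  have u1 : u < 1 by near: u; exact: nbhs_left_lt.
  have u0 : 0 <= u by near: u; exact: nbhs_left_ge.
  apply: le_lt_trans (lg _ _ _ _) _; rewrite ?lexx ?ler01 ?u0 ?ltW//.
  rewrite ger0_norm ?subr_ge0 ?ltW//.
  apply: (@le_lt_trans _ _ ((N + 1) * (1 - u))).
    by rewrite ler_wpM2r ?lerDl// subr_ge0 ltW.
  rewrite mulrC -ltr_pdivlMr ?ltr_wpDl// ltrBlDr -ltrBlDl.
  near: u; apply: nbhs_left_gt; rewrite ltrBlDr ltrDl divr_gt0//.
  by rewrite ltr_wpDl.
- by apply: integrableS ip4 => //; exact: subset_itv_oo_cc.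
Unshelve. all: by end_near. Qed.

End fractional_primitive.

Section bounded_integrable.
Context {R : realType}.
Local Notation mu := (@lebesgue_measure R).

Lemma integrable_bounded_itv (f : R -> R) (C b c : R) : measurable_fun setT f ->
  (forall u, b <= u <= c -> `|f u| <= C) -> mu.-integrable `[b, c] (EFin \o f).
Proof.
move=> mf fC; have [bc|cb] := leP b c; last first.
  by rewrite set_itv_ge ?bnd_simp -?ltNge//; exact: integrable_set0.
apply: integrable_dominated (integrable_powR_right C ltr01 bc) _ => //.
  exact: measurable_funTS.
by move=> u; rewrite /= in_itv/= subrr powRr0 mulr1; exact: fC.
Qed.

Lemma powRN_le (p e y : R) : 0 <= p -> 0 < e -> e <= y -> y `^ (- p) <= e `^ (- p).
Proof.
move=> p0 e0 ey; have y0 : 0 < y by exact: lt_le_trans ey.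
rewrite !powRN lef_pV2 ?posrE ?powR_gt0//.
by rewrite ge0_ler_powR// ?nnegrE ltW.
Qed.

End bounded_integrable.

Section truncated_derivative.
Context {R : realType}.
Local Notation mu := (@lebesgue_measure R).
Variables (a M : R) (f : R -> R).
Hypotheses (a0 : 0 < a) (a1 : a < 1).
Hypotheses (mf : measurable_fun setT f) (fM : forall x, `|f x| <= M).

(* The kernel [(x - u) ^ (- (1 + a))] of the left-sided derivative is shifted by
   [e]; the boundary term [f x / x ^ a] is then absorbed exactly. *)
Definition trunc_left (e x : R) : R :=
  f x * e `^ (- a) - a * \int[mu]_(u in `[0, x]) (f u * (x - u + e) `^ (- (1 + a))).

Definition abs_left (x : R) : \bar R :=
  ((`|f x| / x `^ a)%:E +
   \int[mu]_(z in `[0%R, x]) (`|f x - f z| / (x - z) `^ (1 + a))%:E)%E.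

Let mf1 : measurable_fun setT (fun z : R * R => f z.1).
Proof. exact: measurableT_comp. Qed.

Let mf2 : measurable_fun setT (fun z : R * R => f z.2).
Proof. exact: measurableT_comp. Qed.

Let mdiff p : measurable_fun setT (fun z : R * R => (z.1 - z.2) `^ p).
Proof. by apply: measurable_powR_comp; exact: measurable_funB. Qed.

Let mdiffs e p : measurable_fun setT (fun z : R * R => (z.1 - z.2 + e) `^ p).
Proof.
by apply: measurable_powR_comp; apply: measurable_funD => //; exact: measurable_funB.
Qed.

Let M0 : 0 <= M. Proof. exact: le_trans (fM 0). Qed.

Let a1' : 0 <= 1 + a. Proof. by rewrite addr_ge0// ltW. Qed.

Lemma abs_left_ge0 x : (0 <= abs_left x)%E.
Proof.
rewrite adde_ge0 ?lee_fin ?divr_ge0 ?powR_ge0//.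
by apply: integral_ge0 => z _; rewrite lee_fin divr_ge0 ?powR_ge0.
Qed.

Lemma measurable_abs_left : measurable_fun setT abs_left.
Proof.
apply: emeasurable_funD.
  apply/measurable_EFinP; apply: measurable_funM; first exact: measurable_normr_comp.
  by apply/measurable_invr_comp/measurable_powR_comp.
apply: (@measurable_integral_itv _ _ _ (fun=> 0) id
  (fun z => `|f z.1 - f z.2| / (z.1 - z.2) `^ (1 + a))) => //.
  apply: measurable_funM; last exact: measurable_invr_comp.
  by apply: measurable_normr_comp; exact: measurable_funB.
by move=> z; rewrite divr_ge0 ?powR_ge0.
Qed.

Lemma measurable_frac_left : measurable_fun setT (frac_left a f).
Proof.
apply: measurable_funD.
  by apply: measurable_funM => //; apply/measurable_invr_comp/measurable_powR_comp.
apply: measurable_funM => //.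
apply: (@measurable_Rintegral_itv _ _ _ (fun=> 0) id
  (fun z => (f z.1 - f z.2) / (z.1 - z.2) `^ (1 + a))) => //.
apply: measurable_funM; last exact: measurable_invr_comp.
exact: measurable_funB.
Qed.

Lemma measurable_trunc_left e : measurable_fun setT (trunc_left e).
Proof.
apply: measurable_funB; first exact: measurable_funM.
apply: measurable_funM => //.
apply: (@measurable_Rintegral_itv _ _ _ (fun=> 0) id
  (fun z => f z.2 * (z.1 - z.2 + e) `^ (- (1 + a)))) => //.
exact: measurable_funM.
Qed.

Let kernel_le e x u : 0 < e -> u <= x -> (x - u + e) `^ (- (1 + a)) <= e `^ (- (1 + a)).
Proof. by move=> e0 ux; rewrite powRN_le// lerDr subr_ge0. Qed.

Let measurable_kernel (e x : R) : measurable_fun setT (fun u : R => (x - u + e) `^ (- (1 + a))).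
Proof.
by apply: measurable_powR_comp; apply: measurable_funD => //; exact: measurable_funB.
Qed.

Let integrable_kernel (k : R -> R) (C e x : R) : 0 < e -> measurable_fun setT k ->
  (forall u, `|k u| <= C) ->
  mu.-integrable `[0, x] (EFin \o (fun u => k u * (x - u + e) `^ (- (1 + a)))).
Proof.
move=> e0 mk kC; apply: (@integrable_bounded_itv _ _ (C * e `^ (- (1 + a)))).
  exact: measurable_funM.
move=> u /andP[_ ux]; rewrite normrM (ger0_norm (powR_ge0 _ _)).
by rewrite ler_pM ?powR_ge0// kernel_le.
Qed.

Lemma trunc_leftE e x : 0 < e -> 0 <= x ->
  trunc_left e x = f x * (x + e) `^ (- a) +
    a * \int[mu]_(u in `[0, x]) ((f x - f u) * (x - u + e) `^ (- (1 + a))).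
Proof.
move=> e0 x0; under eq_Rintegral do rewrite mulrBl.
rewrite RintegralB//; last 2 first.
- by apply: (@integrable_kernel (cst (f x)) M) => //= u.
- exact: (@integrable_kernel f M).
rewrite RintegralZl//; last first.
  have := @integrable_kernel (cst 1) 1 e x e0 (measurable_cst _).
  rewrite (_ : EFin \o _ = EFin \o (fun u => (x - u + e) `^ (- (1 + a)))).
    by apply => u; rewrite normr1.
  by apply/funext => u /=; rewrite mul1r.
rewrite {1}/Rintegral integral_powR_shift//= /trunc_left.
move: (\int[mu]_(u in _) _) (e `^ (- a)) ((x + e) `^ (- a)) => I E X.
by field; rewrite gt_eqF.
Qed.

Let inner_bound (k1 k2 : R -> R) x : measurable_fun setT k1 ->
  mu.-integrable `[0, x] (EFin \o k1) ->
  measurable_fun setT k2 ->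
  (forall u, 0 <= u <= x -> `|k1 u| <= k2 u) ->
  (`|\int[mu]_(u in `[0, x]) k1 u|%:E <= \int[mu]_(u in `[0%R, x]) (k2 u)%:E)%E.
Proof.
move=> mk1 ik1 mk2 k12; rewrite EFin_normr_Rintegral//.
apply: le_trans; first by apply: le_abse_integral => //; exact: measurable_int ik1.
apply: ge0_le_integral => //.
- by apply/measurable_EFinP/measurable_normr_comp; exact: measurable_funTS.
- by apply/measurable_EFinP; exact: measurable_funTS.
Qed.

Lemma trunc_left_bound e x : 0 < e -> 0 < x -> (`|trunc_left e x|%:E <= abs_left x)%E.
Proof.
move=> e0 x0; rewrite (trunc_leftE e0 (ltW x0)).
apply: (@le_trans _ _ (`|f x * (x + e) `^ (- a)|%:E +
  `|\int[mu]_(u in `[0, x]) ((f x - f u) * (x - u + e) `^ (- (1 + a)))|%:E)%E).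
  rewrite -EFinD lee_fin (le_trans (ler_normD _ _))// lerD2l normrM.
  by rewrite ler_piMl// gtr0_norm// ltW.
apply: leeD.
  rewrite lee_fin normrM (ger0_norm (powR_ge0 _ _)) ler_wpM2l// -powRN.
  by rewrite powRN_le// ?ltW// ltrDl.
apply: inner_bound.
- by apply: measurable_funM => //; exact: measurable_funB.
- apply: (@integrable_kernel (fun u => f x - f u) (M + M)) => //.
    exact: measurable_funB.
  by move=> u; rewrite (le_trans (ler_normB _ _))// lerD.
- apply: measurable_funM; first by apply: measurable_normr_comp; exact: measurable_funB.
  by apply/measurable_invr_comp/measurable_powR_comp; exact: measurable_funB.
- move=> u /andP[u0]; rewrite le_eqVlt => /predU1P[->|ux].
    by rewrite subrr mul0r normr0 mul0r.
  rewrite normrM (ger0_norm (powR_ge0 _ _)) ler_wpM2l// -powRN.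
  by rewrite powRN_le// ?subr_gt0// lerDl ltW.
Qed.

Lemma frac_left_bound x : 0 <= x -> (`|frac_left a f x|%:E <= abs_left x)%E.
Proof.
move=> x0; have [fin|] := ltP (\int[mu]_(z in `[0%R, x]) (`|f x - f z| / (x - z) `^ (1 + a))%:E)%E +oo%E; last first.
  by rewrite leye_eq => /eqP h; rewrite /abs_left h addey// leey.
have mk : measurable_fun setT (fun u => (f x - f u) / (x - u) `^ (1 + a)).
  apply: measurable_funM; first exact: measurable_funB.
  by apply/measurable_invr_comp/measurable_powR_comp; exact: measurable_funB.
have mk' : measurable_fun setT (fun u => `|f x - f u| / (x - u) `^ (1 + a)).
  apply: measurable_funM; first by apply: measurable_normr_comp; exact: measurable_funB.
  by apply/measurable_invr_comp/measurable_powR_comp; exact: measurable_funB.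
have ik : mu.-integrable `[0, x] (EFin \o (fun u => (f x - f u) / (x - u) `^ (1 + a))).
  have ik' : mu.-integrable `[0, x] (EFin \o (fun u => `|f x - f u| / (x - u) `^ (1 + a))).
    apply: ge0_Rintegral_fin => //; last exact: measurable_funTS.
    by move=> u _; rewrite divr_ge0 ?powR_ge0.
  apply: integrable_dominated ik' _ => //; first exact: measurable_funTS.
  by move=> u _; rewrite normrM normfV (ger0_norm (powR_ge0 _ _)).
apply: (@le_trans _ _ (`|f x / x `^ a|%:E +
  `|\int[mu]_(u in `[0, x]) ((f x - f u) / (x - u) `^ (1 + a))|%:E)%E).
  rewrite -EFinD lee_fin (le_trans (ler_normD _ _))// lerD2l normrM.
  by rewrite ler_piMl// gtr0_norm// ltW.
apply: leeD; first by rewrite lee_fin normrM normfV (ger0_norm (powR_ge0 _ _)).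
apply: inner_bound => // u _.
by rewrite normrM normfV (ger0_norm (powR_ge0 _ _)).
Qed.

Lemma cvg_trunc_left x : 0 < x -> (abs_left x < +oo)%E ->
  trunc_left (harmonic n) x @[n --> \oo] --> frac_left a f x.
Proof.
move=> x0 afin.
have fin : (\int[mu]_(z in `[0%R, x]) (`|f x - f z| / (x - z) `^ (1 + a))%:E < +oo)%E.
  apply: le_lt_trans afin; rewrite leeDr// lee_fin divr_ge0 ?powR_ge0//.
under eq_fun do rewrite trunc_leftE ?ltW// ?invr_gt0//.
have h0 : harmonic n @[n --> \oo] --> (0 : R) by exact: cvg_harmonic.
have hy (y : R) : y + harmonic n @[n --> \oo] --> y.
  by rewrite -[X in _ --> X]addr0; apply: cvgD => //; exact: cvg_cst.
have powy p (y : R) : 0 < y -> (y + harmonic n) `^ p @[n --> \oo] --> y `^ p.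
  move=> y0; apply: (@cvg_comp _ _ _ (fun n => y + harmonic n) (@powR R ^~ p)).
    exact: hy.
  by apply: (@continuous_powR_comp _ id) => //; exact: cvg_id.
apply: cvgD.
  by apply: cvgMl_tmp; rewrite -powRN; exact: powy.
apply: cvgMl_tmp.
have mk : measurable_fun setT (fun u => (f x - f u) / (x - u) `^ (1 + a)).
  apply: measurable_funM; first exact: measurable_funB.
  by apply/measurable_invr_comp/measurable_powR_comp; exact: measurable_funB.
have mk' : measurable_fun setT (fun u => `|f x - f u| / (x - u) `^ (1 + a)).
  apply: measurable_funM; first by apply: measurable_normr_comp; exact: measurable_funB.
  by apply/measurable_invr_comp/measurable_powR_comp; exact: measurable_funB.
apply: (@dominated_cvg_Rintegral _ _ _ mu `[0, x]%classic
  (fun n u => (f x - f u) * (x - u + harmonic n) `^ (- (1 + a)))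
  (fun u => (f x - f u) / (x - u) `^ (1 + a))
  (EFin \o (fun u => `|f x - f u| / (x - u) `^ (1 + a)))) => //.
- move=> n; apply: measurable_funTS; apply: measurable_funM.
    exact: measurable_funB.
  exact: measurable_kernel.
- exact: measurable_funTS.
- apply: aeW => u; rewrite /= in_itv/= => /andP[u0].
  rewrite le_eqVlt => /predU1P[->|ux].
    by rewrite subrr mul0r; under eq_fun do rewrite mul0r; exact: cvg_cst.
  by apply: cvgMl_tmp; rewrite -powRN; apply: powy; rewrite subr_gt0.
- apply: ge0_Rintegral_fin => //; last exact: measurable_funTS.
  by move=> u _; rewrite divr_ge0 ?powR_ge0.
- move=> n u; rewrite /= in_itv/= => /andP[u0].
  rewrite le_eqVlt => /predU1P[->|ux].
    by rewrite subrr mul0r normr0 mul0r.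
  rewrite lee_fin normrM (ger0_norm (powR_ge0 _ _)) ler_wpM2l// -powRN.
  by rewrite powRN_le// ?subr_gt0// lerDl invr_ge0.
Qed.

End truncated_derivative.

Section convolution.
Context {R : realType}.
Local Notation mu := (@lebesgue_measure R).
Variables (a M : R) (f : R -> R).
Hypotheses (a0 : 0 < a) (a1 : a < 1).
Hypotheses (mf : measurable_fun setT f) (fM : forall x, `|f x| <= M).

Lemma triangle_integral_lty (phi : R * R -> R) (K b : R) : measurable_fun setT phi ->
  (forall x, 0 <= x <= b -> (\int[mu]_(y in `[x, b]) `|phi (x, y)|%:E <= K%:E)%E) ->
  (\int[mu]_(x in `[0%R, b]) \int[mu]_(y in `[x, b]) `|phi (x, y)|%:E < +oo)%E.
Proof.
move=> mphi phiK; apply: (@le_lt_trans _ _ (\int[mu]_(x in `[0%R, b]) (cst K%:E) x)%E).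
  apply: ge0_le_integral => //.
  - by move=> x _; apply: integral_ge0 => y _; rewrite lee_fin.
  - apply: measurable_funTS.
    apply: (@measurable_integral_itv _ _ _ id (fun=> b) (fun z => `|phi z|)) => //.
    exact: measurable_normr_comp.
have : mu.-integrable `[0, b] (EFin \o cst K).
  by apply: (@integrable_bounded_itv _ _ `|K|).
by move=> /integrable_fin_num; rewrite fin_numElt => /(_ (measurable_itv _))/andP[].
Qed.

Let M0 : 0 <= M. Proof. exact: le_trans (fM 0). Qed.

Let kernel e x u : R := (x - u + e) `^ (- (1 + a)).

Let kernel_ge0 e x u : 0 <= kernel e x u. Proof. exact: powR_ge0. Qed.

Let measurable_kernel (e x : R) : measurable_fun setT (fun u : R => kernel e x u).
Proof.
by apply: measurable_powR_comp; apply: measurable_funD => //; exact: measurable_funB.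
Qed.

Let measurable_sub_pow (v p : R) : measurable_fun setT (fun u : R => (v - u) `^ p).
Proof. by apply: measurable_powR_comp; exact: measurable_funB. Qed.

Let kernel_le e x u : 0 < e -> u <= x -> kernel e x u <= e `^ (- (1 + a)).
Proof. by move=> e0 ux; rewrite powRN_le ?addr_ge0 ?(ltW a0)// lerDr subr_ge0. Qed.

Let inner e x : R := \int[mu]_(u in `[0, x]) (f u * kernel e x u).

Let integrable_inner e x : 0 < e -> mu.-integrable `[0, x] (EFin \o (fun u => f u * kernel e x u)).
Proof.
move=> e0; apply: (@integrable_bounded_itv _ _ (M * e `^ (- (1 + a)))).
  exact: measurable_funM.
move=> u /andP[_ ux]; rewrite normrM (ger0_norm (kernel_ge0 _ _ _)).
by rewrite ler_pM// kernel_le.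
Qed.

Let measurable_inner e : measurable_fun setT (inner e).
Proof.
apply: (@measurable_Rintegral_itv _ _ _ (fun=> 0) id (fun z => f z.2 * kernel e z.1 z.2)) => //.
apply: measurable_funM; first exact: measurableT_comp.
by apply: measurable_powR_comp; apply: measurable_funD => //; exact: measurable_funB.
Qed.

Let inner_bound e x : 0 < e -> 0 <= x -> `|inner e x| <= M * (e `^ (- a) / a).
Proof.
move=> e0 x0.
have mk : mu.-integrable `[0, x] (EFin \o (fun u => kernel e x u)).
  apply: (@integrable_bounded_itv _ _ (e `^ (- (1 + a)))) => // u /andP[_ ux].
  by rewrite ger0_norm// kernel_le.
apply: (@le_trans _ _ (\int[mu]_(u in `[0, x]) (M * kernel e x u))).
  rewrite /inner; apply: le_trans (le_normr_Rintegral _ _) _ => //.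
    exact: integrable_inner.
  apply: le_Rintegral => //.
  - by have /integrable_abse := integrable_inner x e0.
  - rewrite (_ : EFin \o _ = (fun u => M%:E * (kernel e x u)%:E)%E); last exact/funext.
    exact: integrableZl.
  - by move=> u _; rewrite normrM (ger0_norm (kernel_ge0 _ _ _)) ler_wpM2r.
rewrite RintegralZl// ler_wpM2l// /Rintegral integral_powR_shift//=.
by rewrite ler_pM2r ?invr_gt0// gerBl powR_ge0.
Qed.

Lemma trunc_left_unif_bound e x : 0 < e -> 0 <= x ->
  `|trunc_left a f e x| <= M * e `^ (- a) *+ 2.
Proof.
move=> e0 x0; rewrite (le_trans (ler_normB _ _))// mulr2n lerD//.
  by rewrite normrM (ger0_norm (powR_ge0 _ _)) ler_wpM2r ?powR_ge0.
rewrite normrM gtr0_norm// (le_trans (ler_wpM2l (ltW a0) (inner_bound e0 x0)))//.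
by rewrite mulrCA [a * _]mulrC divfK// gt_eqF.
Qed.

Let convE (e v u : R) : 0 < e -> u <= v ->
  (\int[mu]_(x in `[u, v]) (kernel e x u * (v - x) `^ (a - 1))%:E =
  ((v - u) `^ a / (a * e `^ a * (v - u + e)))%:E)%E.
Proof.
move=> e0; rewrite le_eqVlt => /predU1P[->|uv].
  by rewrite set_itv1 integral_set1 subrr powR0 ?gt_eqF// mul0r.
apply: etrans (integral_powR_convolution a0 e0 uv).
by apply: eq_integral => x _; rewrite mulrC.
Qed.

Let conv_bound (e v u : R) : 0 < e -> 0 <= u <= v ->
  0 <= (v - u) `^ a / (a * e `^ a * (v - u + e)) <= v `^ a / (a * e `^ a * e).
Proof.
move=> e0 /andP[u0 uv]; have vu : 0 <= v - u by rewrite subr_ge0.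
have ae : 0 < a * e `^ a by rewrite mulr_gt0// powR_gt0.
rewrite divr_ge0 ?powR_ge0//=; last by rewrite mulr_ge0 ?ltW// ltr_wpDl.
apply: ler_pM; first exact: powR_ge0.
- by rewrite invr_ge0 mulr_ge0 ?(ltW ae)// addr_ge0// ltW.
- apply: ge0_ler_powR; rewrite ?nnegrE ?(ltW a0) ?vu ?(le_trans u0 uv)//.
  by rewrite gerBl.
- by rewrite lef_pV2 ?posrE ?(mulr_gt0 ae) ?ltr_wpDl// ler_pM2l// lerDr.
Qed.

Lemma trunc_convolution (e v : R) : 0 < e -> 0 <= v ->
  \int[mu]_(x in `[0, v]) (trunc_left a f e x * (v - x) `^ (a - 1)) =
  \int[mu]_(u in `[0, v]) (f u * (e `^ (1 - a) * (v - u) `^ (a - 1) / (v - u + e))).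
Proof.
move=> e0 v0.
pose k x := (v - x) `^ (a - 1).
have k0 x : 0 <= k x by exact: powR_ge0.
have mk : measurable_fun setT k by exact: measurable_sub_pow.
pose J u := (v - u) `^ a / (a * e `^ a * (v - u + e)).
have mJ : measurable_fun setT J.
  apply: measurable_funM; first exact: measurable_sub_pow.
  apply: measurable_invr_comp; apply: measurable_funM => //.
  by apply: measurable_funD => //; exact: measurable_funB.
have ifk : mu.-integrable `[0, v] (EFin \o (fun x => f x * k x)).
  apply: integrable_dominated (integrable_powR_left M a0 v0) _ => //.
    by apply: measurable_funTS; exact: measurable_funM.
  by move=> x _; rewrite normrM (ger0_norm (k0 _)) ler_wpM2r.
have iik : mu.-integrable `[0, v] (EFin \o (fun x => inner e x * k x)).
  apply: integrable_dominated (integrable_powR_left (M * (e `^ (- a) / a)) a0 v0) _ => //.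
    by apply: measurable_funTS; apply: measurable_funM => //; exact: measurable_inner.
  move=> x; rewrite /= in_itv/= => /andP[x0 _].
  by rewrite normrM (ger0_norm (k0 _)) ler_wpM2r// inner_bound.
have ifJ : mu.-integrable `[0, v] (EFin \o (fun x => f x * J x)).
  apply: (@integrable_bounded_itv _ _ (M * (v `^ a / (a * e `^ a * e)))).
    exact: measurable_funM.
  move=> u uv; have /andP[J0 JM] := conv_bound e0 uv.
  by rewrite normrM (ger0_norm J0) ler_pM.
have Z (g : R -> R) c : mu.-integrable `[0, v] (EFin \o g) ->
    mu.-integrable `[0, v] (EFin \o (fun x => c * g x)).
  move=> gi; rewrite (_ : EFin \o _ = (fun u => c%:E * (g u)%:E)%E); last exact/funext.
  exact: integrableZl.
have -> : \int[mu]_(x in `[0, v]) (trunc_left a f e x * (v - x) `^ (a - 1)) =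
    e `^ (- a) * \int[mu]_(x in `[0, v]) (f x * k x) -
    a * \int[mu]_(x in `[0, v]) (inner e x * k x).
  rewrite -(RintegralZl _ _ ifk)// -(RintegralZl _ _ iik)// -RintegralB//; [|exact: Z..].
  apply: eq_Rintegral => x _; rewrite /trunc_left -/(inner e x) -/(k x); ring.
have -> : \int[mu]_(u in `[0, v]) (f u * (e `^ (1 - a) * (v - u) `^ (a - 1) / (v - u + e))) =
    e `^ (- a) * \int[mu]_(x in `[0, v]) (f x * k x) -
    a * \int[mu]_(x in `[0, v]) (f x * J x).
  rewrite -(RintegralZl _ _ ifk)// -(RintegralZl _ _ ifJ)// -RintegralB//; [|exact: Z..].
  apply: eq_Rintegral => x; rewrite inE/= in_itv/= => /andP[x0 xv].
  have vx : 0 <= v - x by rewrite subr_ge0.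
  rewrite /J -(mulr_powRB1 vx a0) -/(k x) (@powRD _ e) ?(gt_eqF e0) ?implybT// powRr1 ?(ltW e0)//.
  rewrite powRN; field.
  by rewrite !gt_eqF ?powR_gt0// ltr_wpDl.
congr (_ - _ * _).
transitivity (\int[mu]_(x in `[0, v]) \int[mu]_(u in `[0, x]) (f u * (kernel e x u * k x))).
  apply: eq_Rintegral => x _; rewrite /inner -RintegralZr//; last exact: integrable_inner.
  by apply: eq_Rintegral => u _; rewrite mulrA.
pose phi (z : R * R) := f z.1 * (kernel e z.2 z.1 * k z.2).
have mphi : measurable_fun setT phi.
  apply: measurable_funM; first exact: measurableT_comp.
  apply: measurable_funM; last exact: measurableT_comp.
  by apply: measurable_powR_comp; apply: measurable_funD => //; exact: measurable_funB.
have := @Rintegral_triangle _ phi v mphi.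
rewrite /phi/= => <-.
  apply: eq_Rintegral => u; rewrite inE/= in_itv/= => /andP[u0 uv].
  rewrite RintegralZl//; first by rewrite {1}/Rintegral convE.
  apply: ge0_Rintegral_fin => //.
  - by move=> x _; rewrite mulr_ge0.
  - apply: measurable_funTS; apply: measurable_funM => //.
    by apply: measurable_powR_comp; apply: measurable_funD => //; exact: measurable_funB.
  - by rewrite convE// ltry.
apply: (@triangle_integral_lty phi (M * (v `^ a / (a * e `^ a * e))) v mphi).
move=> u uv; rewrite /phi/=; have /andP[u0 uv'] := uv.
under eq_integral do rewrite normrM EFinM.
rewrite ge0_integralZl//.
- under eq_integral do rewrite ger0_norm ?mulr_ge0//.
  rewrite convE// -EFinM lee_fin; have /andP[J0 JM] := conv_bound e0 uv.
  by rewrite ler_pM.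
- apply/measurable_EFinP; apply: measurable_funTS; apply: measurable_normr_comp.
  apply: measurable_funM => //.
  by apply: measurable_powR_comp; apply: measurable_funD => //; exact: measurable_funB.
Qed.

End convolution.

Section integration_by_parts.
Context {R : realType}.
Local Notation mu := (@lebesgue_measure R).
Variables (a M N : R) (f h : R -> R).
Hypotheses (a01 : 0 < a < 1).
Hypotheses (cf : continuous f) (fM : forall x, `|f x| <= M).
Hypotheses (ch : continuous h) (hN : forall x, `|h x| <= N).

Let a0 : 0 < a. Proof. by case/andP: a01. Qed.
Let a1 : a < 1. Proof. by case/andP: a01. Qed.
Let mf : measurable_fun setT f. Proof. exact: continuous_measurable_fun. Qed.
Let mh : measurable_fun setT h. Proof. exact: continuous_measurable_fun. Qed.
Let M0 : 0 <= M. Proof. exact: le_trans (fM 0). Qed.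
Let N0 : 0 <= N. Proof. exact: le_trans (hN 0). Qed.

Let k (z : R * R) : R := (z.2 - z.1) `^ (a - 1).

Let k0 z : 0 <= k z. Proof. exact: powR_ge0. Qed.

Let mk : measurable_fun setT k.
Proof. by apply: measurable_powR_comp; exact: measurable_funB. Qed.

Let mk1 x : measurable_fun setT (fun y => k (x, y)).
Proof.
by rewrite /k/=; apply: measurable_powR_comp; exact: measurable_funB.
Qed.

Lemma measurable_frac_int : measurable_fun setT (frac_int a h).
Proof.
apply: (@measurable_Rintegral_itv _ _ _ id (fun=> 1) (fun z => h z.2 * k z)) => //.
by apply: measurable_funM => //; exact: measurableT_comp.
Qed.

Let integrable_hk x : x <= 1 -> mu.-integrable `[x, 1] (EFin \o (fun v => h v * k (x, v))).
Proof.
move=> x1; apply: integrable_dominated (integrable_powR_right N a0 x1) _ => //.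
  by apply: measurable_funTS; apply: measurable_funM => //; exact: mk1.
by move=> v _; rewrite normrM (ger0_norm (k0 _)) ler_wpM2r.
Qed.

Lemma frac_int_bound x : 0 <= x <= 1 -> `|frac_int a h x| <= N / a.
Proof.
move=> /andP[x0 x1]; rewrite (le_trans (le_normr_Rintegral _ (integrable_hk x1)))//.
apply: (@le_trans _ _ (\int[mu]_(v in `[x, 1]) (N * (v - x) `^ (a - 1)))).
  apply: le_Rintegral => //.
  - by have /integrable_abse := integrable_hk x1.
  - exact: integrable_powR_right.
  - by move=> v _; rewrite normrM (ger0_norm (k0 _)) ler_wpM2r.
rewrite RintegralZl//; last first.
  have := integrable_powR_right 1 a0 x1.
  by rewrite (_ : EFin \o _ = EFin \o (fun u => (u - x) `^ (a - 1)))//; apply/funext => u /=; rewrite mul1r.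
rewrite Rintegral_powR_right// ler_wpM2l// ler_piMl ?invr_ge0 ?(ltW a0)//.
have x1' : 0 <= 1 - x by rewrite subr_ge0.
apply: (@le_trans _ _ (1 `^ a)); last by rewrite powR1.
apply: ge0_ler_powR; rewrite ?nnegrE ?(ltW a0)//.
by rewrite gerBl.
Qed.

Let conv e v : R := \int[mu]_(u in `[0, v])
  (f u * (e `^ (1 - a) * (v - u) `^ (a - 1) / (v - u + e))).

Let trunc_frac_int e : 0 < e ->
  \int[mu]_(x in `[0, 1]) (trunc_left a f e x * frac_int a h x) =
  \int[mu]_(v in `[0, 1]) (h v * conv e v).
Proof.
move=> e0.
pose phi (z : R * R) := trunc_left a f e z.1 * (h z.2 * k z).
have mt : measurable_fun setT (trunc_left a f e) by exact: measurable_trunc_left.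
have mphi : measurable_fun setT phi.
  apply: measurable_funM; first exact: measurableT_comp.
  by apply: measurable_funM => //; exact: measurableT_comp.
set C := M * e `^ (- a) *+ 2.
have tC x : 0 <= x -> `|trunc_left a f e x| <= C by exact: trunc_left_unif_bound.
have C0 : 0 <= C by exact: le_trans (tC 0 (lexx _)).
transitivity (\int[mu]_(x in `[0, 1]) \int[mu]_(y in `[x, 1]) phi (x, y)).
  apply: eq_Rintegral => x; rewrite inE/= in_itv/= => /andP[x0 x1].
  by rewrite /frac_int -RintegralZl//; exact: integrable_hk.
rewrite (Rintegral_triangle mphi).
  apply: eq_Rintegral => v; rewrite inE/= in_itv/= => /andP[v0 v1].
  rewrite /conv -(trunc_convolution a0 mf fM e0 v0) -RintegralZl//; last first.
    apply: integrable_dominated (integrable_powR_left C a0 v0) _ => //.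
      apply: measurable_funTS; apply: measurable_funM => //.
      by apply: measurable_powR_comp; exact: measurable_funB.
    move=> x; rewrite /= in_itv/= => /andP[x0 _].
    by rewrite normrM (ger0_norm (powR_ge0 _ _)) ler_wpM2r ?powR_ge0// tC.
  by apply: eq_Rintegral => x _; rewrite /phi /k/= mulrCA.
apply: (@triangle_integral_lty _ phi (C * (N / a)) 1 mphi) => x /andP[x0 x1].
apply: (@le_trans _ _ (\int[mu]_(y in `[x, 1%R]) ((C * N)%:E * (k (x, y))%:E))%E).
  apply: ge0_le_integral => //.
  - apply/measurable_EFinP; apply: measurable_funTS; apply: measurable_normr_comp.
    rewrite /phi/=; apply: measurable_funM; first exact: measurable_cst.
    by apply: measurable_funM; [exact: mh|exact: mk1].
  - apply/measurable_EFinP; apply: measurable_funTS.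
    by apply: measurable_funM; [exact: measurable_cst|exact: mk1].
  - move=> y _; rewrite -EFinM lee_fin !normrM (ger0_norm (k0 _)) -mulrA.
    by rewrite ler_pM ?mulr_ge0 ?tC// ler_wpM2r.
rewrite ge0_integralZl//; last 3 first.
- by apply/measurable_EFinP; apply: measurable_funTS; exact: mk1.
- by move=> y _; rewrite lee_fin.
- by rewrite lee_fin mulr_ge0.
rewrite /k integral_powR_right// -EFinM lee_fin -mulrA !ler_wpM2l//.
rewrite ler_piMl ?invr_ge0 ?(ltW a0)//.
have x1' : 0 <= 1 - x by rewrite subr_ge0.
apply: (@le_trans _ _ (1 `^ a)); last by rewrite powR1.
apply: ge0_ler_powR; rewrite ?nnegrE ?(ltW a0)//.
by rewrite gerBl.
Qed.

Let c : R := Gamma a * Gamma (1 - a).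

Let q (s : R) : R := s `^ (a - 1) / (1 + s).

Let q0 s : 0 < s -> 0 <= q s.
Proof. by move=> s0; rewrite divr_ge0 ?powR_ge0// addr_ge0// ltW. Qed.

Let mq : measurable_fun setT q.
Proof.
apply: measurable_funM; first exact: measurable_powR.
by apply: measurable_invr_comp; exact: measurable_funD.
Qed.

Let iq : mu.-integrable `]0, +oo[ (EFin \o q).
Proof. by have [] := Gamma_reflection a01. Qed.

Let G e v s : R := (if e * s <= v then f (v - e * s) else 0) * q s.

Let mG e v : measurable_fun setT (G e v).
Proof.
apply: measurable_funM => //; apply: measurable_fun_ifT => //.
  by apply: measurable_fun_ler => //; exact: measurable_funM.
by apply: measurableT_comp => //; apply: measurable_funB.
Qed.

Let GM e v s : 0 < s -> `|G e v s| <= M * q s.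
Proof.
move=> s0; rewrite normrM (ger0_norm (q0 s0)) ler_wpM2r ?q0//.
by case: ifP => // _; rewrite normr0.
Qed.

Let iMq : mu.-integrable `]0, +oo[ (EFin \o (fun s => M * q s)).
Proof.
rewrite (_ : EFin \o _ = (fun u => M%:E * (q u)%:E)%E); last exact/funext.
exact: integrableZl.
Qed.

Let iG e v : mu.-integrable `]0, +oo[ (EFin \o G e v).
Proof.
apply: (@integrable_dominated _ _ _ mu _ (G e v) (fun s => M * q s)) => //.
  by apply: measurable_funTS; exact: mG.
by move=> s; rewrite /= in_itv/= andbT; exact: GM.
Qed.

Let mconv_fun e : measurable_fun setT
  (fun z : R * R => f z.2 * (e `^ (1 - a) * (z.1 - z.2) `^ (a - 1) / (z.1 - z.2 + e))).
Proof.
apply: measurable_funM; first exact: measurableT_comp.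
apply: measurable_funM.
  by apply: measurable_funM => //; apply: measurable_powR_comp; exact: measurable_funB.
by apply: measurable_invr_comp; apply: measurable_funD => //; exact: measurable_funB.
Qed.

Let mconv_fun1 e v : measurable_fun setT
  (fun u : R => f u * (e `^ (1 - a) * (v - u) `^ (a - 1) / (v - u + e))).
Proof.
apply: measurable_funM => //; apply: measurable_funM.
  by apply: measurable_funM => //; apply: measurable_powR_comp; exact: measurable_funB.
by apply: measurable_invr_comp; apply: measurable_funD => //; exact: measurable_funB.
Qed.

(* The change of variables [u = v - e s]. *)
Let convE e v : 0 < e -> 0 < v -> conv e v = \int[mu]_(s in `]0, +oo[) G e v s.
Proof.
move=> e0 v0; have e0' : e != 0 by rewrite gt_eqF.
set F := (fun u => f u * (e `^ (1 - a) * (v - u) `^ (a - 1) / (v - u + e))).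
have iF : mu.-integrable `[0, v] (EFin \o F).
  apply: integrable_dominated (integrable_powR_left (M * (e `^ (1 - a) / e)) a0 (ltW v0)) _ => //.
    by apply: measurable_funTS; exact: mconv_fun1.
  move=> u; rewrite /= in_itv/= => /andP[u0 uv].
  have vue : 0 < v - u + e by rewrite ltr_wpDl// subr_ge0.
  rewrite normrM -(mulrA M) ler_pM// ger0_norm; last first.
    by rewrite divr_ge0 ?mulr_ge0 ?powR_ge0// ltW.
  rewrite mulrAC ler_wpM2r ?powR_ge0// ler_wpM2l ?powR_ge0//.
  by rewrite lef_pV2 ?posrE// lerDr subr_ge0.
have iF' : mu.-integrable setT (EFin \o (F \_ `[0, v])).
  rewrite -restrict_EFin; apply: (iffLR (integrable_mkcond _ _)) iF.
  exact: measurable_itv.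
have iF'' := integrable_affine (v : R) (_ : - e != 0) iF'.
rewrite /conv -/F Rintegral_mkcond.
have := Rintegral_affine (v : R) (_ : - e != 0) iF'.
rewrite oppr_eq0 => /(_ e0') h1.
have -> : \int[mu]_x (F \_ `[0, v]) x = e * \int[mu]_x (F \_ `[0, v]) (- e * x + v).
  by rewrite h1 normrN gtr0_norm// mulVKf.
rewrite -RintegralZl//; last by apply: iF''; rewrite oppr_eq0.
rewrite [RHS]Rintegral_mkcond; apply: eq_Rintegral => s _.
rewrite !patchE; have [s0|s0] := ltP 0 s; last first.
  rewrite [in RHS]memNset; last by rewrite /= in_itv/= ltNge s0.
  move: s0; rewrite le_eqVlt => /predU1P[->|s0].
    rewrite mulr0 add0r mem_set; last by rewrite /= in_itv/= lexx ltW.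
    by rewrite /F subrr powR0 ?mulr0 ?mul0r ?mulr0// subr_eq0 lt_eqF.
  rewrite memNset ?mulr0//= in_itv/= => /andP[_].
  by rewrite gerDr mulNr oppr_le0 pmulr_rge0// leNgt s0.
rewrite [in RHS]mem_set; last by rewrite /= in_itv/= s0.
have vE : - e * s + v = v - e * s by rewrite mulNr addrC.
have -> : (- e * s + v \in `[0, v]%classic) = (e * s <= v).
  apply/idP/idP => [/set_mem|es]; first by rewrite /= in_itv/= vE subr_ge0 => /andP[].
  by apply/mem_set; rewrite /= in_itv/= vE subr_ge0 es/= gerBl mulr_ge0 ?ltW.
rewrite /G; case: ifPn => es; last by rewrite mul0r mulr0.
rewrite vE /F /q subKr mulrCA; congr (_ * _).
rewrite powRM ?(ltW e0) ?(ltW s0)// mulrA.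
have -> : 1 - a = - (a - 1) by rewrite opprB.
have -> : e * s + e = e * (1 + s) by rewrite mulrDr mulr1 addrC.
have s1 : 1 + s != 0 by rewrite gt_eqF// addr_gt0.
rewrite powRN; field.
by rewrite e0' s1 gt_eqF// powR_gt0.
Qed.

Let conv_bound e v : 0 < e -> 0 < v -> `|conv e v| <= M * c.
Proof.
move=> e0 v0; rewrite convE// (le_trans (le_normr_Rintegral _ (iG _ _)))//.
have [_ _ cE] := Gamma_reflection a01.
rewrite /c -cE -RintegralZl//; apply: le_Rintegral => //.
- by have /integrable_abse := iG e v.
- by move=> s; rewrite /= in_itv/= andbT; exact: GM.
Qed.

Let conv_cvg v : 0 < v -> conv (harmonic n) v @[n --> \oo] --> f v * c.
Proof.
move=> v0; have h0 n : 0 < harmonic n :> R by rewrite /= invr_gt0.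
under eq_fun do rewrite convE//.
have [_ _ cE] := Gamma_reflection a01.
rewrite /c -cE -RintegralZl//.
apply: (@dominated_cvg_Rintegral _ _ _ mu `]0, +oo[%classic (fun n => G (harmonic n) v)
  (fun s => f v * q s) (EFin \o (fun s => M * q s))) => //.
- by move=> n; apply: measurable_funTS; exact: mG.
- by apply: measurable_funTS; apply: measurable_funM => //; exact: mq.
- apply: aeW => s; rewrite /= in_itv/= andbT => s0.
  have hs : harmonic n * s @[n --> \oo] --> (0 : R).
    by rewrite -[X in _ --> X](mul0r s); apply: cvgMr_tmp; exact: cvg_harmonic.
  apply: cvgMr_tmp.
  have hvs : v - harmonic n * s @[n --> \oo] --> v.
    by rewrite -[X in _ --> X]subr0; apply: cvgB => //; exact: cvg_cst.
  have : f (v - harmonic n * s) @[n --> \oo] --> f v.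
    apply: (@cvg_comp _ _ _ (fun n => v - harmonic n * s) f _ (nbhs v)); last exact: cf.
    exact: hvs.
  apply: cvg_trans; apply: near_eq_cvg; near=> n.
  rewrite ifT// ltW//; near: n.
  by move/cvgrPdist_lt : hs => /(_ _ v0); apply: filterS => n;
    rewrite sub0r normrN; apply: le_lt_trans; exact: ler_norm.
- by move=> n s; rewrite /= in_itv/= andbT lee_fin; exact: GM.
Unshelve. all: by end_near. Qed.

Hypothesis f_fin : (norm_alpha a 1 f < +oo)%E.

Lemma integrable_abs_left : mu.-integrable `[0, 1] (abs_left a f).
Proof.
apply/integrableP; split; first by apply: measurable_funTS; exact: measurable_abs_left.
under eq_integral do rewrite gee0_abs ?abs_left_ge0//.
exact: f_fin.
Qed.

Lemma integrable_frac_left_mul (g : R -> R) (C : R) : measurable_fun setT g ->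
  (forall x, 0 <= x <= 1 -> `|g x| <= C) ->
  mu.-integrable `[0, 1] (EFin \o (fun x => frac_left a f x * g x)).
Proof.
move=> mg gC; have C0 : 0 <= C by rewrite (le_trans _ (gC 0 _))// lexx ler01.
have iC : mu.-integrable `[0, 1] (fun x => C%:E * abs_left a f x)%E.
  by apply: integrableZl => //; exact: integrable_abs_left.
apply: le_integrable iC => //.
  apply/measurable_EFinP; apply: measurable_funTS; apply: measurable_funM => //.
  exact: measurable_frac_left.
move=> x; rewrite /= in_itv/= => /andP[x0 x1].
rewrite normrM EFinM abseM gee0_abs ?lee_fin// gee0_abs ?abs_left_ge0// muleC.
by rewrite lee_pmul ?lee_fin// ?gC ?x0// (frac_left_bound a0 a1).
Qed.

(* Fubini for the truncated derivative, whose kernel is bounded; the truncation is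
   then removed by dominated convergence on both sides. *)
Lemma Rintegral_frac_left_frac_int :
  \int[mu]_(x in `[0, 1]) (frac_left a f x * frac_int a h x) =
  c * \int[mu]_(x in `[0, 1]) (f x * h x).
Proof.
have mt e : measurable_fun setT (trunc_left a f e) by exact: measurable_trunc_left.
have mJ := measurable_frac_int.
have h0 n : 0 < harmonic n :> R by rewrite /= invr_gt0.
pose S n := \int[mu]_(x in `[0, 1]) (trunc_left a f (harmonic n) x * frac_int a h x).
have i1 := integrable_frac_left_mul mJ frac_int_bound.
have it n : mu.-integrable `[0, 1]
    (EFin \o (fun x => trunc_left a f (harmonic n) x * frac_int a h x)).
  apply: (@integrable_bounded_itv _ _ (M * (harmonic n) `^ (- a) *+ 2 * (N / a))).
    exact: measurable_funM.
  move=> x x01; have /andP[x0 _] := x01; rewrite normrM ler_pM ?frac_int_bound//.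
  exact: trunc_left_unif_bound.
have c0 : 0 < c by have [] := Gamma_reflection a01.
have icv n : mu.-integrable `[0, 1] (EFin \o (fun v => h v * conv (harmonic n) v)).
  have mc : measurable_fun setT (conv (harmonic n)).
    by apply: (measurable_Rintegral_itv (lo := fun=> 0) (hi := id) _ _ (mconv_fun _)).
  apply: (@integrable_bounded_itv _ _ (N * (M * c))); first exact: measurable_funM.
  move=> v /andP[]; rewrite le_eqVlt => /predU1P[<-|v0] _.
    by rewrite /conv set_itv1 Rintegral_set1 mulr0 normr0 mulr_ge0// mulr_ge0// ltW.
  by rewrite normrM ler_pM// conv_bound.
have S1 : S n @[n --> \oo] --> \int[mu]_(x in `[0, 1]) (frac_left a f x * frac_int a h x).
  rewrite Rintegral_itv_cc_oo// /S; under eq_fun do rewrite Rintegral_itv_cc_oo//.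
  apply: (@dominated_cvg_Rintegral _ _ _ mu `]0, 1[%classic
    (fun n x => trunc_left a f (harmonic n) x * frac_int a h x)
    (fun x => frac_left a f x * frac_int a h x)
    (fun x => abs_left a f x * (N / a)%:E)%E) => //.
  - by move=> n; apply: measurable_funTS; apply: measurable_funM; [exact: mt|exact: mJ].
  - apply: measurable_funTS; apply: measurable_funM; last exact: mJ.
    exact: measurable_frac_left.
  - have := @integrable_ae _ _ _ mu _ (measurable_itv `[0%R, 1%R]) _ integrable_abs_left.
    apply: filterS => x fin; rewrite /= in_itv/= => /andP[x0 x1].
    have afin : (abs_left a f x < +oo)%E.
      have : `[0, 1]%classic x by rewrite /= in_itv/= !ltW.
      by move=> /fin; rewrite fin_numElt => /andP[].
    by have := cvg_trunc_left a0 mf fM x0 afin; exact: cvgMr_tmp.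
  - have : mu.-integrable `]0, 1[ (abs_left a f).
      by apply: integrableS integrable_abs_left => //; exact: subset_itv_oo_cc.
    exact: integrableZr.
  - move=> n x; rewrite /= in_itv/= => /andP[x0 x1].
    rewrite normrM EFinM; apply: lee_pmul => //.
      exact: (trunc_left_bound a0 a1 mf fM).
    by rewrite lee_fin frac_int_bound// !ltW.
have ifh : mu.-integrable `[0, 1] (EFin \o (fun x => f x * h x)).
  apply: (@integrable_bounded_itv _ _ (M * N)); first exact: measurable_funM.
  by move=> x _; rewrite normrM ler_pM.
have ihfc : mu.-integrable `[0, 1] (EFin \o (fun v => h v * (f v * c))).
  apply: (@integrable_bounded_itv _ _ (N * (M * c))).
    by apply: measurable_funM => //; exact: measurable_funM.
  move=> x _; rewrite normrM (normrM (f x)) (gtr0_norm c0).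
  have c0' := ltW c0; apply: ler_pM => //; first exact: mulr_ge0.
  exact: ler_wpM2r.
have S2 : S n @[n --> \oo] --> \int[mu]_(v in `[0, 1]) (h v * (f v * c)).
  rewrite /S; under eq_fun do rewrite trunc_frac_int// Rintegral_itv_cc_oo//.
  rewrite Rintegral_itv_cc_oo//.
  apply: (@dominated_cvg_Rintegral _ _ _ mu `]0, 1[%classic
    (fun n v => h v * conv (harmonic n) v) (fun v => h v * (f v * c))
    (EFin \o cst (N * (M * c)))) => //.
  - move=> n; apply: measurable_funTS; apply: measurable_funM => //.
    by apply: (measurable_Rintegral_itv (lo := fun=> 0) (hi := id) _ _ (mconv_fun _)).
  - by apply: measurable_funTS; apply: measurable_funM => //; exact: measurable_funM.
  - apply: aeW => v; rewrite /= in_itv/= => /andP[v0 _].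
    by apply: cvgMl_tmp; exact: conv_cvg.
  - have : mu.-integrable `[0, 1] (EFin \o cst (N * (M * c))).
      by apply: (@integrable_bounded_itv _ _ `|N * (M * c)|).
    by apply: integrableS => //; exact: subset_itv_oo_cc.
  - move=> n v; rewrite /= in_itv/= => /andP[v0 _].
    by rewrite lee_fin normrM ler_pM// conv_bound.
rewrite (cvg_unique _ S1 S2)// -RintegralZl//.
by apply: eq_Rintegral => x _; ring.
Qed.

Lemma gLS_primitive (g : R -> R) :
  (forall u : R, 0 < u < 1 -> is_derive u 1 g (h u)) ->
  (forall u v, 0 <= u <= 1 -> 0 <= v <= 1 -> `|g u - g v| <= N * `|u - v|) ->
  measurable_fun setT g ->
  gLS a 1 f g = \int[mu]_(x in `[0, 1]) (f x * h x).
Proof.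
move=> dg lg mg; rewrite /gLS.
have [c0 _ _] := Gamma_reflection a01.
have -> : \int[mu]_(x in `[0, 1]) (frac_left a f x * frac_right a 1 g x) =
    \int[mu]_(x in `[0, 1]) (frac_left a f x * frac_int a h x).
  apply: eq_Rintegral => x; rewrite inE/= in_itv/= => x01.
  by rewrite (frac_right_primitive a01 x01 ch hN dg lg mg).
rewrite Rintegral_frac_left_frac_int /c [Gamma (1 - a) * _]mulrC mulrA mulVf ?mul1r//.
by rewrite gt_eqF.
Qed.

End integration_by_parts.

Section hoelder_estimate.
Context {R : realType}.
Local Notation mu := (@lebesgue_measure R).

Definition hoelder_with (L p : R) (g : R -> R) :=
  forall u v, 0 <= u <= 1 -> 0 <= v <= 1 -> `|g u - g v| <= L * `|u - v| `^ p.

Lemma le1_powR (x p : R) : 0 <= x <= 1 -> 0 <= p -> x `^ p <= 1.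
Proof.
move=> /andP[x0 x1] p0; apply: (@le_trans _ _ (1 `^ p)); last by rewrite powR1.
by apply: ge0_ler_powR; rewrite ?nnegrE.
Qed.

Variables (a p : R).
Hypotheses (a01 : 0 < a < 1) (ap : 1 - a < p).

Let a0 : 0 < a. Proof. by case/andP: a01. Qed.
Let a1 : a < 1. Proof. by case/andP: a01. Qed.
Let s : R := p - 1 + a.
Let s0 : 0 < s. Proof. by rewrite /s; move: ap; lra. Qed.
Let p0 : 0 < p. Proof. by move: ap a1; lra. Qed.

Lemma measurable_frac_right (g : R -> R) : measurable_fun setT g ->
  measurable_fun setT (frac_right a 1 g).
Proof.
move=> mg; apply: measurable_funD.
  apply: measurable_funM; first exact: measurable_funB.
  by apply: measurable_invr_comp; apply: measurable_powR_comp; exact: measurable_funB.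
apply: measurable_funM => //.
apply: (@measurable_Rintegral_itv _ _ _ id (fun=> 1)
  (fun z => (g z.2 - g z.1) / (z.2 - z.1) `^ (2 - a))) => //.
apply: measurable_funM.
  by apply: measurable_funB; exact: measurableT_comp.
by apply: measurable_invr_comp; apply: measurable_powR_comp; exact: measurable_funB.
Qed.

Let quotient_bound (L : R) (r : R -> R) x u : hoelder_with L p r -> 0 <= L ->
  0 <= x -> x <= u -> u <= 1 ->
  `|(r u - r x) / (u - x) `^ (2 - a)| <= L * (u - x) `^ (s - 1).
Proof.
move=> hr L0 x0; rewrite le_eqVlt => /predU1P[<-|xu] u1.
  by rewrite !subrr mul0r normr0 mulr_ge0 ?powR_ge0.
have xu0 : 0 < u - x by rewrite subr_gt0.
rewrite normrM normfV (ger0_norm (powR_ge0 _ _)).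
apply: (@le_trans _ _ (L * (u - x) `^ p / (u - x) `^ (2 - a))).
  rewrite ler_wpM2r ?invr_ge0 ?powR_ge0//.
  have := hr u x; rewrite (gtr0_norm xu0); apply.
    by rewrite u1 andbT (le_trans x0)// ltW.
  by rewrite x0 (le_trans (ltW xu)).
rewrite -mulrA ler_wpM2l// -powRN -powRD ?(gt_eqF xu0) ?implybT//.
by rewrite /s (_ : p - (2 - a) = p - 1 + a - 1)//; ring.
Qed.

Lemma frac_right_integrable (L : R) (r : R -> R) x : hoelder_with L p r -> 0 <= L ->
  measurable_fun setT r -> 0 <= x <= 1 ->
  mu.-integrable `[x, 1] (EFin \o (fun u => (r u - r x) / (u - x) `^ (2 - a))).
Proof.
move=> hr L0 mr /andP[x0 x1].
apply: integrable_dominated (integrable_powR_right L s0 x1) _ => //.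
  apply: measurable_funTS; apply: measurable_funM; first exact: measurable_funB.
  by apply: measurable_invr_comp; apply: measurable_powR_comp; exact: measurable_funB.
by move=> u; rewrite /= in_itv/= => /andP[xu u1]; exact: quotient_bound.
Qed.

Lemma frac_right_hoelder_bound (L : R) (r : R -> R) x : hoelder_with L p r -> 0 <= L ->
  measurable_fun setT r -> 0 <= x <= 1 ->
  `|frac_right a 1 r x| <= L * (1 + s^-1).
Proof.
move=> hr L0 mr x01; have /andP[x0 x1] := x01.
have x1' : 0 <= 1 - x by rewrite subr_ge0.
have x1'' : 0 <= 1 - x <= 1 by rewrite x1' gerBl.
rewrite (le_trans (ler_normD _ _))// mulrDr mulr1 lerD//.
  have [->|x1n] := eqVneq x 1; first by rewrite subrr mul0r normr0.
  have x1l : 0 < 1 - x by rewrite subr_gt0 lt_neqAle x1n.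
  rewrite normrM normfV (ger0_norm (powR_ge0 _ _)).
  rewrite ler_pdivrMr ?powR_gt0//; have := hr 1 x.
  rewrite (gtr0_norm x1l) lexx ler01 => /(_ isT x01) /le_trans; apply.
  rewrite ler_wpM2l// -(subrK (1 - a) p) powRD ?(gt_eqF x1l) ?implybT//.
  by rewrite ler_piMl ?powR_ge0// le1_powR// subr_ge0 ltW.
rewrite normrM gtr0_norm ?subr_gt0// (@le_trans _ _ (1 * (L * s^-1)))//; last by rewrite mul1r.
rewrite ler_pM ?subr_ge0 ?(ltW a1)//; first by rewrite gerBl ltW.
have fi := frac_right_integrable hr L0 mr x01.
rewrite (le_trans (le_normr_Rintegral _ fi))//.
apply: (@le_trans _ _ (\int[mu]_(u in `[x, 1]) (L * (u - x) `^ (s - 1)))).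
  apply: le_Rintegral => //.
  - by have /integrable_abse := fi.
  - exact: integrable_powR_right.
  - by move=> u; rewrite /= in_itv/= => /andP[xu u1]; exact: quotient_bound.
rewrite RintegralZl//; last first.
  have := integrable_powR_right 1 s0 x1.
  by rewrite (_ : EFin \o _ = EFin \o (fun u => (u - x) `^ (s - 1)))//;
    apply/funext => u /=; rewrite mul1r.
rewrite Rintegral_powR_right// ler_wpM2l// ler_piMl ?invr_ge0 ?(ltW s0)//.
by rewrite le1_powR// ltW.
Qed.

Variables (f : R -> R).
Hypotheses (cf : continuous f).
Hypothesis f_fin : (norm_alpha a 1 f < +oo)%E.

Let mf : measurable_fun setT f. Proof. exact: continuous_measurable_fun. Qed.

Let integrable_left (L : R) (g : R -> R) : hoelder_with L p g -> 0 <= L ->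
  measurable_fun setT g ->
  mu.-integrable `[0, 1] (EFin \o (fun x => frac_left a f x * frac_right a 1 g x)).
Proof.
move=> hg L0 mg; apply: (integrable_frac_left_mul (C := L * (1 + s^-1)) a01 cf f_fin (measurable_frac_right mg)).
by move=> x x01; exact: frac_right_hoelder_bound hg L0 mg x01.
Qed.

Lemma gLS_diff_bound (K K' L : R) (g g' : R -> R) :
  measurable_fun setT g -> measurable_fun setT g' ->
  0 <= K -> hoelder_with K p g -> 0 <= K' -> hoelder_with K' p g' ->
  0 <= L -> hoelder_with L p (g \- g') ->
  `|gLS a 1 f g - gLS a 1 f g'| <=
    (Gamma (1 - a) * Gamma a)^-1 * (fine (norm_alpha a 1 f) * (1 + s^-1)) * L.
Proof.
move=> mg mg' K0 hg K'0 hg' L0 hr.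
have [c0 _ _] := Gamma_reflection a01.
rewrite /gLS -mulrBr normrM gtr0_norm; last by rewrite invr_gt0 mulrC.
rewrite -mulrA; apply: ler_wpM2l; first by rewrite invr_ge0 mulrC ltW.
have ig := integrable_left hg K0 mg; have ig' := integrable_left hg' K'0 mg'.
have mr : measurable_fun setT (g \- g') by exact: measurable_funB.
have ir := integrable_left hr L0 mr.
rewrite -RintegralB//.
have -> : \int[mu]_(x in `[0, 1]) (frac_left a f x * frac_right a 1 g x -
      frac_left a f x * frac_right a 1 g' x) =
    \int[mu]_(x in `[0, 1]) (frac_left a f x * frac_right a 1 (g \- g') x).
  apply: eq_Rintegral => x; rewrite inE/= in_itv/= => x01.
  rewrite -mulrBr; congr (_ * _); rewrite /frac_right/=.
  have i1 := frac_right_integrable hg K0 mg x01.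
  have i2 := frac_right_integrable hg' K'0 mg' x01.
  have -> : \int[mu]_(u in `[x, 1]) ((g u - g' u - (g x - g' x)) / (u - x) `^ (2 - a)) =
      \int[mu]_(u in `[x, 1]) ((g u - g x) / (u - x) `^ (2 - a)) -
      \int[mu]_(u in `[x, 1]) ((g' u - g' x) / (u - x) `^ (2 - a)).
    by rewrite -RintegralB//; apply: eq_Rintegral => u _; ring.
  ring.
have nfin : norm_alpha a 1 f \is a fin_num.
  rewrite ge0_fin_numE//; apply: integral_ge0 => x _; exact: abs_left_ge0.
rewrite -lee_fin EFin_normr_Rintegral//.
apply: (le_trans (le_abse_integral _ _ _)) => //; first exact: measurable_int ir.
have -> : fine (norm_alpha a 1 f) * (1 + s^-1) * L = L * (1 + s^-1) * fine (norm_alpha a 1 f) by ring.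
rewrite [leRHS]EFinM fineK//.
have mA : measurable_fun setT (abs_left a f) by exact: measurable_abs_left.
apply: (@le_trans _ _ (\int[mu]_(x in `[0%R, 1%R]) ((L * (1 + s^-1))%:E * abs_left a f x))%E).
  apply: ge0_le_integral => //.
  - apply: measurableT_comp => //; exact: measurable_int ir.
  - by apply: measurable_funTS; exact: emeasurable_funM.
  - move=> x; rewrite /= in_itv/= => x01; have /andP[x0 _] := x01.
    rewrite normrM EFinM muleC; apply: lee_pmul => //.
      by rewrite lee_fin frac_right_hoelder_bound.
    exact: (frac_left_bound a0 a1 mf).
rewrite ge0_integralZl//.
- exact: measurable_funTS.
- by move=> x _; exact: abs_left_ge0.
- by rewrite lee_fin mulr_ge0// addr_ge0// invr_ge0 ltW.
Qed.

End hoelder_estimate.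

(** * Mollified integrals *)

Section mollification.
Context {R : realType}.
Local Notation mu := (@lebesgue_measure R).

(* The difference quotient of step [1 - t] of [g] stopped at time [t]. *)
Definition moll (g : R -> R) (t x : R) : R :=
  (g (Num.min (x + (1 - t)) t) - g (Num.min x t)) / (1 - t).

Lemma continuous_minr (t : R) : continuous (fun y : R => Num.min y t).
Proof.
move=> y; have -> : (fun y : R => Num.min y t) = (fun y => (y + t - `|y - t|) / 2).
  by apply/funext => z; rewrite minr_absE.
apply: cvgMr_tmp; apply: cvgB; first by apply: cvgD; [exact: cvg_id|exact: cvg_cst].
by apply: cvg_norm; apply: cvgB; [exact: cvg_id|exact: cvg_cst].
Qed.

Lemma minr_lipschitz (t x y : R) : `|Num.min x t - Num.min y t| <= `|x - y|.
Proof.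
by case: (leP x t) => ?; case: (leP y t) => ?; rewrite ?subrr ?normr0 ?normr_ge0//;
  rewrite ler_norml; have := ler_norm (x - y); have := ler_norm (y - x);
  rewrite distrC => ? ?; apply/andP; split; lra.
Qed.

Variables (g : R -> R) (t Mg K q : R).
Hypotheses (t0 : 0 <= t) (t1 : t < 1).
Hypotheses (cg : continuous g) (gM : forall x, `|g x| <= Mg).
Hypotheses (K0 : 0 <= K) (q0 : 0 < q) (gK : hoelder_with K q g).

Let e := 1 - t.
Let e0 : 0 < e. Proof. by rewrite subr_gt0. Qed.
Let G y := g (Num.min y t).
Let cG : continuous G.
Proof. by move=> y; apply: continuous_comp; [exact: continuous_minr|exact: cg]. Qed.
Let mG : measurable_fun setT G. Proof. exact: continuous_measurable_fun. Qed.
Let Mg0 : 0 <= Mg. Proof. exact: le_trans (gM 0). Qed.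
Let iG b c : mu.-integrable `[b, c] (EFin \o G).
Proof. by apply: (@integrable_bounded_itv _ _ Mg) => // u _; exact: gM. Qed.

Let Phi x := \int[mu]_(y in `[0, x]) G y.

Let is_derive_Phi (u : R) : 0 < u -> is_derive u 1 Phi (G u).
Proof.
move=> u0; have uu : u < u + 1 by rewrite ltrDl.
have [d1 d2] := @continuous_FTC1_closed _ G 0 u (u + 1) uu (iG _ _) u0 (cG (x:=u)).
by rewrite -d2 derive1E; exact: derivableP.
Qed.

Definition mollified (x : R) : R := (Phi (x + e) - Phi x) / e.

Lemma continuous_moll : continuous (moll g t).
Proof.
move=> x; apply: cvgMr_tmp; apply: cvgB; last exact: cG.
apply: (@continuous_comp _ _ _ (fun x => x + e) G); last exact: cG.
by apply: cvgD; [exact: cvg_id|exact: cvg_cst].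
Qed.

Lemma moll_bound x : `|moll g t x| <= Mg *+ 2 / e.
Proof.
rewrite normrM normfV (gtr0_norm e0) ler_wpM2r ?invr_ge0 ?(ltW e0)//.
by rewrite (le_trans (ler_normB _ _))// mulr2n lerD.
Qed.

Lemma is_derive_mollified (u : R) : 0 < u -> is_derive u 1 mollified (moll g t u).
Proof.
move=> u0; have ue0 : 0 < u + e by rewrite addr_gt0.
have d1 : is_derive u 1 (fun x => Phi (x + e)) (G (u + e)).
  have ds : is_derive u 1 (fun x => x + e) 1 by apply: is_derive_eq; rewrite addr0.
  have := @is_derive1_comp _ Phi (fun x => x + e) u _ _ (is_derive_Phi ue0) ds.
  by rewrite mulr1.
have := is_deriveM (is_deriveB d1 (is_derive_Phi u0)) (is_derive_cst e^-1 u 1).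
move=> d2; apply: is_derive_eq; rewrite /GRing.scale/= mulr0 add0r mulrC; reflexivity.
Qed.

Lemma measurable_mollified : measurable_fun setT mollified.
Proof.
have mPhi : measurable_fun setT Phi.
  apply: (@measurable_Rintegral_itv _ _ _ (fun=> 0) id (fun z => G z.2)) => //.
  exact: measurableT_comp.
apply: measurable_funM => //; apply: measurable_funB => //.
by apply: measurableT_comp => //; exact: measurable_funD.
Qed.

Let PhiB x y : 0 <= x -> x <= y -> Phi y - Phi x = \int[mu]_(z in `[x, y]) G z.
Proof.
move=> x0 xy; rewrite /Phi Rintegral_itvB ?bnd_simp//.
rewrite Rintegral_itv_obnd_cbnd//.
by apply: integrableS (iG x y) => //; exact: subset_itv_oc_cc.
Qed.

Let Phi_lipschitz x y : 0 <= x -> x <= y -> `|Phi y - Phi x| <= Mg * (y - x).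
Proof.
move=> x0 xy; rewrite PhiB// (le_trans (le_normr_Rintegral _ (iG _ _)))//.
apply: (@le_trans _ _ (\int[mu]_(z in `[x, y]) Mg)).
  apply: le_Rintegral => //.
  - by have /integrable_abse := iG x y.
  - by apply: (@integrable_bounded_itv _ _ `|Mg|).
  - by move=> z _; exact: gM.
rewrite Rintegral_cst//= lebesgue_measure_itv/= lte_fin.
by move: xy; rewrite le_eqVlt => /predU1P[->|xy]; rewrite ?ltxx ?xy ?subrr//.
Qed.

Lemma mollified_lipschitz u v : 0 <= u <= 1 -> 0 <= v <= 1 ->
  `|mollified u - mollified v| <= Mg *+ 2 / e * `|u - v|.
Proof.
wlog vu : u v / v <= u.
  move=> H u01 v01; have [|/ltW] := leP v u; first by move/H; apply.
  by move=> uv; rewrite distrC [X in _ * X]distrC; exact: H.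
move=> /andP[u0 u1] /andP[v0 v1]; rewrite (ger0_norm (_ : 0 <= u - v)) ?subr_ge0//.
rewrite /mollified -mulrBl normrM normfV (gtr0_norm e0) mulrAC.
rewrite ler_wpM2r ?invr_ge0 ?(ltW e0)//.
rewrite (_ : Phi (u + e) - Phi u - (Phi (v + e) - Phi v) =
  (Phi (u + e) - Phi (v + e)) - (Phi u - Phi v)); last by ring.
rewrite (le_trans (ler_normB _ _))// mulr2n mulrDl lerD ?Phi_lipschitz//.
have -> : u - v = (u + e) - (v + e) by ring.
by apply: Phi_lipschitz; rewrite ?lerD2r// addr_ge0// ltW.
Qed.

Let mollifiedE x : 0 <= x -> mollified x = e^-1 * \int[mu]_(y in `[0, e]) G (x + y).
Proof.
move=> x0; rewrite /mollified mulrC PhiB// ?lerDl ?(ltW e0)//; congr (_ * _).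
have iF : mu.-integrable setT (EFin \o (G \_ `[x, x + e])).
  by rewrite -restrict_EFin; apply: (iffLR (integrable_mkcond _ _)) (iG x (x + e)).
rewrite Rintegral_mkcond [RHS]Rintegral_mkcond.
have := Rintegral_affine x (oner_neq0 R) iF.
rewrite normr1 invr1 mul1r => <-; apply: eq_Rintegral => y _.
rewrite mul1r !patchE addrC.
rewrite (_ : (x + y \in `[x, x + e]%classic) = (y \in `[0, e]%classic))//.
by apply/idP/idP => /set_mem h; apply/mem_set; move: h;
  rewrite /= !in_itv/= lerDl lerD2l.
Qed.

Let average_bound (phi : R -> R) (C : R) : measurable_fun setT phi ->
  (forall y, 0 <= y <= e -> `|phi y| <= C) ->
  `|e^-1 * \int[mu]_(y in `[0, e]) phi y| <= C.
Proof.
move=> mphi phiC; have ip : mu.-integrable `[0, e] (EFin \o phi).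
  exact: (integrable_bounded_itv mphi phiC).
rewrite normrM gtr0_norm ?invr_gt0// ler_pdivrMl// mulrC.
rewrite (le_trans (le_normr_Rintegral _ ip))//.
apply: (@le_trans _ _ (\int[mu]_(z in `[0, e]) C)).
  apply: le_Rintegral => //.
  - by have /integrable_abse := ip.
  - by apply: (@integrable_bounded_itv _ _ `|C|).
rewrite Rintegral_cst//= lebesgue_measure_itv/= lte_fin e0/= subr0//.
Qed.

Let mGx (x : R) : measurable_fun setT (fun y : R => G (x + y)).
Proof. by apply: measurableT_comp => //; exact: measurable_funD. Qed.

Let iGx (x : R) : mu.-integrable `[0, e] (EFin \o (fun y => G (x + y))).
Proof. by apply: (@integrable_bounded_itv _ _ Mg) => // u _; exact: gM. Qed.

Let min01 (x y : R) : 0 <= x -> 0 <= y -> 0 <= Num.min (x + y) t <= 1.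
Proof. by move=> x0 y0; rewrite le_min addr_ge0// t0/= ge_min (ltW t1) orbT. Qed.

Lemma mollified_hoelder : hoelder_with K q mollified.
Proof.
move=> u v /andP[u0 u1] /andP[v0 v1]; rewrite !mollifiedE// -mulrBr -RintegralB//.
apply: average_bound; first exact: measurable_funB.
move=> y /andP[y0 ye]; rewrite (le_trans (gK _ _))// ?min01// ler_wpM2l//.
apply: ge0_ler_powR; rewrite ?nnegrE ?(ltW q0)//.
rewrite (le_trans (minr_lipschitz _ _ _))//.
by rewrite (_ : u + y - (v + y) = u - v)//; ring.
Qed.

Lemma mollified_approx u : 0 <= u <= 1 -> `|mollified u - g u| <= K * e `^ q.
Proof.
move=> /andP[u0 u1]; rewrite mollifiedE//.
have -> : g u = e^-1 * \int[mu]_(y in `[0, e]) (cst (g u) y).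
  rewrite Rintegral_cst//= lebesgue_measure_itv/= lte_fin e0/= subr0.
  by rewrite mulrC mulfK// gt_eqF.
rewrite -mulrBr -RintegralB//; last by apply: (@integrable_bounded_itv _ _ Mg) => // y _; exact: gM.
apply: average_bound; first exact: measurable_funB.
move=> y /andP[y0 ye]; rewrite (le_trans (gK _ _)) ?min01 ?u0//.
rewrite ler_wpM2l//; apply: ge0_ler_powR; rewrite ?nnegrE ?(ltW q0) ?(ltW e0)//.
case: (leP (u + y) t) => uyt; first by rewrite addrC addKr ger0_norm.
by rewrite ler_norml; apply/andP; split; move: ye; rewrite /e; lra.
Qed.

Lemma mollified_diff_hoelder p : 0 < p -> p <= q ->
  hoelder_with (K *+ 2 * e `^ (q - p)) p (g \- mollified).
Proof.
move=> p0 pq u v u01 v01 /=.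
have qp : 0 <= q - p by rewrite subr_ge0.
have [->|uv] := eqVneq u v; first by rewrite !subrr normr0 mulr_ge0 ?mulr_ge0 ?mulrn_wge0 ?powR_ge0.
have uv0 : 0 < `|u - v| by rewrite normr_gt0 subr_eq0.
have powqE x : 0 < x -> x `^ q = x `^ (q - p) * x `^ p.
  by move=> x0; rewrite -powRD ?subrK// (gt_eqF x0) implybT.
have [uve|euv] := leP `|u - v| e.
  apply: (@le_trans _ _ (K *+ 2 * `|u - v| `^ q)).
    rewrite (_ : g u - mollified u - (g v - mollified v) =
      (g u - g v) - (mollified u - mollified v)); last by ring.
    by rewrite (le_trans (ler_normB _ _))// mulr2n mulrDl lerD ?gK// mollified_hoelder.
  rewrite -mulrA ler_wpM2l ?mulrn_wge0//.
  rewrite powqE// ler_wpM2r ?powR_ge0//.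
  by apply: ge0_ler_powR; rewrite ?nnegrE ?(ltW e0).
apply: (@le_trans _ _ (K *+ 2 * e `^ q)).
  rewrite (_ : g u - mollified u - (g v - mollified v) =
    (mollified v - g v) - (mollified u - g u)); last by ring.
  by rewrite (le_trans (ler_normB _ _))// mulr2n mulrDl lerD ?mollified_approx.
rewrite -mulrA ler_wpM2l ?mulrn_wge0//.
rewrite (powqE _ e0) ler_wpM2l ?powR_ge0//.
by apply: ge0_ler_powR; rewrite ?nnegrE ?(ltW p0) ?(ltW e0) ?(ltW euv).
Qed.

End mollification.

Section approximation.
Context {R : realType}.
Local Notation mu := (@lebesgue_measure R).

Lemma hoelder_withW (K p q : R) (g : R -> R) : 0 <= K -> 0 < p -> p <= q ->
  hoelder_with K q g -> hoelder_with K p g.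
Proof.
move=> K0 p0 pq gK u v u01 v01; rewrite (le_trans (gK _ _ u01 v01))// ler_wpM2l//.
have [->|uv] := eqVneq u v.
  by rewrite subrr normr0 !powR0// gt_eqF// (lt_le_trans p0).
have uv0 : 0 < `|u - v| by rewrite normr_gt0 subr_eq0.
have uv1 : `|u - v| <= 1.
  by move: u01 v01 => /andP[? ?] /andP[? ?]; rewrite ler_norml; apply/andP; split; lra.
by rewrite ger_powR// uv0 uv1.
Qed.

Lemma moll_integral_approx (a p q K M Mg : R) (f g : R -> R) :
  0 < a < 1 -> 1 - a < p -> p <= q -> 0 <= K ->
  continuous f -> (forall x, `|f x| <= M) -> (norm_alpha a 1 f < +oo)%E ->
  continuous g -> (forall x, `|g x| <= Mg) -> hoelder_with K q g ->
  exists2 C : R, 0 <= C & forall t, 0 <= t -> t < 1 ->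
    `|\int[mu]_(x in `[0, 1]) (f x * moll g t x) - gLS a 1 f g| <= C * (1 - t) `^ (q - p).
Proof.
move=> a01 ap pq K0 cf fM f_fin cg gM gK.
have p0 : 0 < p by case/andP: a01 => ? ?; lra.
have q0 : 0 < q by exact: lt_le_trans pq.
have [c0 _ _] := Gamma_reflection a01.
have mg : measurable_fun setT g by exact: continuous_measurable_fun.
exists ((Gamma (1 - a) * Gamma a)^-1 *
  (fine (norm_alpha a 1 f) * (1 + (p - 1 + a)^-1)) * (K *+ 2)).
  rewrite !mulr_ge0 ?mulrn_wge0//.
  - by rewrite invr_ge0 mulrC ltW.
  - by rewrite fine_ge0// integral_ge0// => x _; exact: abs_left_ge0.
  - by rewrite addr_ge0// invr_ge0; case/andP: a01 => ? ?; lra.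
move=> t t0 t1.
have e0 : 0 < 1 - t by rewrite subr_gt0.
have mm : measurable_fun setT (mollified g t) by exact: measurable_mollified.
have <- : gLS a 1 f (mollified g t) = \int[mu]_(x in `[0, 1]) (f x * moll g t x).
  apply: (@gLS_primitive _ _ M (Mg *+ 2 / (1 - t))) => //.
  - exact: continuous_moll.
  - exact: moll_bound.
  - by move=> u /andP[u0 _]; exact: (is_derive_mollified t1 cg gM).
  - exact: mollified_lipschitz.
rewrite distrC -(mulrA _ (K *+ 2)).
have gp := hoelder_withW K0 p0 pq gK.
have hm : hoelder_with K q (mollified g t) by exact: (mollified_hoelder t0 t1 cg gM).
apply: (gLS_diff_bound a01 ap cf f_fin mg mm K0 gp K0 (hoelder_withW K0 p0 pq hm)).
  by rewrite mulr_ge0 ?mulrn_wge0 ?powR_ge0.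
exact: (mollified_diff_hoelder t0 t1 cg gM).
Qed.

End approximation.

Section hoelder_interpolation.
Context {R : realType}.
Local Notation mu := (@lebesgue_measure R).
Variables (f g : R -> R) (M Mg K q C eta v : R).
Hypotheses (cf : continuous f) (fM : forall x, `|f x| <= M).
Hypotheses (cg : continuous g) (gM : forall x, `|g x| <= Mg).
Hypotheses (K0 : 0 <= K) (q01 : 0 < q <= 1) (gK : hoelder_with K q g).
Hypotheses (C0 : 0 <= C) (eta01 : 0 < eta <= 1).

Let Z t := \int[mu]_(x in `[0, 1]) (f x * moll g t x).

Hypothesis Z_v : forall t, 0 <= t -> t < 1 -> `|Z t - v| <= C * (1 - t) `^ eta.

Let num t x := f x * (g (Num.min (x + (1 - t)) t) - g (Num.min x t)).

Let M0 : 0 <= M. Proof. exact: le_trans (fM 0). Qed.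
Let Mg0 : 0 <= Mg. Proof. exact: le_trans (gM 0). Qed.
Let q0 : 0 < q. Proof. by case/andP: q01. Qed.
Let eta0 : 0 < eta. Proof. by case/andP: eta01. Qed.

Let measurable_num t : measurable_fun setT (num t).
Proof.
have cm (h : R -> R) : continuous h -> continuous (fun y => g (Num.min (h y) t)).
  move=> ch y; apply: (@continuous_comp _ _ _ (fun y => Num.min (h y) t) g); last exact: cg.
  by apply: (@continuous_comp _ _ _ h (fun y => Num.min y t)); [exact: ch|exact: continuous_minr].
apply: continuous_measurable_fun => x; apply: cvgM; first exact: cf.
apply: cvgB; last by apply: (cm id) => y; exact: cvg_id.
by apply: (cm (fun x => x + (1 - t))) => y; apply: cvgD; [exact: cvg_id|exact: cvg_cst].
Qed.

Let num_bound t x : `|num t x| <= M * (Mg *+ 2).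
Proof.
by rewrite normrM ler_pM// (le_trans (ler_normB _ _))// mulr2n lerD.
Qed.

Let integrable_num t : mu.-integrable `[0, 1] (EFin \o num t).
Proof. by apply: (integrable_bounded_itv (measurable_num t)) => u _; exact: num_bound. Qed.

Let N t := \int[mu]_(x in `[0, 1]) num t x.

Let bound01 (phi : R -> R) (D : R) : measurable_fun setT phi ->
  (forall y, 0 <= y <= 1 -> `|phi y| <= D) -> `|\int[mu]_(y in `[0, 1]) phi y| <= D.
Proof.
move=> mphi phiD; have ip : mu.-integrable `[0, 1] (EFin \o phi).
  exact: (integrable_bounded_itv mphi phiD).
rewrite (le_trans (le_normr_Rintegral _ ip))//.
apply: (@le_trans _ _ (\int[mu]_(z in `[0, 1]) D)).
  apply: le_Rintegral => //.
  - by have /integrable_abse := ip.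
  - by apply: (@integrable_bounded_itv _ _ `|D|).
by rewrite Rintegral_cst//= lebesgue_measure_itv/= lte_fin ltr01/= subr0 mulr1.
Qed.

Let ZE t : Z t = N t / (1 - t).
Proof.
rewrite /Z /N -RintegralZr//; apply: eq_Rintegral => x _.
by rewrite /num /moll mulrA.
Qed.

Let N_bound t : `|N t| <= M * (Mg *+ 2).
Proof. by apply: bound01 => [|y _]; [exact: measurable_num|exact: num_bound]. Qed.

Let minB (x s t : R) : `|Num.min x t - Num.min x s| <= `|t - s|.
Proof. by rewrite !(minC x); exact: minr_lipschitz. Qed.

Let min_shiftB (x s t : R) :
  `|Num.min (x + (1 - t)) t - Num.min (x + (1 - s)) s| <= `|t - s|.
Proof.
by case: (leP (x + (1 - t)) t) => ?; case: (leP (x + (1 - s)) s) => ?;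
  rewrite ler_norml; have := ler_norm (t - s); have := ler_norm (s - t);
  rewrite distrC => ? ?; apply/andP; split; lra.
Qed.

Let min01 (x t : R) : 0 <= x -> 0 <= t <= 1 -> 0 <= Num.min x t <= 1.
Proof. by move=> x0 /andP[t0 t1]; rewrite le_min x0 t0/= ge_min t1 orbT. Qed.

Let N_hoelder s t : 0 <= s <= 1 -> 0 <= t <= 1 -> `|N t - N s| <= M * (K *+ 2) * `|t - s| `^ q.
Proof.
move=> s01 t01; rewrite /N -RintegralB//; apply: bound01.
  exact: measurable_funB.
move=> x /andP[x0 x1]; rewrite /num -mulrBr normrM -mulrA ler_pM//.
set a := g _; set b := g _; set c := g _; set d := g _.
rewrite (_ : a - b - (c - d) = (a - c) - (b - d)); last by ring.
rewrite (le_trans (ler_normB _ _))// mulr2n mulrDl lerD//.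
  rewrite /a /c (le_trans (gK _ _))// ?min01//; last 2 first.
  - by rewrite addr_ge0// subr_ge0; case/andP: s01.
  - rewrite ler_wpM2l//; apply: ge0_ler_powR; rewrite ?nnegrE ?(ltW q0)//.
  by rewrite addr_ge0// subr_ge0; case/andP: t01.
rewrite /b /d (le_trans (gK _ _))// ?min01// ler_wpM2l//.
by apply: ge0_ler_powR; rewrite ?nnegrE ?(ltW q0).
Qed.

Let D : R := M * (K *+ 2) + M * (Mg *+ 2).

Let D0 : 0 <= D. Proof. by rewrite addr_ge0// mulr_ge0// mulrn_wge0. Qed.

Let Z_local s t : 0 <= s -> s < t -> t < 1 ->
  `|Z t - Z s| <= D * (t - s) `^ q / (1 - t) ^+ 2.
Proof.
move=> s0 st t1; have ts : 0 < t - s by rewrite subr_gt0.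
have t1' : 0 < 1 - t by rewrite subr_gt0.
have s1' : 0 < 1 - s by rewrite subr_gt0 (lt_trans st).
have t1'' : 1 - t <= 1 by rewrite gerBl (le_trans s0)// ltW.
have ts1 : t - s <= 1 by lra.
rewrite !ZE; have -> : N t / (1 - t) - N s / (1 - s) =
    (N t - N s) / (1 - t) + N s * ((t - s) / ((1 - t) * (1 - s))).
  by field; rewrite !gt_eqF.
have inv2 : (1 - t)^-1 <= ((1 - t) ^+ 2)^-1.
  by rewrite lef_pV2 ?posrE ?exprn_gt0// expr2 ler_piMl// ltW.
rewrite (le_trans (ler_normD _ _))// /D -!mulrA (mulrDl (M * _)) lerD//; last first.
  rewrite normrM ler_pM// gtr0_norm ?divr_gt0 ?mulr_gt0//.
  apply: ler_pM; rewrite ?(ltW ts) ?invr_ge0 ?mulr_ge0 ?(ltW t1') ?(ltW s1')//.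
    rewrite -[leLHS]powRr1 ?(ltW ts)// ger_powR ?ts ?ts1//.
    by case/andP: q01.
  rewrite lef_pV2 ?posrE ?exprn_gt0 ?mulr_gt0// expr2 ler_pM2l//.
  by rewrite lerD2l lerN2 ltW.
rewrite normrM normfV (gtr0_norm t1') !mulrA; apply: ler_pM; rewrite ?invr_ge0 ?(ltW t1')//.
have := @N_hoelder s t; rewrite (gtr0_norm ts); apply.
  by rewrite s0 (le_trans (ltW st))// ltW.
by rewrite (le_trans s0) ?(ltW st) ?(ltW t1).
Qed.

Let th : R := eta * (q / 4).

(* For increments [t - s] small against the distance [1 - t] to the end point, use
   the regularity of [(1 - t) Z t]; otherwise compare both values with [v]. *)
Lemma hoelder_interpolation : hoelder01 th (fun t => if t == 1 then v else Z t).
Proof.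
have th0 : 0 < th by rewrite mulr_gt0// divr_gt0.
have th_eta : th <= eta by rewrite ler_piMr ?(ltW eta0)//; move: q01 => /andP[? ?]; lra.
have le_th (x p : R) : 0 <= x <= 1 -> th <= p -> x `^ p <= x `^ th.
  move=> /andP[]; rewrite le_eqVlt => /predU1P[<-|x0] x1 thp.
    by rewrite !powR0// gt_eqF// (lt_le_trans th0).
  by rewrite ger_powR// x0.
exists (D + C *+ 3).
have C3 : 0 <= C *+ 3 by rewrite mulrn_wge0.
suff H s t : 0 <= s -> s < t -> t <= 1 ->
    `|(if t == 1 then v else Z t) - (if s == 1 then v else Z s)| <=
    (D + C *+ 3) * (t - s) `^ th.
  move=> s t /andP[s0 s1] /andP[t0 t1]; have [st|ts|->] := ltgtP s t.
  - by rewrite (gtr0_norm (_ : 0 < t - s)) ?subr_gt0//; exact: H.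
  - rewrite distrC [X in _ * X `^ _]distrC (gtr0_norm (_ : 0 < s - t)) ?subr_gt0//.
    exact: H.
  - by rewrite !subrr normr0 mulr_ge0 ?powR_ge0// addr_ge0.
move=> s0 st t1; have s1 : s < 1 by exact: lt_le_trans t1.
have ts : 0 < t - s by rewrite subr_gt0.
have ts1 : 0 <= t - s <= 1 by apply/andP; split; lra.
rewrite (lt_eqF s1).
have [t1E|t1n] := eqVneq t 1.
  rewrite distrC (le_trans (Z_v s0 s1))// -t1E.
  apply: ler_pM; rewrite ?powR_ge0//; last exact: le_th.
  by rewrite ler_wpDl// -[leLHS]mulr1n ler_wpMn2l.
have {t1n}t1 : t < 1 by rewrite lt_neqAle t1n.
have t1' : 0 < 1 - t by rewrite subr_gt0.
rewrite mulrDl; have [far|near] := leP (1 - t) ((t - s) `^ (q / 4)).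
  rewrite ler_wpDl ?mulr_ge0 ?powR_ge0//.
  have t0 : 0 <= t by rewrite (le_trans s0)// ltW.
  have -> : Z t - Z s = (Z t - v) - (Z s - v) by ring.
  rewrite (le_trans (ler_normB _ _))//.
  have -> : C *+ 3 * (t - s) `^ th = C * (t - s) `^ th + C * (2 * (t - s) `^ th) by ring.
  have powE : (t - s) `^ th = ((t - s) `^ (q / 4)) `^ eta by rewrite -powRrM mulrC.
  rewrite lerD//.
    rewrite (le_trans (Z_v t0 t1))// ler_wpM2l// powE.
    by apply: ge0_ler_powR; rewrite ?nnegrE ?(ltW eta0) ?powR_ge0 ?(ltW t1').
  rewrite (le_trans (Z_v s0 s1))// ler_wpM2l// powE.
  apply: (@le_trans _ _ ((2 * (t - s) `^ (q / 4)) `^ eta)).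
    apply: ge0_ler_powR; rewrite ?nnegrE ?(ltW eta0) ?mulr_ge0 ?powR_ge0//.
      by rewrite subr_ge0 ltW.
    have -> : 1 - s = (1 - t) + (t - s) by ring.
    rewrite mulr_natl mulr2n lerD// -[leLHS]powRr1 ?(ltW ts)// ger_powR.
    - by [].
    - by rewrite ts; case/andP: ts1.
    - by case/andP: q01 => ? ?; lra.
  rewrite powRM ?powR_ge0// ler_wpM2r ?powR_ge0//.
  rewrite -[leRHS]powRr1//; apply: ler_powR; first by rewrite ler1n.
  by case/andP: eta01.
rewrite ler_wpDr ?mulr_ge0 ?powR_ge0//.
rewrite (le_trans (Z_local s0 st t1))// -mulrA ler_wpM2l//.
apply: (@le_trans _ _ ((t - s) `^ (q / 2))); last first.
  apply: le_th => //; rewrite /th; case/andP: eta01 => e0 e1; rewrite (@le_trans _ _ (1 * (q / 4)))//.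
    by rewrite ler_wpM2r// divr_ge0// ltW.
  by rewrite mul1r; move: q0; lra.
rewrite ler_pdivrMr ?exprn_gt0//.
have -> : (t - s) `^ q = (t - s) `^ (q / 2) * ((t - s) `^ (q / 4)) ^+ 2.
  rewrite -powR_mulrn ?powR_ge0// -powRrM -powRD ?(gt_eqF ts) ?implybT//.
  by congr (_ `^ _); field.
rewrite ler_wpM2l ?powR_ge0// lerXn2r ?nnegrE ?powR_ge0 ?(ltW t1') ?(ltW near)//.
Qed.

End hoelder_interpolation.

Section joint_measurability.
Context {R : realType} {d : measure_display} {T : measurableType d}.

Lemma cvg_floor_scaled (x : R) :
  (Num.floor (n.+1%:R * x))%:~R / n.+1%:R @[n --> \oo] --> x.
Proof.
apply: (@squeeze_cvgr _ _ _ _ (fun n => x - n.+1%:R^-1) (fun=> x)).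
- near=> n; have n0 : (0 : R) < n.+1%:R by [].
  have /andP[le_fl lt_fl] := floor_itv (n.+1%:R * x).
  rewrite ler_pdivrMr// (mulrC x) le_fl andbT.
  by rewrite ler_pdivlMr// mulrBl mulVf ?gt_eqF// lerBlDr (mulrC x) ltW// -[X in _ + X]/(1%:~R) -intrD.
- rewrite -[X in _ --> X]subr0; apply: cvgB; first exact: cvg_cst.
  exact: cvg_harmonic.
- exact: cvg_cst.
Unshelve. all: by end_near. Qed.

Lemma measurable_fun_joint (Y : R -> T -> R) :
  (forall x, measurable_fun setT (Y x)) -> (forall w, continuous (Y ^~ w)) ->
  measurable_fun setT (fun z : T * R => Y z.2 z.1).
Proof.
move=> mY cY.
pose h n (z : T * R) := Y ((Num.floor (n.+1%:R * z.2))%:~R / n.+1%:R) z.1.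
apply: (@measurable_fun_cvg _ _ _ _ h); last first.
  move=> [w x] _; exact: cvg_comp (@cvg_floor_scaled x) (cY w x).
move=> n _ A mA; rewrite setTI.
have -> : h n @^-1` A = \bigcup_(k : int)
    ((Y (k%:~R / n.+1%:R) @^-1` A) `*` `[k%:~R / n.+1%:R, (k + 1)%:~R / n.+1%:R[%classic).
  apply/seteqP; split=> [[w x] Ahx|[w x] [k _ [/= AY]]].
    exists (Num.floor (n.+1%:R * x)) => //; split => //=.
    rewrite in_itv/= ler_pdivrMr// ltr_pdivlMr// (mulrC x).
    exact: floor_itv.
  rewrite /h/= in_itv/= ler_pdivrMr// ltr_pdivlMr// (mulrC x) => /floor_def ->.
  exact: AY.
apply: countable_bigcupT_measurable => [|k]; first exact: countableP.
by apply: measurableX => //; rewrite -[X in measurable X]setTI; exact: mY.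
Qed.

(* [moll] vanishes from [t] on, so [X] and [Y] may be stopped at [t]. *)
Lemma measurable_moll_integral (X Y : R -> T -> R) (t : R) : 0 <= t -> t < 1 ->
  (forall x, 0 <= x <= t -> measurable_fun setT (X x)) ->
  (forall x, 0 <= x <= t -> measurable_fun setT (Y x)) ->
  (forall w, continuous (X ^~ w)) -> (forall w, continuous (Y ^~ w)) ->
  measurable_fun setT
    (fun w => \int[lebesgue_measure]_(x in `[0, 1]) (X x w * moll (Y ^~ w) t x)).
Proof.
move=> t0 t1 mX mY cX cY; pose cl x := Num.max 0 (Num.min x t).
have cl0t x : 0 <= cl x <= t by rewrite le_max lexx ge_max t0 ge_min lexx orbT.
have clE x : 0 <= x -> cl x = Num.min x t.
  by move=> x0; apply/max_idPr; rewrite le_min x0.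
have ccl : continuous cl.
  have -> : cl = (fun x => - Num.min (- Num.min x t) 0).
    by apply/funext => x; rewrite /cl maxC -{1}[Num.min x t]opprK -{1}oppr0 -oppr_min.
  move=> x; apply: cvgN.
  apply: (@continuous_comp _ _ _ (fun x => - Num.min x t) (fun y => Num.min y 0)).
    by apply: cvgN; exact: continuous_minr.
  exact: continuous_minr.
have mcl (V : R -> T -> R) : (forall x, 0 <= x <= t -> measurable_fun setT (V x)) ->
    (forall w, continuous (V ^~ w)) ->
    measurable_fun setT (fun z : T * R => V (cl z.2) z.1).
  move=> mV cV; apply: (measurable_fun_joint (Y := V \o cl)) => [x|w x].
    exact: mV.
  by apply: (@continuous_comp _ _ _ cl (V ^~ w)); [exact: ccl|exact: cV].
have mYshift : measurable_fun setT (fun z : T * R => Y (cl (z.2 + (1 - t))) z.1).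
  apply: (@measurableT_comp _ _ _ _ _ _ (fun z : T * R => Y (cl z.2) z.1) _
    (fun z : T * R => (z.1, z.2 + (1 - t)))); first exact: mcl.
  apply: measurable_fun_pair; first exact: measurable_fst.
  by apply: measurable_funD; [exact: measurable_snd|exact: measurable_cst].
have m1 : measurable_fun setT (fun z : T * R =>
    X (cl z.2) z.1 * ((Y (cl (z.2 + (1 - t))) z.1 - Y (cl z.2) z.1) / (1 - t))).
  apply: measurable_funM; first exact: mcl.
  apply: measurable_funM; last exact: measurable_cst.
  by apply: measurable_funB; [exact: mYshift|exact: mcl].
rewrite (_ : (fun w => _) = (fun w => \int[lebesgue_measure]_(x in `[0, 1])
    (X (cl x) w * ((Y (cl (x + (1 - t))) w - Y (cl x) w) / (1 - t))))).
  have := @measurable_Rintegral_itv _ _ _ (fun=> 0) (fun=> 1) _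
    (@measurable_cst _ _ _ _ setT (0 : R)) (@measurable_cst _ _ _ _ setT (1 : R)) m1.
  exact.
apply/funext => w; apply: eq_Rintegral => x; rewrite inE/= => /andP[x0 x1].
have e0 : 0 < 1 - t by rewrite subr_gt0.
have xe0 : 0 <= x + (1 - t) by rewrite addr_ge0// ltW.
rewrite /moll (clE x x0) (clE _ xe0).
have [xt|tx] := leP x t => //.
have -> : Num.min (x + (1 - t)) t = t by apply/min_idPr; lra.
by rewrite subrr mul0r !mulr0.
Qed.

End joint_measurability.

(** * Hoelder regularity of fractional Brownian paths *)

Section normal_tail.
Context {R : realType}.
Variables (m s tau : R).
Hypotheses (s0 : 0 < s) (tau0 : 0 < tau).
Hypothesis central : ((3 / 4)%:E <= normal_prob m s `[(- (2 * tau))%R, (2 * tau)%R])%E.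

Let sn0 : s != 0. Proof. by rewrite gt_eqF. Qed.

Let normal_peak_le : normal_peak s <= (2 * s)^-1.
Proof.
rewrite lef_pV2 ?posrE ?mulr_gt0 ?sqrtr_gt0 ?mulrn_wgt0 ?mulr_gt0 ?exprn_gt0 ?pi_gt0//.
rewrite -(ler_pXn2r (n := 2)) ?nnegrE ?sqrtr_ge0 ?mulr_ge0 ?(ltW s0)//.
rewrite sqr_sqrtr ?mulrn_wge0 ?mulr_ge0 ?sqr_ge0 ?pi_ge0//.
have := @pi_ge2 R; have : 0 < s ^+ 2 by rewrite exprn_gt0.
by rewrite exprMn mulr2n; nra.
all: exact: ltW.
Qed.

Let central_le (b : R) : 0 <= b -> (forall x, `|x| <= 2 * tau -> normal_fun m s x <= b) ->
  3 / 4 <= 2 * (tau / s) * b.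
Proof.
move=> b0 fb.
have : (normal_prob m s `[(- (2 * tau))%R, (2 * tau)%R] <=
        ((2 * s)^-1 * b * (4 * tau))%:E)%E.
  apply: (@le_trans _ _
    (\int[lebesgue_measure]_(x in `[(- (2 * tau))%R, (2 * tau)%R]) ((2 * s)^-1 * b)%:E)%E).
    apply: ge0_le_integral => //.
    - by move=> x _; rewrite lee_fin normal_pdf_ge0.
    - by apply/measurable_EFinP; apply: measurable_funTS; exact: measurable_normal_pdf.
    - move=> x /=; rewrite in_itv/= => xtau; rewrite lee_fin normal_pdfE//.
      rewrite ler_pM ?normal_peak_ge0 ?normal_fun_ge0//; apply: fb.
      by rewrite ler_norml.
  have tt : - (2 * tau) < 2 * tau by move: tau0; lra.
  rewrite integral_cst//= lebesgue_measure_itv/= lte_fin tt.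
  by rewrite -EFinD -EFinM lee_fin ler_wpM2l ?mulr_ge0 ?invr_ge0 ?mulr_ge0// ?(ltW s0)//; lra.
move=> /(le_trans central); rewrite lee_fin => /le_trans; apply.
by rewrite le_eqVlt; apply/orP; left; apply/eqP; field.
Qed.

Let s_le : s <= 3 * tau.
Proof.
have := @central_le 1 ler01; rewrite mulr1 => H.
have {H} : 3 / 4 <= 2 * (tau / s).
  apply: H => x _; rewrite /normal_fun -[leRHS]expR0 ler_expR mulNr oppr_le0.
  by rewrite divr_ge0 ?mulrn_wge0 ?sqr_ge0.
by rewrite mulrA ler_pdivlMr// => ?; move: tau0; lra.
Qed.

Let m_le : `|m| <= 4 * tau.
Proof.
rewrite leNgt; apply/negP => tau_m.
pose u := tau / s.
have u0 : 0 < u by rewrite divr_gt0.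
have e0 : 0 < 1 + 2 * u ^+ 2 by rewrite ltr_pwDl// mulr_ge0// sqr_ge0.
have : 3 / 4 <= 2 * u * (1 + 2 * u ^+ 2)^-1.
  apply: central_le; first by rewrite invr_ge0 ltW.
  move=> x xtau; rewrite /normal_fun mulNr expRN lef_pV2 ?posrE ?expR_gt0//.
  apply: le_trans (expR_ge1Dx _); rewrite lerD2l.
  have -> : (x - m) ^+ 2 / (s ^+ 2 *+ 2) = (x - m) ^+ 2 / s ^+ 2 / 2 by field.
  rewrite ler_pdivlMr// /u exprMn exprVn.
  have -> : 2 * (tau ^+ 2 / s ^+ 2) * 2 = (2 * tau) ^+ 2 / s ^+ 2 by ring.
  rewrite ler_wpM2r ?invr_ge0 ?sqr_ge0// -[leRHS]real_normK ?num_real//.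
  rewrite lerXn2r ?nnegrE ?normr_ge0 ?mulr_ge0 ?(ltW tau0)//.
  by have := ler_normB m (m - x); have := ler_dist_dist m x; rewrite [`|m - x|]distrC !ler_norml => /andP[? ?] ?; lra.
by have := sqr_ge0 (u - 2 / 3); rewrite ler_pdivlMr// sqrrB; lra.
Qed.

(* Mean and standard deviation are of order [tau] (otherwise the mass near [0] would
   be too small), so that on the tail the density is dominated by that of the
   centered law of standard deviation [3 * s], times a Gaussian factor. *)
Lemma normal_tail (lam : R) : 8 * tau <= lam ->
  (normal_prob m s [set x | (lam < `|x|)%R] <=
   (3 * expR (- (lam / (12 * tau)) ^+ 2))%:E)%E.
Proof.
move=> tau_lam; have lam0 : 0 < lam by apply: lt_le_trans tau_lam; rewrite mulr_gt0.
set b := 3 * _.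
have b0 : 0 <= b by rewrite mulr_ge0// expR_ge0.
have s3 : 3 * s != 0 by rewrite mulf_neq0.
have mlam : measurable [set x : R | lam < `|x|].
  by rewrite -[X in measurable X]setTI; apply: measurable_fun_ltr => //; exact: measurableT_comp.
apply: (@le_trans _ _ (\int[lebesgue_measure]_(x in [set x | (lam < `|x|)%R])
    (b * normal_pdf 0 (3 * s) x)%:E)%E).
  apply: ge0_le_integral => //.
  - by move=> x _; rewrite lee_fin normal_pdf_ge0.
  - by apply/measurable_EFinP; apply: measurable_funTS; exact: measurable_normal_pdf.
  - by apply/measurable_EFinP; apply: measurable_funTS; apply: measurable_funM => //; exact: measurable_normal_pdf.
  move=> x /= lamx; rewrite lee_fin !normal_pdfE//.
  have -> : normal_peak (3 * s) = normal_peak s / 3.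
    rewrite /normal_peak (_ : (3 * s) ^+ 2 * pi *+ 2 = 3 ^+ 2 * (s ^+ 2 * pi *+ 2)); last by ring.
    rewrite sqrtrM ?sqr_ge0// sqrtr_sqr ger0_norm//.
    by rewrite invfM mulrC.
  rewrite /b (_ : _ * (_ / _ * _) = normal_peak s * (expR (- (lam / (12 * tau)) ^+ 2) * normal_fun 0 (3 * s) x)); last by field.
  rewrite ler_wpM2l ?normal_peak_ge0// /normal_fun -expRD ler_expR subr0 !mulNr -opprD lerN2.
  have s2 : 0 < s ^+ 2 by rewrite exprn_gt0.
  rewrite ler_pdivlMr ?mulrn_wgt0// mulrDl.
  have xm : x ^+ 2 / 4 <= (x - m) ^+ 2.
    have -> : x ^+ 2 / 4 = (`|x| / 2) ^+ 2 by rewrite exprMn real_normK ?num_real//; field.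
    rewrite -[leRHS]real_normK ?num_real// lerXn2r ?nnegrE ?normr_ge0 ?divr_ge0//.
    by move: lamx m_le tau_lam; have := lerB_dist x m; lra.
  apply: le_trans xm.
  have -> : x ^+ 2 / 4 = x ^+ 2 / 8 + x ^+ 2 / 8 by field.
  rewrite lerD//.
    have lt : lam / (12 * tau) * s <= lam / 4.
      rewrite mulrAC ler_pdivrMr ?mulr_gt0// -mulrA ler_wpM2l ?(ltW lam0)//.
      by move: s_le; lra.
    have -> : (lam / (12 * tau)) ^+ 2 * (s ^+ 2 *+ 2) = (lam / (12 * tau) * s) ^+ 2 *+ 2 by ring.
    have -> : x ^+ 2 / 8 = (`|x| / 4) ^+ 2 *+ 2 by rewrite exprMn real_normK ?num_real//; field.
    rewrite lerMn2r/= lerXn2r ?nnegrE ?divr_ge0 ?mulr_ge0 ?normr_ge0 ?(ltW lam0) ?(ltW s0)//.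
      by rewrite invr_ge0 mulr_ge0// ltW.
    by rewrite (le_trans lt)// ler_wpM2r// ltW.
  have -> : x ^+ 2 / ((3 * s) ^+ 2 *+ 2) * (s ^+ 2 *+ 2) = x ^+ 2 / 9 by field.
  by rewrite ler_wpM2l ?sqr_ge0// lef_pV2 ?posrE// ler_nat.
under eq_integral do rewrite EFinM.
rewrite ge0_integralZl//; last first.
- by move=> x _; rewrite lee_fin normal_pdf_ge0.
- by apply/measurable_EFinP; apply: measurable_funTS; exact: measurable_normal_pdf.
rewrite -[leRHS]mule1 lee_wpmul2l ?lee_fin//.
exact: (@probability_le1 _ _ _ (normal_prob 0 (3 * s))).
Qed.

End normal_tail.

Section gaussian_tail.
Context {R : realType} {d : measure_display} {T : measurableType d}.
Variables (P : probability T R) (Y : T -> R) (tau : R).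
Hypotheses (tau0 : 0 < tau) (mY : measurable_fun setT Y) (gY : gaussian_rv P Y).
Hypothesis var : (\int[P]_w (Y w ^+ 2)%:E = (tau ^+ 2)%:E)%E.

Let central : ((3 / 4)%:E <= P (Y @^-1` `[(- (2 * tau))%R, (2 * tau)%R]))%E.
Proof.
set A := Y @^-1` _.
have mA : measurable A by rewrite -[X in measurable X]setTI; exact: mY.
have t2 : 0 < 2 * tau by rewrite mulr_gt0.
have : ((4 * tau ^+ 2)%:E * P (~` A) <= (tau ^+ 2)%:E)%E.
  rewrite -var -integral_cst//; last exact: measurableC.
  apply: (@le_trans _ _ (\int[P]_(w in ~` A) (Y w ^+ 2)%:E)%E).
    apply: ge0_le_integral => //.
    - exact: measurableC.
    - by move=> w _; rewrite lee_fin mulr_ge0// sqr_ge0.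
    - by apply/measurable_EFinP; apply: measurable_funTS; exact: measurable_funX.
    move=> w; rewrite /A/= in_itv/= -ler_norml => /negP; rewrite -ltNge => tY.
    rewrite lee_fin -[leRHS]real_normK ?num_real//.
    have -> : 4 * tau ^+ 2 = (2 * tau) ^+ 2 by ring.
    by rewrite lerXn2r ?nnegrE ?normr_ge0// ltW.
  apply: ge0_subset_integral => //; first exact: measurableC.
    by apply/measurable_EFinP; exact: measurable_funX.
  by move=> w _; rewrite lee_fin sqr_ge0.
rewrite probability_setC// -(fineK (fin_num_measure P _ mA)) -EFinB -EFinM !lee_fin.
by have := exprn_gt0 2 tau0; nra.
Qed.

Lemma gaussian_rv_exp_tail (lam : R) : 8 * tau <= lam ->
  (P [set w | (lam < `|Y w|)%R] <= (3 * expR (- (lam / (12 * tau)) ^+ 2))%:E)%E.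
Proof.
move=> tau_lam; case: gY => m [s [s0 law]].
have mlam : measurable [set x : R | lam < `|x|].
  by rewrite -[X in measurable X]setTI; apply: measurable_fun_ltr => //; exact: measurableT_comp.
have -> : [set w | lam < `|Y w|] = Y @^-1` [set x : R | lam < `|x|] by [].
move: central; rewrite law// law// /gaussian_prob; case: eqP => [_|/eqP sn0 c34].
  rewrite !diracE; case: (boolP (m \in [set` _])) => [|_]; last first.
    by rewrite lee_fin leNgt divr_gt0.
  rewrite inE/= in_itv/= -ler_norml => mtau _.
  case: (boolP (m \in _)) => [|_]; first (rewrite inE/= => lm).
    by exfalso; have : lam < 2 * tau := lt_le_trans lm mtau; move: tau_lam tau0; lra.
  by rewrite lee_fin mulr_ge0// expR_ge0.
by apply: normal_tail => //; rewrite lt_neqAle eq_sym sn0.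
Qed.

Lemma gaussian_rv_tail (n : nat) (lam : R) : 0 < lam ->
  (P [set w | (lam < `|Y w|)%R] <=
   (3 * n.+1`!%:R * (12 * tau / lam) ^+ (2 * n.+1))%:E)%E.
Proof.
move=> lam0; have fact1 : 1 <= n.+1`!%:R :> R by rewrite ler1n fact_gt0.
have [tau_lam|lam_tau] := leP (8 * tau) lam.
  apply: (le_trans (gaussian_rv_exp_tail tau_lam)); rewrite lee_fin -mulrA ler_wpM2l//.
  set y := (lam / (12 * tau)) ^+ 2.
  have y0 : 0 < y by rewrite exprn_gt0// divr_gt0// mulr_gt0.
  have -> : (12 * tau / lam) ^+ (2 * n.+1) = (y ^+ n.+1)^-1.
    by rewrite exprM -exprVn -exprVn invf_div.
  rewrite expRN -[leRHS]invf_div lef_pV2 ?posrE ?expR_gt0//; last first.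
    by apply: divr_gt0; [exact: exprn_gt0|exact: lt_le_trans fact1].
  by apply: le_trans (expR_ge1Dxn n (ltW y0)); rewrite lerDr.
have mlam : measurable [set w | lam < `|Y w|].
  rewrite -[X in measurable X]setTI; apply: measurable_fun_ltr => //.
  exact: measurableT_comp.
apply: (le_trans (probability_le1 P mlam)); rewrite lee_fin.
rewrite -[leLHS]mulr1; apply: ler_pM => //; first by rewrite -[leLHS]mulr1 ler_pM// ler1n.
by apply: exprn_ege1; rewrite ler_pdivlMr// mul1r; lra.
Qed.

End gaussian_tail.

Section fBm_increments.
Context {R : realType} {d : measure_display} {T : measurableType d}.
Variables (P : probability T R) (F : R -> set (set T)) (H : R) (B : R -> T -> R).
Hypotheses (filtF : is_filtration F) (BfBm : fBm P H F B).

Lemma fBm_measurable t : 0 <= t <= 1 -> measurable_fun setT (B t).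
Proof.
move=> t01 _ A mA; rewrite setTI.
have [_ Fm _] := filtF; have [adB _ _ _ _] := BfBm.
by apply: (Fm t t01); exact: adB.
Qed.

Let integral_prod s t : 0 <= s <= 1 -> 0 <= t <= 1 ->
  (\int[P]_w (B t w * B s w)%:E)%E =
  (2^-1 * (s `^ (2 * H) + t `^ (2 * H) - `|s - t| `^ (2 * H)))%:E.
Proof.
move=> s01 t01; have [_ _ _ + _] := BfBm.
by move=> /(_ s t s01 t01) <-; rewrite unlock.
Qed.

Let integrable_sqr t : 0 <= t <= 1 -> P.-integrable setT (fun w => (B t w * B t w)%:E).
Proof.
move=> t01; apply/integrableP; split.
  by apply/measurable_EFinP; apply: measurable_funM; exact: fBm_measurable.
under eq_integral do rewrite gee0_abs ?lee_fin -?expr2 ?sqr_ge0//.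
by rewrite integral_prod// ltry.
Qed.

Let integrable_prod s t : 0 <= s <= 1 -> 0 <= t <= 1 ->
  P.-integrable setT (fun w => (B t w * B s w)%:E).
Proof.
move=> s01 t01; have := integrableD measurableT (integrable_sqr s01) (integrable_sqr t01).
apply: le_integrable => //.
  by apply/measurable_EFinP; apply: measurable_funM; exact: fBm_measurable.
move=> w _; rewrite -EFinD !abse_EFin lee_fin -!expr2 [leRHS]ger0_norm ?addr_ge0 ?sqr_ge0//.
rewrite ler_norml; have := sqr_ge0 (B s w + B t w); have := sqr_ge0 (B s w - B t w).
have := sqr_ge0 (B s w); have := sqr_ge0 (B t w).
by rewrite sqrrB sqrrD !expr2 => *; apply/andP; split; lra.
Qed.

Lemma fBm_increment_measurable s t : 0 <= s <= 1 -> 0 <= t <= 1 ->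
  measurable_fun setT (fun w => B t w - B s w).
Proof. by move=> s01 t01; apply: measurable_funB; exact: fBm_measurable. Qed.

Lemma fBm_increment_gaussian s t : 0 <= s <= 1 -> 0 <= t <= 1 ->
  gaussian_rv P (fun w => B t w - B s w).
Proof.
move=> s01 t01; have [_ gB _ _ _] := BfBm.
pose tt (i : 'I_2) := if i == ord0 then t else s.
pose c (i : 'I_2) : R := if i == ord0 then 1 else -1.
have := gB 2 tt c; rewrite /tt /c => /(_ _)/wrap[i|]; first by case: ifP.
by under eq_fun do rewrite big_ord_recl big_ord1/= mul1r mulN1r.
Qed.

Lemma fBm_increment_variance s t : 0 < H -> 0 <= s <= 1 -> 0 <= t <= 1 ->
  (\int[P]_w ((B t w - B s w) ^+ 2)%:E = (`|t - s| `^ (2 * H))%:E)%E.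
Proof.
move=> H0 s01 t01.
under eq_integral => w _.
  rewrite (_ : ((B t w - B s w) ^+ 2)%:E =
    ((B t w * B t w)%:E + (B s w * B s w)%:E + (- 2)%:E * (B t w * B s w)%:E)%E).
    over.
  by rewrite -EFinM -!EFinD; congr EFin; ring.
rewrite integralD//; last 2 first.
- by apply: integrableD => //; exact: integrable_sqr.
- by apply: integrableZl => //; exact: integrable_prod.
rewrite integralD//; [|exact: integrable_sqr..].
rewrite integralZl//; last exact: integrable_prod.
rewrite !integral_prod// -EFinM -!EFinD !subrr normr0 powR0 ?mulf_neq0 ?gt_eqF//.
by rewrite distrC; congr EFin; field.
Qed.

End fBm_increments.

Section fBm_dyadic.
Context {R : realType} {d : measure_display} {T : measurableType d}.
Variables (P : probability T R) (F : R -> set (set T)) (H : R) (B : R -> T -> R).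
Hypotheses (filtF : is_filtration F) (BfBm : fBm P H F B).
Variable gam : R.
Hypotheses (gam0 : 0 < gam) (gamH : gam < H).

Let h n : R := 2 ^- n.
Let r : R := 2^-1 `^ gam.
Let rH : R := 2^-1 `^ H.

Let pow_h a n : h n `^ a = (2^-1 `^ a) ^+ n.
Proof.
rewrite -[RHS]powR_mulrn ?powR_ge0// -powRrM mulrC powRrM powR_mulrn ?invr_ge0//.
by rewrite exprVn.
Qed.

Let A n k := [set w | r ^+ n < `|B (k.+1%:R * h n) w - B (k%:R * h n) w|].

Let h0 n : 0 < h n. Proof. by rewrite invr_gt0 exprn_gt0. Qed.

Let dyadic01 n k : (k <= 2 ^ n)%N -> 0 <= k%:R * h n <= 1.
Proof.
move=> kn; rewrite mulr_ge0 ?(ltW (h0 _))//= ler_pdivrMr ?exprn_gt0// mul1r.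
by rewrite -natrX ler_nat.
Qed.

Let measurable_A n k : (k < 2 ^ n)%N -> measurable (A n k).
Proof.
move=> kn; rewrite -[X in measurable X]setTI; apply: measurable_fun_ltr => //.
apply: measurableT_comp => //.
by apply: (fBm_increment_measurable filtF BfBm); apply: dyadic01 => //; exact: ltnW.
Qed.

Let prob_A m n k : (k < 2 ^ n)%N ->
  (P (A n k) <= (3 * m.+1`!%:R * (12 * (rH / r) ^+ n) ^+ (2 * m.+1))%:E)%E.
Proof.
move=> kn; have H0 : 0 < H by exact: lt_trans gamH.
have s01 : 0 <= k%:R * h n <= 1 by apply: dyadic01; exact: ltnW.
have t01 : 0 <= k.+1%:R * h n <= 1 by exact: dyadic01.
have := @gaussian_rv_tail _ _ _ P _ (rH ^+ n) _
  (fBm_increment_measurable filtF BfBm s01 t01)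
  (fBm_increment_gaussian BfBm s01 t01) _ m (r ^+ n).
rewrite (_ : 12 * (rH / r) ^+ n = 12 * rH ^+ n / r ^+ n); last first.
  by rewrite expr_div_n mulrA.
apply.
- by rewrite exprn_gt0// powR_gt0.
- rewrite (fBm_increment_variance filtF BfBm H0 s01 t01); congr EFin.
  rewrite -mulrBl -natrB// subSnn mul1r gtr0_norm// pow_h.
  by rewrite (mulrC 2) powRrM powR_mulrn ?powR_ge0// -!exprM mulnC.
- by rewrite exprn_gt0// powR_gt0.
Qed.

Lemma fBm_dyadic_increments : {ae P, forall w, exists n0, forall n k,
  (n0 <= n)%N -> (k < 2 ^ n)%N ->
  `|B (k.+1%:R * 2 ^- n) w - B (k%:R * 2 ^- n) w| <= (2^-1 `^ gam) ^+ n}.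
Proof.
pose E n := \big[setU/set0]_(k < 2 ^ n) A n k.
have mE n : measurable (E n).
  by apply: bigsetU_measurable => k _; exact: measurable_A.
have [m rho] : exists m, (2 * (rH / r) ^+ (2 * m.+1) <= 2^-1)%R.
  have q1 : `|rH / r| < 1.
    rewrite gtr0_norm ?divr_gt0 ?powR_gt0// ltr_pdivrMr ?powR_gt0// mul1r.
    by rewrite /rH /r /powR gt_eqF// ltr_expR ltr_nM2r// ln_lt0// invr_gt0 ltr0n invf_lt1// ltr1n.
  have /cvgr_lt /(_ (4^-1)) : (rH / r) ^+ n @[n --> \oo] --> 0 by exact: cvg_expr.
  move=> /(_ _)[//|n0 _ Hn0]; exists n0; have := Hn0 (2 * n0.+1)%N.
  move=> /(_ _)/wrap[|]; first by rewrite /= mul2n -addnn addSn ltnW// ltnS leq_addr.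
  by move=> /ltW; lra.
pose C : R := 3 * m.+1`!%:R * 12 ^+ (2 * m.+1).
have C0 : 0 <= C by rewrite !mulr_ge0.
have PE n : (P (E n) <= (C / 2 ^+ n)%:E)%E.
  apply: (@le_trans _ _ (\sum_(k < 2 ^ n) (P (A n k)))%E).
    by apply: Boole_inequality => k; exact: measurable_A.
  apply: (@le_trans _ _
    (\sum_(k < 2 ^ n) (3 * m.+1`!%:R * (12 * (rH / r) ^+ n) ^+ (2 * m.+1))%:E)%E).
    by apply: lee_sum => k _; exact: prob_A.
  rewrite sumEFin lee_fin sumr_const card_ord -[leLHS]mulr_natl natrX.
  rewrite exprMn exprAC.
  rewrite mulrA (_ : 2 ^+ n * _ * _ = C * (2 * (rH / r) ^+ (2 * m.+1)) ^+ n); last first.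
    rewrite [in RHS]exprMn /C.
    by move: (2 ^+ n) (12 ^+ _) (((rH / r) ^+ _) ^+ n) (m.+1`!%:R) => u v w z; ring.
  rewrite ler_wpM2l// -exprVn lerXn2r ?nnegrE//.
  by rewrite mulr_ge0// exprn_ge0// divr_ge0// powR_ge0.
exists (lim_sup_set E); split.
- apply: bigcapT_measurable => n; apply: bigcup_measurable => k _; exact: mE.
- apply: lim_sup_set_cvg0 => //.
  apply: (@le_lt_trans _ _ (\sum_(0 <= i <oo) (2 * C / (2 ^ i.+1)%:R)%:E)%E).
    apply: lee_nneseries => // n _; apply: (le_trans (PE n)).
    by rewrite lee_fin natrX exprS invfM mulrACA divff// mul1r.
  apply: (@le_lt_trans _ _ (2 * C)%:E); last exact: ltry.
  by apply: epsilon_trick0; rewrite mulr_ge0.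
move=> w nw n _; apply: contrapT => nE; apply: nw; exists n => j k nj kj.
rewrite leNgt; apply/negP => Ajk; apply: nE; exists j => //.
by rewrite /E -bigcup_mkord; exists k.
Qed.

End fBm_dyadic.

Section dyadic_chaining.
Context {R : realType}.
Variables (g : R -> R) (gam M : R) (n0 : nat).
Hypotheses (cg : continuous g) (gM : forall x, `|g x| <= M) (gam0 : 0 < gam).

Let r : R := 2^-1 `^ gam.

Hypothesis increments : forall n k, (n0 <= n)%N -> (k < 2 ^ n)%N ->
  `|g (k.+1%:R * 2 ^- n) - g (k%:R * 2 ^- n)| <= r ^+ n.

Let r0 : 0 < r. Proof. by rewrite powR_gt0. Qed.

Let r1 : r < 1.
Proof. by rewrite /r /powR gt_eqF// expR_lt1 nmulr_llt0// ln_lt0// invr_gt0 ltr0n invf_lt1// ltr1n. Qed.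

Let a n (x : R) := Num.truncn (2 ^+ n * x).
Let D n (x : R) : R := (a n x)%:R * 2 ^- n.

Let e2 n : 0 < 2 ^+ n :> R. Proof. exact: exprn_gt0. Qed.

Let a_itv n x : 0 <= x -> (a n x)%:R <= 2 ^+ n * x < (a n x).+1%:R.
Proof. by move=> x0; apply: truncn_itv; rewrite mulr_ge0// ltW. Qed.

Let a_le n x : 0 <= x <= 1 -> (a n x <= 2 ^ n)%N.
Proof.
move=> /andP[x0 x1]; rewrite -(@ler_nat R) natrX.
by have /andP[+ _] := a_itv n x0 => /le_trans; apply; rewrite ler_piMr// ltW.
Qed.

Let step n x : 0 <= x <= 1 -> (n0 <= n.+1)%N -> `|g (D n.+1 x) - g (D n x)| <= r ^+ n.+1.
Proof.
move=> x01 n0n; have /andP[x0 x1] := x01.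
have /andP[lo hi] := a_itv n x0; have /andP[lo' hi'] := a_itv n.+1 x0.
have DE : D n x = (2 * a n x)%:R * 2 ^- n.+1.
  by rewrite /D natrM exprS invfM mulrACA divff// mul1r.
have : (2 * a n x <= a n.+1 x <= (2 * a n x).+1)%N.
  rewrite -ltnS -[X in (_ && X)]ltnS -!(@ltr_nat R); apply/andP; split.
    by apply: le_lt_trans hi'; rewrite natrM exprS -mulrA ler_wpM2l.
  apply: (le_lt_trans lo'); have -> : (2 * a n x).+2 = (2 * (a n x).+1)%N by rewrite mulnS.
  by rewrite natrM exprS -mulrA ltr_pM2l.
rewrite leq_eqVlt => /andP[/predU1P[aE _|lt_a a_lt]].
  by rewrite DE /D -aE subrr normr0 exprn_ge0// ltW.
have aE : a n.+1 x = (2 * a n x).+1 by apply/eqP; rewrite eqn_leq a_lt.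
rewrite DE /D aE; apply: increments => //; rewrite -aE; exact: a_le.
Qed.

Let S : R := (1 - r)^-1.

Let S0 : 0 < S. Proof. by rewrite invr_gt0 subr_gt0. Qed.

Let chain n j x : 0 <= x <= 1 -> (n0 <= n)%N ->
  `|g (D (n + j)%N x) - g (D n x)| <= S * (r ^+ n - r ^+ (n + j)).
Proof.
move=> x01 n0n; elim: j => [|j IH]; first by rewrite addn0 !subrr normr0 mulr0.
rewrite addnS (_ : g _ - _ = (g (D (n + j).+1 x) - g (D (n + j) x)) +
  (g (D (n + j) x) - g (D n x))); last by ring.
rewrite (le_trans (ler_normD _ _))//.
have -> : S * (r ^+ n - r ^+ (n + j).+1) = r ^+ (n + j) + S * (r ^+ n - r ^+ (n + j)).
  by rewrite /S exprS; field; rewrite subr_eq0 gt_eqF.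
rewrite lerD// (le_trans (step x01 _)) ?leqW ?(leq_trans n0n) ?leq_addr//.
by rewrite exprS ler_piMl ?exprn_ge0 ?(ltW r0) ?(ltW r1).
Qed.

Let D_cvg x : 0 <= x -> D n x @[n --> \oo] --> x.
Proof.
move=> x0; apply: (@squeeze_cvgr _ _ _ _ (fun n => x - 2^-1 ^+ n) (fun=> x)).
- near=> n; have /andP[lo hi] := a_itv n x0.
  rewrite /D ler_pdivrMr// (mulrC x) lo andbT ler_pdivlMr// mulrBl exprVn mulVf ?gt_eqF//.
  by rewrite lerBlDr (mulrC x) natr1 ltW.
- rewrite -[X in _ --> X]subr0; apply: cvgB; first exact: cvg_cst.
  by apply: cvg_expr; rewrite ger0_norm// invf_lt1// ltr1n.
- exact: cvg_cst.
Unshelve. all: by end_near. Qed.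

Let approx n x : 0 <= x <= 1 -> (n0 <= n)%N -> `|g x - g (D n x)| <= S * r ^+ n.
Proof.
move=> x01 n0n; have /andP[x0 _] := x01.
have : `|g (D m x) - g (D n x)| @[m --> \oo] --> `|g x - g (D n x)|.
  apply: cvg_norm; apply: cvgB; last exact: cvg_cst.
  exact: cvg_comp (D_cvg x0) (cg (x:=x)).
move/cvgr_to_le; apply; exists n => // m /= nm; rewrite -(subnKC nm).
rewrite (le_trans (chain _ x01 n0n))// ler_wpM2l ?(ltW S0)// gerBl exprn_ge0//.
exact: ltW.
Qed.

Let coarse n x y : 0 <= x -> x <= y -> y <= 1 -> y - x <= 2 ^- n -> (n0 <= n)%N ->
  `|g (D n y) - g (D n x)| <= r ^+ n.
Proof.
move=> x0 xy y1 yx n0n; have y0 := le_trans x0 xy.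
have /andP[lo hi] := a_itv n x0; have /andP[lo' hi'] := a_itv n y0.
have : (a n x <= a n y <= (a n x).+1)%N.
  rewrite -ltnS -[X in (_ && X)]ltnS -!(@ltr_nat R); apply/andP; split.
    by apply: le_lt_trans hi'; rewrite (le_trans lo)// ler_wpM2l// ltW.
  apply: (le_lt_trans lo'); rewrite -[(a n x).+2]addn1 natrD.
  have -> : 2 ^+ n * y = 2 ^+ n * x + 2 ^+ n * (y - x) by ring.
  apply: ltr_leD; first exact: hi.
  by rewrite -ler_pdivlMl ?mulr1.
rewrite leq_eqVlt => /andP[/predU1P[aE _|lt_a a_lt]].
  by rewrite /D -aE subrr normr0 exprn_ge0// ltW.
have aE : a n y = (a n x).+1 by apply/eqP; rewrite eqn_leq a_lt.
by rewrite /D aE; apply: increments => //; rewrite -aE; apply: a_le; rewrite y0.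
Qed.

Lemma dyadic_hoelder : exists2 L, 0 <= L & hoelder_with L gam g.
Proof.
have M0 : 0 <= M by exact: le_trans (gM 0).
pose L := (S *+ 2 + 1) * 2 `^ gam + M *+ 2 * (2 ^+ n0) `^ gam.
have L1 : 0 <= (S *+ 2 + 1) * 2 `^ gam by rewrite mulr_ge0 ?powR_ge0// addr_ge0// mulrn_wge0// ltW.
have L2 : 0 <= M *+ 2 * (2 ^+ n0) `^ gam by rewrite mulr_ge0 ?powR_ge0// mulrn_wge0.
exists L; first exact: addr_ge0.
suff H x y : 0 <= x -> x < y -> y <= 1 -> `|g y - g x| <= L * (y - x) `^ gam.
  move=> u v /andP[u0 u1] /andP[v0 v1]; have [uv|vu|->] := ltgtP u v.
  - by rewrite (distrC u) (distrC (g u)) (gtr0_norm (_ : 0 < v - u)) ?subr_gt0// H.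
  - by rewrite (gtr0_norm (_ : 0 < u - v)) ?subr_gt0// H.
  - by rewrite !subrr normr0 mulr_ge0 ?powR_ge0// addr_ge0.
move=> x0 xy y1; have yx0 : 0 < y - x by rewrite subr_gt0.
have y0 : 0 <= y by rewrite (le_trans x0)// ltW.
rewrite /L (mulrDl _ (_ * (_ `^ gam))); have [near|far] := leP (y - x) (2 ^- n0); last first.
  apply: ler_wpDl; first exact: mulr_ge0 L1 (powR_ge0 _ _).
  rewrite (le_trans (ler_normB _ _))// -mulrA -powRM ?(ltW (e2 _)) ?(ltW yx0)//.
  rewrite -[leLHS]mulr1; apply: ler_pM; rewrite ?addr_ge0//.
    by rewrite mulr2n lerD.
  apply: (@le_trans _ _ (1 `^ gam)); first by rewrite powR1.
  apply: ge0_ler_powR; rewrite ?nnegrE ?(ltW gam0) ?mulr_ge0 ?(ltW yx0) ?(ltW (e2 _))//.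
  by rewrite -ler_pdivrMl// mulr1 ltW.
have ex : exists j, (2 ^- j.+1 < y - x)%R.
  exists (Num.truncn (y - x)^-1); rewrite invf_plt ?posrE//.
  have /andP[_ /lt_trans] : (Num.truncn (y - x)^-1)%:R <= (y - x)^-1 < (Num.truncn (y - x)^-1).+1%:R.
    by apply: truncn_itv; rewrite invr_ge0 ltW.
  by apply; rewrite -natrX ltr_nat ltn_expl.
have [n nxy nmin] := ex_minnP ex.
have n0n : (n0 <= n)%N.
  rewrite leqNgt; apply/negP => nn0; move: nxy; apply/negP; rewrite -leNgt.
  by rewrite (le_trans near)// lef_pV2 ?posrE// ler_eXn2l// ltr1n.
have xyn : y - x <= 2 ^- n.
  case: n nmin n0n {nxy} => [_ |n nmin _].
    by rewrite leqn0 => /eqP n00; move: near; rewrite n00.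
  by rewrite leNgt; apply/negP => /nmin; rewrite ltnn.
apply: ler_wpDr; first exact: mulr_ge0 L2 (powR_ge0 _ _).
have -> : g y - g x = (g y - g (D n y)) + (g (D n y) - g (D n x)) - (g x - g (D n x)) by ring.
rewrite -mulrA -powRM ?(ltW yx0)//.
apply: (@le_trans _ _ ((S *+ 2 + 1) * r ^+ n)).
  have -> : (S *+ 2 + 1) * r ^+ n = S * r ^+ n + r ^+ n + S * r ^+ n by ring.
  rewrite (le_trans (ler_normB _ _))// lerD//; last first.
    by apply: approx => //; rewrite x0 ltW// (lt_le_trans xy).
  rewrite (le_trans (ler_normD _ _))// lerD//.
    by apply: approx => //; rewrite y0.
  by apply: coarse => //; exact: ltW.
rewrite ler_wpM2l ?addr_ge0 ?mulrn_wge0 ?(ltW S0)//.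
rewrite -powR_mulrn ?powR_ge0// -powRrM mulrC powRrM.
apply: ge0_ler_powR; rewrite ?nnegrE ?(ltW gam0) ?powR_ge0 ?mulr_ge0 ?(ltW yx0)//.
rewrite powR_mulrn ?invr_ge0// exprVn; move: nxy; rewrite exprS invfM.
by rewrite ltr_pdivrMl// => /ltW.
Qed.

End dyadic_chaining.

(** * Representation *)

Section clamping.
Context {R : realType}.
Local Notation mu := (@lebesgue_measure R).
Implicit Types (f g : R -> R) (a t x : R).

Definition clamp x : R := Num.max 0 (Num.min x 1).

Lemma clamp01 x : 0 <= clamp x <= 1.
Proof. by rewrite le_max lexx ge_max ler01 ge_min lexx orbT. Qed.

Lemma clamp_id x : 0 <= x <= 1 -> clamp x = x.
Proof. by move=> /andP[x0 x1]; rewrite /clamp (min_idPl x1) (max_idPr x0). Qed.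

Lemma continuous_clamp : continuous clamp.
Proof.
have -> : clamp = (fun x => - Num.min (- Num.min x 1) 0).
  by apply/funext => x; rewrite /clamp maxC -{1}[Num.min x 1]opprK -{1}oppr0 -oppr_min.
move=> x; apply: cvgN.
apply: (@continuous_comp _ _ _ (fun x => - Num.min x 1) (fun y => Num.min y 0)).
  by apply: cvgN; exact: continuous_minr.
exact: continuous_minr.
Qed.

Lemma continuous_comp_clamp f : {within `[0, 1], continuous f} -> continuous (f \o clamp).
Proof.
move=> /subspace_continuousP cf x.
have c01 : `[0, 1]%classic (clamp x) by rewrite /= in_itv/= clamp01.
apply: (@cvg_comp _ _ _ clamp f (nbhs x) (within `[0, 1] (nbhs (clamp x)))); last exact: cf.
move=> A wA; have H : \forall y \near x, `[0, 1]%classic (clamp y) -> A (clamp y).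
  exact: continuous_clamp wA.
change (\forall y \near x, A (clamp y)); apply: filterS H => y; apply.
by rewrite /= in_itv/= clamp01.
Qed.

Lemma bounded_comp_clamp f : {within `[0, 1], continuous f} ->
  exists M, forall x, `|(f \o clamp) x| <= M.
Proof.
move=> /continuous_comp_clamp cf.
have cn : {within `[0, 1], continuous (fun x => `|(f \o clamp) x|)}.
  by apply: continuous_subspaceT => x; apply: cvg_norm; exact: cf.
have [c _ cM] := EVT_max ler01 cn; exists `|(f \o clamp) c| => x.
have := cM (clamp x); rewrite in_itv/= clamp01 => /(_ isT).
by rewrite (clamp_id (clamp01 x)).
Qed.

Lemma eq_norm_alpha a f g : (forall x, 0 <= x <= 1 -> f x = g x) ->
  norm_alpha a 1 f = norm_alpha a 1 g.
Proof.
move=> fg; apply: eq_integral => x; rewrite inE/= in_itv/= => x01.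
have /andP[x0 x1] := x01; rewrite fg//; congr (_ + _)%E.
apply: eq_integral => z; rewrite inE/= in_itv/= => /andP[z0 zx].
by rewrite (fg z)// z0 (le_trans zx).
Qed.

Lemma eq_gLS a (f1 f2 g1 g2 : R -> R) :
  (forall x, 0 <= x <= 1 -> f1 x = f2 x) -> (forall x, 0 <= x <= 1 -> g1 x = g2 x) ->
  gLS a 1 f1 g1 = gLS a 1 f2 g2.
Proof.
move=> f12 g12; rewrite /gLS; apply: (congr1 ( *%R _)); apply: eq_Rintegral => x /set_mem.
rewrite /= in_itv/= => x01.
have /andP[x0 x1] := x01; rewrite /frac_left /frac_right f12// !g12 ?ler01 ?lexx//.
congr ((_ + _ * _) * (_ + _ * _)); apply: eq_Rintegral => u; rewrite inE/= in_itv/= => /andP[u0 u1].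
  by rewrite (f12 u)// u0 (le_trans u1).
by rewrite (g12 u)// u1 (le_trans x0).
Qed.

Lemma ler_div_powR (p q c x : R) : 0 < p -> p <= q -> 0 <= c -> 0 <= x <= 1 ->
  c / x `^ p <= c / x `^ q.
Proof.
move=> p0 pq c0 /andP[]; rewrite le_eqVlt => /predU1P[<-|x0] x1.
  by rewrite !powR0 ?gt_eqF// (lt_le_trans p0).
by rewrite ler_wpM2l// lef_pV2 ?posrE ?powR_gt0// ger_powR// x0.
Qed.

Lemma norm_alpha_le (a b : R) f : 0 < a -> a <= b -> measurable_fun setT f ->
  (norm_alpha a 1 f <= norm_alpha b 1 f)%E.
Proof.
move=> a0 ab mf.
have in0 c x : (0 <= \int[mu]_(z in `[0%R, x]) (`|f x - f z| / (x - z) `^ (1 + c))%:E)%E.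
  by apply: integral_ge0 => z _; rewrite lee_fin divr_ge0 ?powR_ge0.
apply: ge0_le_integral; first exact: measurable_itv.
- by move=> x _; rewrite adde_ge0// lee_fin divr_ge0 ?powR_ge0.
- by apply: measurable_funTS; exact: measurable_abs_left.
- by apply: measurable_funTS; exact: measurable_abs_left.
move=> x /=; rewrite in_itv/= => x01; have /andP[x0 x1] := x01.
apply: leeD; first by rewrite lee_fin ler_div_powR.
have mk c : measurable_fun setT (fun z => (`|f x - f z| / (x - z) `^ (1 + c))%:E).
  apply/measurable_EFinP; apply: measurable_funM.
    by apply: measurable_normr_comp; exact: measurable_funB.
  by apply: measurable_invr_comp; apply: measurable_powR_comp; exact: measurable_funB.
apply: ge0_le_integral; first exact: measurable_itv.
- by move=> z _; rewrite lee_fin divr_ge0 ?powR_ge0.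
- by apply: measurable_funTS; exact: mk.
- by apply: measurable_funTS; exact: mk.
move=> z /=; rewrite in_itv/= => /andP[z0 zx]; rewrite lee_fin ler_div_powR ?lerD2l//.
  by rewrite addr_gt0.
by rewrite subr_ge0 zx/= lerBlDr (le_trans x1)// lerDl.
Qed.

End clamping.

Section fBm_hoelder.
Context {R : realType} {d : measure_display} {T : measurableType d}.
Variables (P : probability T R) (F : R -> set (set T)) (H : R) (B : R -> T -> R).
Hypotheses (filtF : is_filtration F) (BfBm : fBm P H F B) (H0 : 0 < H).

Lemma fBm_hoelder : {ae P, forall w, forall q, 0 < q -> q < H ->
  exists2 K, 0 <= K & hoelder_with K q ((B ^~ w) \o clamp)}.
Proof.
pose gam n : R := H - H / n.+2%:R.
have gam0 n : 0 < gam n by rewrite subr_gt0 ltr_pdivrMr// ltr_pMr// ltr1n.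
have gamH n : gam n < H by rewrite gtrBl divr_gt0.
have := ae_foralln (fun n => fBm_dyadic_increments filtF BfBm (gam0 n) (gamH n)).
apply: filterS => w incr q q0 qH.
have [_ _ _ _ /(_ w) cB] := BfBm.
have [M gM] := bounded_comp_clamp cB.
pose n := Num.truncn (H / (H - q)).
have qn : q <= gam n.
  have Hq : 0 < H - q by rewrite subr_gt0.
  have /andP[_ hi] : n%:R <= H / (H - q) < n.+1%:R.
    by apply: truncn_itv; rewrite divr_ge0 ?(ltW H0) ?(ltW Hq).
  rewrite lerBrDr -lerBrDl ler_pdivrMr// mulrC -ler_pdivrMr// (le_trans (ltW hi))//.
  by rewrite ler_nat.
have [n0 incr0] := incr n.
have d01 j k : (k <= 2 ^ j)%N -> 0 <= (k%:R * 2 ^- j : R) <= 1.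
  move=> kj; rewrite mulr_ge0 ?invr_ge0 ?exprn_ge0//= ler_pdivrMr ?exprn_gt0// mul1r.
  by rewrite -natrX ler_nat.
have [] := @dyadic_hoelder _ ((B ^~ w) \o clamp) (gam n) M n0
  (continuous_comp_clamp cB) gM (gam0 n).
  by move=> j k nj kj /=; rewrite !clamp_id ?d01 ?(ltnW kj)//; exact: incr0.
by move=> K K0 gK; exists K => //; exact: hoelder_withW gK.
Qed.

End fBm_hoelder.

Section representation.
Context {R : realType}.
Local Notation mu := (@lebesgue_measure R).

Definition moll_integral (f g : R -> R) (t : R) : R :=
  \int[mu]_(x in `[0, 1]) (f x * moll g t x).

(* Both values are the limit of the same mollified integrals. *)
Lemma moll_integral_gLS_unique (f g : R -> R) (Mf Mg H : R) (a b : R) :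
  continuous f -> (forall x, `|f x| <= Mf) ->
  continuous g -> (forall x, `|g x| <= Mg) ->
  (forall q, 0 < q -> q < H -> exists2 K, 0 <= K & hoelder_with K q g) ->
  H < 1 -> 1 - H < a < 1 -> 1 - H < b < 1 ->
  (norm_alpha a 1 f < +oo)%E -> (norm_alpha b 1 f < +oo)%E ->
  gLS a 1 f g = gLS b 1 f g.
Proof.
move=> cf fM cg gM gH H1.
have main c : 1 - H < c < 1 -> (norm_alpha c 1 f < +oo)%E ->
    moll_integral f g (1 - n.+1%:R^-1) @[n --> \oo] --> gLS c 1 f g.
  move=> /andP[Hc c1] fc; pose dl := (H - (1 - c)) / 3.
  have dl0 : 0 < dl by rewrite divr_gt0// subr_gt0; move: Hc; lra.
  have [||K K0 gK] := gH (1 - c + 2 * dl); [by move: c1; lra|by rewrite /dl; move: Hc; lra|].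
  have [|||C C0 approx] := @moll_integral_approx _ c (1 - c + dl) (1 - c + 2 * dl) K Mf Mg f g
    _ _ _ K0 cf fM fc cg gM gK.
  - by rewrite c1 andbT; move: Hc; lra.
  - by rewrite ltrDl.
  - by lra.
  have e : 1 - c + 2 * dl - (1 - c + dl) = dl by ring.
  rewrite {}e in approx.
  apply/subr_cvg0/norm_cvg0P.
  apply: (@squeeze_cvgr _ _ _ _ (fun=> 0) (fun n => C * (n.+1%:R^-1 `^ dl))).
  - near=> n; rewrite normr_ge0/=; have n0 : 0 < n.+1%:R :> R by [].
    have := approx (1 - n.+1%:R^-1); rewrite (_ : 1 - (1 - n.+1%:R^-1) = n.+1%:R^-1); last by ring.
    apply.
      by rewrite subr_ge0 invf_le1// ler1n.
    by rewrite gtrBl invr_gt0.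
  - exact: cvg_cst.
  - rewrite -[X in _ --> X](mulr0 C); apply: cvgMl_tmp.
    apply: cvg_powR0 => //; first exact: cvg_harmonic.
    by near=> n; rewrite invr_gt0.
move=> aH bH fa fb; have ca := main a aH fa; have cb := main b bH fb.
exact: (cvg_unique _ ca cb).
Unshelve. all: by end_near. Qed.

End representation.

Theorem theorem3p4 (R : realType) (d : measure_display) (Omega : measurableType d)
    (P : probability Omega R) (F : R -> set (set Omega))
    (H : R) (B : R -> Omega -> R) (xi : Omega -> R)
    (Pcomplete : measure_is_complete P)
    (Ffiltration : is_filtration F)
    (Fcomplete : filtration_complete P F)
    (Fleft : filtration_left_continuous F)
    (Hrange : 2^-1 < H < 1)
    (BfBm : fBm P H F B)
    (xiF1 : measurable_wrt (F 1) xi)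
    (representation : exists psi : R -> Omega -> R,
        [/\ adapted F psi,
            continuous_paths psi,
            exists2 alpha : R, 1 - H < alpha &
              {ae P, forall w, (norm_alpha alpha 1 (psi ^~ w) < +oo)%E} &
            {ae P, forall w, is_gLS_integral H 1 (psi ^~ w) (B ^~ w) (xi w)}]) :
  exists a : R, 0 < a /\
    exists z : R -> Omega -> R,
      [/\ adapted F z,
          {ae P, forall w, hoelder01 a (z ^~ w)} &
          z 1 = xi].
Proof.
have [psi [adpsi cpsi [alpha Halpha psi_fin] psi_int]] := representation.
have /andP[H2 H1] := Hrange.
have H0 : 0 < H by rewrite (lt_trans _ H2).
have [adB _ _ _ cB] := BfBm.
pose a' := Num.min alpha (1 - H / 2).
have a'H : 1 - H < a' by rewrite lt_min Halpha/=; move: H0; lra.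
have a'1 : a' < 1 by rewrite gt_min; apply/orP; right; move: H0; lra.
have a'0 : 0 < a' by rewrite (lt_trans _ a'H)// subr_gt0.
pose dl := (H - (1 - a')) / 3.
have dl0 : 0 < dl by rewrite divr_gt0// subr_gt0; move: a'H; lra.
pose q := 1 - a' + 2 * dl.
have q0 : 0 < q by rewrite /q; move: a'1; lra.
have qH : q < H by rewrite /q /dl; move: a'H; lra.
have pq : 1 - a' + dl <= q by rewrite lerD2l ler_peMl ?ler1n// ltW.
have dl1 : dl <= 1 by rewrite /dl; move: a'1 H1; lra.
have q_dl : q - (1 - a' + dl) = dl by rewrite /q; ring.
exists (dl * (q / 4)); split; first by rewrite mulr_gt0// divr_gt0.
pose X x w := psi (clamp x) w; pose Y x w := B (clamp x) w.
have cX w : continuous (X ^~ w) by exact: (@continuous_comp_clamp _ (psi ^~ w) (cpsi w)).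
have cY w : continuous (Y ^~ w) by exact: (@continuous_comp_clamp _ (B ^~ w) (cB w)).
exists (fun t w => if t == 1 then xi w else moll_integral (X ^~ w) (Y ^~ w) t); split.
- move=> t t01; have /andP[t0 t1] := t01.
  have [->|tn1] := eqVneq t 1; first exact: xiF1.
  have {tn1}t1 : t < 1 by rewrite lt_neqAle tn1.
  have [sF _ Finc] := Ffiltration.
  pose Ft : measurableType (F t).-sigma := g_sigma_algebraType (F t).
  have FtE : @measurable _ Ft = F t by exact: measurable_g_measurableTypeE (sF t t01).
  have m_clamp (V : R -> Omega -> R) : adapted F V -> forall x, 0 <= x <= t ->
      @measurable_fun _ _ Ft _ setT (V (clamp x)).
    move=> adV x /andP[x0 xt] _ A mA; rewrite setTI FtE.
    have x1 : x <= 1 by rewrite (le_trans xt)// ltW.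
    rewrite clamp_id ?x0//; apply: (Finc x t) => //; first exact: ltW.
    by apply: adV => //; rewrite x0.
  have := @measurable_moll_integral _ _ Ft X Y t t0 t1 (m_clamp _ adpsi) (m_clamp _ adB) cX cY.
  by move=> mZ A mA; have := mZ measurableT A mA; rewrite setTI FtE.
- have := fBm_hoelder Ffiltration BfBm H0.
  apply: filterS3 psi_fin psi_int => w psi_fin [b [bH b_fin xiE]] gH.
  have [Mf fM] := bounded_comp_clamp (cpsi w).
  have [Mg gM] := bounded_comp_clamp (cB w).
  have eqX x : 0 <= x <= 1 -> X x w = psi x w by move=> x01; rewrite /X clamp_id.
  have eqY x : 0 <= x <= 1 -> Y x w = B x w by move=> x01; rewrite /Y clamp_id.
  have fa : (norm_alpha a' 1 (X ^~ w) < +oo)%E.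
    apply: le_lt_trans psi_fin; rewrite -(eq_norm_alpha alpha eqX).
    apply: norm_alpha_le; [exact: a'0|by rewrite ge_min lexx|].
    exact: continuous_measurable_fun.
  have fb : (norm_alpha b 1 (X ^~ w) < +oo)%E.
    by rewrite (eq_norm_alpha b eqX); exact: b_fin.
  have [K K0 gK] := gH q q0 qH.
  have xiE' : xi w = gLS a' 1 (X ^~ w) (Y ^~ w).
    rewrite xiE -(eq_gLS b eqX eqY).
    apply: (@moll_integral_gLS_unique _ _ _ Mf Mg H b a' (cX w) fM (cY w) gM gH H1 bH _ fb fa).
    by rewrite a'H.
  have [|||C C0 approx] := @moll_integral_approx _ a' (1 - a' + dl) q K Mf Mg
    (X ^~ w) (Y ^~ w) _ _ _ K0 (cX w) fM fa (cY w) gM gK.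
  + by rewrite a'0.
  + by rewrite ltrDl.
  + exact: pq.
  apply: (@hoelder_interpolation _ (X ^~ w) (Y ^~ w) Mf Mg K q C dl) => //.
  + by rewrite q0 (le_trans (ltW qH))// ltW.
  + by rewrite dl0.
  + move=> t t0 t1; rewrite xiE' -q_dl; exact: approx.
- by apply/funext => w; rewrite eqxx.
Qed.
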